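(* Let $\mathcal{M}$ be an LR mesh that is admissible for RM B-splines of bidegree $(1,1)$. Let $s \in \mathbb{N} = \{0,1,2,\ldots\}$, $p = 2s+1$ and $\mathbf{p} = (p,p)$. Let $\mathcal{M}^{(s)}$ be the mesh having the same meshlines as $\mathcal{M}$, with the multiplicity of every internal meshline increased by $s$ and the multiplicity of every boundary meshline increased by $2s$. Then $\mathcal{M}^{(s)}$ is an LR mesh admissible for RM B-splines of bidegree $\mathbf{p}$.
   Context: All meshes are on an axis-aligned rectangle in $\mathbb{R}^2$. Fix a bidegree $\mathbf{p}=(p_1,p_2)$. **Meshes and multiplicities.** A mesh consists of horizontal and vertical segments (meshlines), including the boundary edges of the rectangle, which partition the rectangle into rectangular cells. Each meshline $\gamma$ carries an integer multiplicity $\mu(\gamma)$ with $1\le\mu(\gamma)\le p_k+1$, where $k=1$ for vertical and $k=2$ for horizontal meshlines. A meshline is a boundary meshline if it lies on the boundary of the rectangle, and internal otherwise. A tensor-product mesh is one all of whose meshlines span the whole rectangle. A mesh is open (with respect to $\mathbf{p}$) if its vertical boundary meshlines have multiplicity $p_1+1$ and its horizontal boundary meshlines have multiplicity $p_2+1$. **B-splines and minimal support.** A B-spline $B$ of bidegree $\mathbf{p}$ is the product of two univariate B-splines, with local knot vectors $(x^1\le\dots\le x^{p_1+2})$ and $(y^1\le\dots\le y^{p_2+2})$. Its support is $\operatorname{supp} B=[x^1,x^{p_1+2}]\times[y^1,y^{p_2+2}]$. Its local tensor mesh consists of the segments $\{x^j\}\times[y^1,y^{p_2+2}]$ and $[x^1,x^{p_1+2}]\times\{y^j\}$,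 with the multiplicities with which the values $x^j$, $y^j$ occur in the local knot vectors. These segments must be contained in the mesh, with local multiplicity not exceeding the mesh multiplicity. A meshline traverses $\operatorname{supp} B$ if it crosses the interior of $\operatorname{supp} B$ from one side to the opposite side. $B$ has minimal support on a mesh if its local tensor mesh is formed by $p_1+2$ consecutive vertical and $p_2+2$ consecutive horizontal meshlines, counting multiplicities. That is, no meshline of the mesh traversing $\operatorname{supp} B$ is skipped, in position or in multiplicity, in the local knot vectors of $B$. **LR B-splines and LR meshes** (defined together, recursively). - On a tensor-product mesh, the LR B-splines of bidegree $\mathbf{p}$ are the tensor-product B-splines of bidegree $\mathbf{p}$ on it, and the mesh is an LR mesh. - Given an LR mesh with its LR B-splines, a new LR mesh is obtained either by inserting a new meshline that traverses the support of at least one LR B-spline, or by increasing the multiplicity of an existing meshline, with multiplicities never exceeding $p_k+1$. The LR B-splines on the new mesh are obtained as follows: as long as some B-spline $B$ in the collection does not have minimal support on the new mesh, insert a skipped knot into its local knot vector in the relevant direction $k$, giving $p_k+3$ knots, and replace $B$ by the two B-splines whose local knot vectors in that direction are the first and the last $p_k+2$ of these knots (knot insertion). Repeat until all B-splines in the collection have minimal support. Repeated functions are counted once. A mesh is an LR mesh for bidegree $\mathbf{p}$ if it is generated in this way. **Local linear independence.** A collection of functions is locally linearly independent if it is linearly independent on every open subset of the domain. As usual, this means that for every nonempty open subset $U$ of the domain, the functions of the collection that are not identically zero on $U$ are linearly independent on $U$. **Admissibility.** Let $\mathbf{p}=(p,p)$ with $p=2s+1$, $s\in\mathbb{N}$.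 An LR mesh for bidegree $\mathbf{p}$ is called admissible for RM (Reachable Minimally supported) B-splines of degree $\mathbf{p}$ if: 1. every internal meshline has multiplicity $s+1$ and every boundary meshline has multiplicity $2s+2=p+1$ (so the mesh is open); 2. the meshlines are positioned so that the LR B-splines of bidegree $\mathbf{p}$ on the mesh are locally linearly independent. The LR B-splines of bidegree $\mathbf{p}$ on an admissible mesh are called RM B-splines. *)

(* Defs.v *)
From HB Require Import structures.
From Stdlib Require Import Relation_Operators.
From mathcomp Require Import all_boot all_order all_algebra.
From mathcomp Require Import all_classical all_reals all_analysis.
Set Implicit Arguments.
Unset Strict Implicit.
Unset Printing Implicit Defensive.
Import Order.TTheory GRing.Theory Num.Theory.
Import numFieldNormedType.Exports.
Local Open Scope classical_set_scope.
Local Open Scope ring_scope.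

(* Direction of a meshline.  Vertical meshlines {x} * [lo, hi] give knots for
   the first parameter, horizontal ones [lo, hi] * {y} for the second one, so
   that a direction also designates a parameter. *)
Inductive dir := Vert | Hor.

Definition odir (d : dir) : dir := if d is Vert then Hor else Vert.

Definition sel (T : Type) (d : dir) (a : T * T) : T :=
  if d is Vert then a.1 else a.2.

Definition upd (T : Type) (d : dir) (v : T) (a : T * T) : T * T :=
  if d is Vert then (v, a.2) else (a.1, v).

Record meshline (R : realType) := Meshline {
  mdir : dir; mpos : R; mlo : R; mhi : R }.

(* A mesh on the rectangle with lower left corner [corner0] and upper right
   corner [corner1].  Its meshlines are the [g] with [0 < mult g]; [mult] is 0
   on all other segments. *)
Record mesh (R : realType) := Mesh {
  corner0 : R * R; corner1 : R * R; mult : meshline R -> nat }.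

Section Meshes.
Context {R : realType}.
Implicit Types (M : mesh R) (g : meshline R) (d : dir) (p : nat * nat).

Definition rectangle M : set (R * R) :=
  [set z | forall d, sel d (corner0 M) <= sel d z <= sel d (corner1 M)].

Definition on_meshline g (z : R * R) : Prop :=
  sel (mdir g) z = mpos g /\ mlo g <= sel (odir (mdir g)) z <= mhi g.

Definition skeleton M : set (R * R) :=
  [set z | exists2 g, (0 < mult M g)%N & on_meshline g z].

Definition spanning_line M d (c : R) : meshline R :=
  Meshline d c (sel (odir d) (corner0 M)) (sel (odir d) (corner1 M)).

Definition boundary_meshline M g : Prop :=
  mpos g = sel (mdir g) (corner0 M) \/ mpos g = sel (mdir g) (corner1 M).

Definition open_box (c : (R * R) * (R * R)) : set (R * R) :=
  [set z | forall d, sel d c.1 < sel d z < sel d c.2].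

(* The complement of the meshlines in the rectangle is a finite disjoint union
   of open rectangles; as these are connected, they are exactly the connected
   components of that complement. *)
Definition rectangular_cells M : Prop :=
  exists cells : seq ((R * R) * (R * R)),
    [/\ forall c, c \in cells -> forall d, sel d c.1 < sel d c.2,
        trivIset [set` cells] open_box
      & rectangle M `\` skeleton M = \bigcup_(c in [set` cells]) open_box c].

(* Collinear meshlines are allowed to abut or overlap (a meshline may be
   extended by inserting a longer one); where they overlap, the mesh has the
   largest of their multiplicities, cf. [crosses] below. *)
Definition is_mesh p M : Prop :=
  [/\ forall d, sel d (corner0 M) < sel d (corner1 M),
      finite_set [set g | (0 < mult M g)%N],
      forall g, (0 < mult M g)%N ->
        [/\ sel (mdir g) (corner0 M) <= mpos g <= sel (mdir g) (corner1 M),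
            sel (odir (mdir g)) (corner0 M) <= mlo g,
            mlo g < mhi g,
            mhi g <= sel (odir (mdir g)) (corner1 M)
          & (mult M g <= (sel (mdir g) p).+1)%N],
      forall d, (0 < mult M (spanning_line M d (sel d (corner0 M))))%N /\
                (0 < mult M (spanning_line M d (sel d (corner1 M))))%N
    & rectangular_cells M].

Definition tensor_mesh M : Prop :=
  forall g, (0 < mult M g)%N -> g = spanning_line M (mdir g) (mpos g).

Definition set_mult M g (m : nat) : mesh R :=
  Mesh (corner0 M) (corner1 M)
       (fun g' => if `[< g' = g >] then m else mult M g').

(* The segment in direction [d] at position [c], over the parameter interval
   [lo, hi], is contained in the mesh with multiplicity at least [m].  It may
   be covered by several contiguous meshlines. *)
Definition crosses M d (c lo hi : R) (m : nat) : Prop :=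
  forall t, lo <= t <= hi ->
    exists g, [/\ mdir g = d, mpos g = c, mlo g <= t <= mhi g,
                  (0 < mult M g)%N & (m <= mult M g)%N].

Fixpoint bspline1 (k : nat) (x : seq R) (t : R) : R :=
  if k is q.+1 then
    (t - x`_0) / (x`_q.+1 - x`_0) * bspline1 q x t +
    (x`_q.+2 - t) / (x`_q.+2 - x`_1) * bspline1 q (behead x) t
  else ((x`_0 <= t) && (t < x`_1))%:R.

(* A bivariate B-spline is represented by its pair of local knot vectors (of
   lengths p_1 + 2 and p_2 + 2).  Distinct pairs give distinct functions, so a
   set of such pairs counts repeated B-splines once. *)
Definition knots := (seq R * seq R)%type.
Implicit Types (B : knots) (S : set knots).

Definition bspline p B (z : R * R) : R :=
  bspline1 p.1 B.1 z.1 * bspline1 p.2 B.2 z.2.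

(* The support of B is [supp_lo Vert B, supp_hi Vert B] *
   [supp_lo Hor B, supp_hi Hor B]. *)
Definition supp_lo d B : R := head 0 (sel d B).
Definition supp_hi d B : R := last 0 (sel d B).

Definition local_mesh_in M B : Prop :=
  forall d c, c \in sel d B ->
    crosses M d c (supp_lo (odir d) B) (supp_hi (odir d) B)
            (count_mem c (sel d B)).

Definition traverses g B : Prop :=
  supp_lo (mdir g) B < mpos g < supp_hi (mdir g) B /\
  mlo g <= supp_lo (odir (mdir g)) B /\ supp_hi (odir (mdir g)) B <= mhi g.

(* A traversing line of the mesh is missing from the knot vector, or occurs in
   it with a multiplicity that is too small. *)
Definition skipped M B d (c : R) : Prop :=
  supp_lo d B < c < supp_hi d B /\
  crosses M d c (supp_lo (odir d) B) (supp_hi (odir d) B)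
          (count_mem c (sel d B)).+1.

Definition minimal_support M B : Prop :=
  local_mesh_in M B /\ forall d c, ~ skipped M B d c.

(* The global knot vector of a tensor-product mesh. *)
Definition knot_vector M d (X : seq R) : Prop :=
  sorted <=%R X /\ forall c, count_mem c X = mult M (spanning_line M d c).

Definition tensor_bsplines p (X : knots) : set knots :=
  [set B | forall d, size (sel d B) = (sel d p).+2 /\
                     infix (sel d B) (sel d X)].

Definition insert_knot (c : R) (x : seq R) : seq R := sort <=%R (c :: x).

Definition split_first d (c : R) B : knots :=
  upd d (take (size (sel d B)) (insert_knot c (sel d B))) B.

Definition split_last d (c : R) B : knots :=
  upd d (behead (insert_knot c (sel d B))) B.

Definition split_step M S S' : Prop :=
  exists B d c, [/\ S B, skipped M B d c
    & S' = (S `\ B) `|` [set split_first d c B; split_last d c B]].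

Definition lr_update M S S' : Prop :=
  clos_refl_trans _ (split_step M) S S' /\
  forall B, S' B -> minimal_support M B.

(* [lr_mesh p M S]: M is an LR mesh for bidegree p, with LR B-splines S. *)
Inductive lr_mesh p : mesh R -> set knots -> Prop :=
| LR_tensor M X :
    is_mesh p M -> tensor_mesh M -> (forall d, knot_vector M d (sel d X)) ->
    lr_mesh p M (tensor_bsplines p X)
| LR_insert M S g m S' :
    lr_mesh p M S ->
    ~ crosses M (mdir g) (mpos g) (mlo g) (mhi g) 1 ->
    (0 < m)%N -> (exists2 B, S B & traverses g B) ->
    is_mesh p (set_mult M g m) -> lr_update (set_mult M g m) S S' ->
    lr_mesh p (set_mult M g m) S'
| LR_raise M S g S' :
    lr_mesh p M S -> (0 < mult M g)%N ->
    is_mesh p (set_mult M g (mult M g).+1) ->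
    lr_update (set_mult M g (mult M g).+1) S S' ->
    lr_mesh p (set_mult M g (mult M g).+1) S'.

Definition locally_linearly_independent p M S : Prop :=
  forall U : set (R * R), open U -> U !=set0 -> U `<=` rectangle M ->
  forall (s : seq knots) (a : knots -> R), uniq s ->
    (forall B, B \in s -> S B /\ exists2 z, U z & bspline p B z != 0) ->
    (forall z, U z -> \sum_(B <- s) a B * bspline p B z = 0) ->
    forall B, B \in s -> a B = 0.

Definition rm_multiplicities (s : nat) M : Prop :=
  forall g, (0 < mult M g)%N ->
    (boundary_meshline M g -> mult M g = s.*2.+2) /\
    (~ boundary_meshline M g -> mult M g = s.+1).

(* Admissibility for RM B-splines of bidegree (2s+1, 2s+1).  The collection of
   LR B-splines is quantified universally: the property is required of any
   collection that the refinement procedure can produce on M. *)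
Definition admissible (s : nat) M : Prop :=
  let p := (s.*2.+1, s.*2.+1) in
  [/\ exists S, lr_mesh p M S,
      rm_multiplicities s M
    & forall S, lr_mesh p M S -> locally_linearly_independent p M S].

Definition raise_mesh (s : nat) M : mesh R :=
  Mesh (corner0 M) (corner1 M)
    (fun g => if mult M g == 0%N then 0%N
              else (mult M g + if `[< boundary_meshline M g >]
                               then s.*2 else s)%N).

End Meshes.

(* Main.v *)
(* Every hat function with knots (a, b, e) corresponds to the s+1 B-splines of
   degree p = 2s+1 with knots (a^i, b^(s+1), e^(s+2-i)), its lifts, which have
   the same support.  Knot insertion commutes with this correspondence and is
   confluent, so a run of the refinement procedure for one of the bidegrees
   (1,1), (p,p) yields a run for the other one on the mesh with the same lines.
   Hence M^(s) is an LR mesh, and LR B-splines of bidegree (p,p) on M^(s) are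
   lifts of LR B-splines of bidegree (1,1) on M.

   On a cell, a bilinear B-spline is a multiple of (x - u)(y - v), and its lifts
   form a basis of (x - u)^(s+1) (y - v)^(s+1) P, where P consists of the
   polynomials of bidegree (s,s).  The spaces obtained from the bilinear
   B-splines that are active on the cell span all polynomials of bidegree (p,p):
   this holds on an open tensor-product mesh and is preserved by knot insertion,
   because (x - b)^(s+1) and (x - c)^(s+1) are coprime.  Local linear
   independence for bidegree (1,1) leaves at most 4 active bilinear B-splines,
   hence at most 4 (s+1)^2 = (p+1)^2 active lifts, so these are a basis. *)

Require Import Defs.
From mathcomp Require Import all_boot all_order all_algebra.
From mathcomp Require Import all_classical all_reals all_analysis.
From Stdlib Require Import Relation_Operators.
From mathcomp Require Import zify ring lra.
Set Implicit Arguments.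
Unset Strict Implicit.
Unset Printing Implicit Defensive.
Import Order.TTheory GRing.Theory Num.Theory.
Import numFieldNormedType.Exports.
Local Open Scope classical_set_scope.
Local Open Scope ring_scope.

(** Admissibility quantifies over every collection that some run can produce, and a run for bidegree
    (p,p) may pass through meshes that are not RM: a line may enter with a small multiplicity and be
    raised later. Conversion of runs therefore goes through [rm_mesh], which keeps only the set of
    meshlines: a raise is converted to nothing, an insertion to one with full multiplicity. The two
    collections are not matched exactly during a conversion. The invariant is one-sided: each shadow
    of a current B-spline can be split into members of the other collection. Confluence makes this
    survive any order of splits, and it supplies the B-spline that a new line has to traverse. Local
    independence for (1,1) is applied to the collection that the converted run produces on M. The
    (p,p)-collection enters only as a subset of the lifts; the other lifts get coefficient 0.
    Spanning is stated dually, through linear forms that annihilate, so that a decomposition F = F1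
    + F2 of one factor is used by bilinearity alone. *)

Lemma odirK : involutive odir. Proof. by case. Qed.

Lemma dirP (d d' : dir) : d' = d \/ d' = odir d.
Proof. by case: d d' => -[]; [left|right|right|left]. Qed.

Lemma sel_upd T d (v : T) a : sel d (upd d v a) = v.
Proof. by case: d. Qed.

Lemma sel_updC T d (v : T) a : sel (odir d) (upd d v a) = sel (odir d) a.
Proof. by case: d. Qed.

Lemma upd_sel T d (a : T * T) : upd d (sel d a) a = a.
Proof. by case: d a => -[]. Qed.

Lemma upd_upd T d (v w : T) a : upd d v (upd d w a) = upd d v a.
Proof. by case: d. Qed.

Lemma upd_updC T d (v w : T) a :
  upd (odir d) w (upd d v a) = upd d v (upd (odir d) w a).
Proof. by case: d. Qed.

(** * Knot insertion *)

Section KnotInsertion.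
Context {R : realType}.
Implicit Types (x y A E : seq R) (a c e : R).

Definition knot_first c x : seq R := take (size x) (insert_knot c x).
Definition knot_last c x : seq R := behead (insert_knot c x).

Lemma insert_knot_sorted c x : sorted <=%R (insert_knot c x).
Proof. exact: (sort_sorted (@le_total _ _)). Qed.

Lemma perm_insert_knot c x : perm_eq (insert_knot c x) (c :: x).
Proof. by rewrite perm_sort. Qed.

Lemma size_insert_knot c x : size (insert_knot c x) = (size x).+1.
Proof. by rewrite size_sort. Qed.

Lemma insert_knot_eq c x y :
  sorted <=%R y -> perm_eq y (c :: x) -> insert_knot c x = y.
Proof.
move=> sy pxy; apply: (sorted_eq le_trans le_anti) => //.
  exact: insert_knot_sorted.
by rewrite (permPl (perm_insert_knot _ _)) perm_sym.
Qed.

Lemma insert_knotC c1 c2 x :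
  insert_knot c1 (insert_knot c2 x) = insert_knot c2 (insert_knot c1 x).
Proof.
apply: insert_knot_eq; first exact: insert_knot_sorted.
rewrite (permPl (perm_insert_knot _ _)) perm_sym.
apply/permP => f /=; have /permP -> := perm_insert_knot c2 x.
by have /permP /= -> := perm_insert_knot c1 x; rewrite addnCA.
Qed.

Lemma sorted_catP x y :
  sorted <=%R (x ++ y) <->
  [/\ sorted <=%R x, sorted <=%R y & {in x & y, forall a c, a <= c}].
Proof.
rewrite (sorted_pairwise le_trans) pairwise_cat -!(sorted_pairwise le_trans).
split=> [/and3P[/allrelP h -> ->]|[-> -> h]]; first by split=> // a c; apply: h.
by rewrite !andbT; apply/allrelP.
Qed.

Lemma insert_knot_cat c A E : sorted <=%R (A ++ E) ->
  {in A, forall a, a <= c} -> {in E, forall e, c <= e} ->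
  insert_knot c (A ++ E) = A ++ c :: E.
Proof.
move=> /sorted_catP[sA sE AE] Ac Ec; apply: insert_knot_eq.
  apply/sorted_catP; split=> //=.
    rewrite (path_sortedE le_trans) sE andbT; exact/allP.
  by move=> a e aA; rewrite inE => /predU1P[->|]; [exact: Ac|exact: AE].
by rewrite perm_catC /= perm_cons perm_catC.
Qed.

Lemma insert_knot_cons c a x : sorted <=%R (a :: x) -> a <= c ->
  insert_knot c (a :: x) = a :: insert_knot c x.
Proof.
move=> /= sx ac; apply: insert_knot_eq => /=.
  rewrite (path_sortedE le_trans) insert_knot_sorted andbT.
  apply/allP => y; rewrite (perm_mem (perm_insert_knot c x)) inE.
  case/predU1P => [->//|]; move: sx; rewrite (path_sortedE le_trans).
  by case/andP => /allP h _ /h.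
apply/permP => f /=; have /permP /= -> := perm_insert_knot c x.
by rewrite addnCA.
Qed.

Lemma sorted_rconsP x e : sorted <=%R (rcons x e) <->
  sorted <=%R x /\ {in x, forall a, a <= e}.
Proof.
rewrite -cats1 sorted_catP; split=> [[sx _ h]|[sx h]].
  by split=> // a ax; apply: h => //; rewrite inE.
by split=> // a c ax; rewrite inE => /eqP ->; exact: h.
Qed.

Lemma insert_knot_rcons c x e : sorted <=%R (rcons x e) -> c <= e ->
  insert_knot c (rcons x e) = rcons (insert_knot c x) e.
Proof.
move=> /sorted_rconsP[sx xe] ce; apply: insert_knot_eq => /=.
  apply/sorted_rconsP; split; first exact: insert_knot_sorted.
  move=> a; rewrite (perm_mem (perm_insert_knot c x)) inE.
  by case/predU1P => [->//|]; exact: xe.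
apply/permP => f; rewrite -!cats1 !count_cat /= ?count_cat /=.
by have /permP /= -> := perm_insert_knot c x; rewrite -addnA.
Qed.

(* All the combinatorics of knot insertion is read off this normal form. *)
Lemma knot_splitP c x : sorted <=%R x -> head 0 x < c < last 0 x ->
  exists a A E e, [/\ x = a :: A ++ rcons E e, a < c < e,
    {in A, forall u, u <= c}, {in E, forall u, c < u} &
    insert_knot c x = a :: A ++ c :: rcons E e].
Proof.
move=> sx xc; pose A := [seq u <- x | u <= c]; pose E := [seq u <- x | c < u].
have Ac : {in A, forall u, u <= c} by move=> u; rewrite mem_filter => /andP[].
have Ec : {in E, forall u, c < u} by move=> u; rewrite mem_filter => /andP[].
have xE : x = A ++ E.
  apply: (sorted_eq le_trans le_anti) => //.
    apply/sorted_catP; split.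
    - by apply: sorted_filter => //; exact: le_trans.
    - by apply: sorted_filter => //; exact: le_trans.
    - by move=> a e /Ac ac /Ec /ltW; apply: le_trans.
  rewrite perm_sym; have -> : E = [seq u <- x | ~~ (u <= c)].
    by apply: eq_filter => u; rewrite ltNge.
  exact/permPl/perm_filterC.
have iE : insert_knot c x = A ++ c :: E.
  by rewrite xE insert_knot_cat -?xE // => u /Ec/ltW.
move: xc iE; rewrite xE.
case: A Ac {xE} => [|a A] Ac; case/lastP: E Ec => [|E e] Ec.
- by move=> /= /andP[c0 /(lt_trans c0)]; rewrite ltxx.
- rewrite cat0s last_rcons => /andP[+ _].
  by case: E Ec => [|u E] Ec /= uc; have := Ec _ (mem_head _ _);
    rewrite ltNge (ltW uc).
- rewrite cats0 => /andP[_ +].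
  by have := Ac _ (mem_last a A) => /= lc /(le_lt_trans lc); rewrite ltxx.
- rewrite last_cat last_rcons => /= ace ->; exists a, A, E, e.
  split=> // [u uA|u uE]; first by apply: Ac; rewrite inE uA orbT.
  by apply: Ec; rewrite mem_rcons inE uE orbT.
Qed.
End KnotInsertion.

(** * The two children of a local knot vector *)

Section KnotChildren.
Context {R : realType}.
Implicit Types (x y A E : seq R) (a c e : R).

Definition inner_knot c x : bool := head 0 x < c < last 0 x.

Definition knot_child c x y : Prop := y = knot_first c x \/ y = knot_last c x.

Lemma knot_childP c x : sorted <=%R x -> inner_knot c x ->
  exists a A E e, [/\ x = a :: A ++ rcons E e, a < c < e,
    {in A, forall u, u <= c} /\ {in E, forall u, c < u},
    knot_first c x = a :: A ++ c :: E &
    knot_last c x = A ++ c :: rcons E e].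
Proof.
move=> sx xc; have [a [A [E [e [xE ace Ac Ec iE]]]]] := knot_splitP sx xc.
exists a, A, E, e; split=> //; rewrite /knot_first /knot_last iE //=.
have -> : size x = (size (a :: A ++ c :: E)).
  by rewrite xE /= !size_cat /= size_rcons.
have -> : a :: A ++ c :: rcons E e = rcons (a :: A ++ c :: E) e.
  by rewrite -!cats1 /= -catA.
by rewrite -cats1 take_size_cat.
Qed.

Section Child.
Variables (c : R) (x y : seq R).
Hypotheses (sx : sorted <=%R x) (xc : inner_knot c x) (xy : knot_child c x y).

Lemma size_knot_child : size y = size x.
Proof.
have [a [A [E [e [xE _ _ fE lE]]]]] := knot_childP sx xc.
by case: xy => ->; rewrite ?fE ?lE xE /= !size_cat /= size_rcons ?addnS.
Qed.

Lemma sorted_knot_child : sorted <=%R y.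
Proof.
by case: xy => ->; [apply: take_sorted|rewrite /knot_last -drop1; apply: drop_sorted];
  exact: insert_knot_sorted.
Qed.

Lemma knot_child_hull :
  [/\ head 0 x <= head 0 y, head 0 y < last 0 y & last 0 y <= last 0 x].
Proof.
have [a [A [E [e [xE /andP[ac ce] [Ac Ec] fE lE]]]]] := knot_childP sx xc.
move: sx; rewrite xE -cat_cons => /sorted_catP[saA /sorted_rconsP[sE Ee] _].
have lc : c <= last c E <= e.
  case/lastP: E Ee Ec {fE lE xE sE} => [|E u] Ee Ec /=; first by rewrite lexx ltW.
  rewrite last_rcons (ltW (Ec _ _)) ?Ee // mem_rcons mem_head //.
have hc : a <= head 0 (A ++ c :: rcons E e) <= c.
  case: (A) saA Ac => [|u B] /=; first by rewrite lexx ltW.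
  by case/andP => -> _ -> //; rewrite mem_head.
case/andP: hc => h1 h2; case/andP: lc => l1 l2.
case: xy => ->; rewrite ?fE ?lE ?last_cat /= ?last_cat /= ?last_rcons; split=> //.
  exact: lt_le_trans l1.
exact: le_lt_trans ce.
Qed.

Lemma mem_knot_child : {subset y <= c :: x}.
Proof.
move=> u uy; rewrite -(perm_mem (perm_insert_knot c x)).
by move: uy; case: xy => ->; [exact: mem_take|exact: mem_behead].
Qed.

Lemma count_knot_child_le q :
  (count_mem q y <= count_mem q x + (q == c))%N.
Proof.
have [a [A [E [e [xE _ _ fE lE]]]]] := knot_childP sx xc.
case: xy => ->; rewrite ?fE ?lE xE /= !count_cat /= -cats1 count_cat /=
  [c == q]eq_sym; clear; lia.
Qed.

(** An interior point of a child differs from the end knot that was dropped, so no copy of it is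
    lost. *)
Lemma count_knot_child q : inner_knot q y ->
  count_mem q y = (count_mem q x + (q == c))%N.
Proof.
have [hx hy ly] := knot_child_hull => /andP[hq ql].
have [a [A [E [e [xE _ _ fE lE]]]]] := knot_childP sx xc.
have qa : (a == q) = false.
  by apply/negbTE; move: hx; rewrite {1}xE /=; apply: contraTneq => ->;
   rewrite leNgt hq.
have qe : (e == q) = false.
  by apply/negbTE; move: ly; rewrite {1}xE /= last_cat last_rcons;
  apply: contraTneq => ->; rewrite leNgt ql.
case: xy => ->; rewrite ?fE ?lE xE /= !count_cat /= -cats1 count_cat /=
  [c == q]eq_sym qa qe; clear; lia.
Qed.

Lemma inner_knot_child q : inner_knot q y -> inner_knot q x.
Proof.
have [hx _ lx] := knot_child_hull => /andP[hq ql]; apply/andP; split.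
  exact: le_lt_trans hq.
exact: lt_le_trans lx.
Qed.

End Child.

(** Both children can miss [g] only if [x] reads a, c, ..., c, e and [g] is [c]: then [c] is an end
    of each child. The bound on the multiplicity of [c] excludes this. *)
Lemma knot_child_cover c g x : sorted <=%R x -> inner_knot c x -> inner_knot g x ->
  ((count_mem c x).+2 < size x)%N -> exists2 y, knot_child c x y & inner_knot g y.
Proof.
move=> sx xc /andP[hg gl] cx.
have [a [A [E [e [xE /andP[ac ce] [Ac Ec] fE lE]]]]] := knot_childP sx xc.
have ag : a < g by move: hg; rewrite xE.
have ge : g < e by move: gl; rewrite xE /= last_cat last_rcons.
have [gE|Eg] := ltP g (last c E).
  exists (knot_first c x); first by left.
  by rewrite fE /inner_knot /= last_cat /= ag gE.
have [gA|Ag] := ltP (head 0 (A ++ c :: rcons E e)) g.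
  exists (knot_last c x); first by right.
  by rewrite lE /inner_knot gA last_cat /= last_rcons.
move: sx; rewrite xE -cat_cons => /sorted_catP[saA _ _].
have E0 : E = [::].
  case/lastP: E Eg Ec {fE lE xE} Ag => // E u; rewrite last_rcons => ug Ec Ag.
  have := Ec u; rewrite mem_rcons mem_head => /(_ isT) cu; exfalso.
  have {}Ag : g <= c.
    by move: Ag Ac; case: (A) => //= v B gv vc; rewrite (le_trans gv) ?vc ?mem_head.
  by have := lt_le_trans cu ug; rewrite ltNge Ag.
have cA : count_mem c A = size A.
  apply/eqP; rewrite -all_count; apply/allP => u uA /=; rewrite eq_le Ac //=.
  move: Ag Eg saA uA; rewrite E0; case: (A) => //= v B gv cg /andP[_].
  rewrite (path_sortedE le_trans) inE => /andP[/allP vB _] /predU1P[->|/vB /= h].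
    exact: le_trans gv.
  exact: le_trans (le_trans cg gv) h.
by move: cx; rewrite xE E0 /= size_cat count_cat /= cA; clear; lia.
Qed.

Section Windows.
Variables (c1 c2 : R) (x : seq R).
Hypotheses (sx : sorted <=%R x) (xc1 : inner_knot c1 x) (xc2 : inner_knot c2 x).

Let L := insert_knot c2 (insert_knot c1 x).

(** [L] has two knots more than [x], hence three windows of the length of [x]. The children of the
    first child are the first two windows; if [c2] lies at or beyond the last knot of that child,
    the child is itself the first window. *)
Lemma knot_first_window (y := knot_first c1 x) :
  if c2 < last 0 y
  then knot_first c2 y = take (size x) L /\
       knot_last c2 y = take (size x) (behead L)
  else y = take (size x) L.
Proof.
have [a [A [E [e [xE /andP[ac ce] _ _ iE]]]]] := knot_splitP sx xc1.
have iF : insert_knot c1 x = rcons y e.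
  rewrite /y /knot_first iE.
  have -> : a :: A ++ c1 :: rcons E e = rcons (a :: A ++ c1 :: E) e.
    by rewrite -!cats1 /= -catA.
  by rewrite -cats1 take_size_cat ?cats1 // xE /= !size_cat /= size_rcons.
have sy : size y = size x.
  by apply/eqP; rewrite -eqSS -(size_rcons y e) -iF size_insert_knot.
have srt : sorted <=%R (rcons y e) by rewrite -iF insert_knot_sorted.
have c2e : c2 <= e.
  by case/andP: xc2 => _; rewrite xE /= last_cat last_rcons => /ltW.
have LE : L = rcons (insert_knot c2 y) e.
  by rewrite /L iF insert_knot_rcons.
case: ltP => [c2l|lc2].
  rewrite LE /knot_first /knot_last sy; case def : (insert_knot c2 y) => [|u z] /=.
    by have := size_insert_knot c2 y; rewrite def.
  have sz : size z = size x.
    by have := size_insert_knot c2 y; rewrite def /= sy => -[].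
  rewrite -rcons_cons -!cats1 takel_cat; last by rewrite /= sz.
  by split=> //; rewrite takel_cat -?sz // take_size.
have /sorted_rconsP[srty _] := srt.
have iy : insert_knot c2 y = rcons y c2.
  apply: insert_knot_eq; last by rewrite perm_rcons.
  apply/sorted_rconsP; split=> // u uy; apply: le_trans lc2.
  move: uy srty; case/lastP: (y) => // s v; rewrite last_rcons mem_rcons inE.
  by move=> /predU1P[->//|us] /sorted_rconsP[_]; exact.
by rewrite LE iy -!cats1 -catA take_size_cat.
Qed.

Lemma knot_last_window (y := knot_last c1 x) :
  if head 0 y < c2
  then knot_first c2 y = take (size x) (behead L) /\
       knot_last c2 y = behead (behead L)
  else y = behead (behead L).
Proof.
have [a [A [E [e [xE /andP[ac ce] _ _ iE]]]]] := knot_splitP sx xc1.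
have iF : insert_knot c1 x = a :: y by rewrite /y /knot_last iE.
have sy : size y = size x.
  by apply/eqP; rewrite -eqSS -[(size y).+1]/(size (a :: y)) -iF size_insert_knot.
have srt : sorted <=%R (a :: y) by rewrite -iF insert_knot_sorted.
have c2a : a <= c2 by case/andP: xc2; rewrite xE /= => /ltW.
have LE : L = a :: insert_knot c2 y by rewrite /L iF insert_knot_cons.
case: ltP => [c2l|lc2]; first by rewrite LE /knot_first /knot_last sy.
have srty := path_sorted srt.
rewrite LE (_ : insert_knot c2 y = c2 :: y) //=; apply: insert_knot_eq => //=.
rewrite (path_sortedE le_trans) srty andbT; apply/allP => u uy.
apply: le_trans lc2 _; move: uy srty; case: (y) => //= v s.
rewrite (path_sortedE le_trans) inE => /predU1P[->//|us] /andP[/allP h _].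
exact: h.
Qed.

(** The middle window is always reached through a child for [c1]: through the last one if [c1 < c2],
    through the first one if [c2 < c1]. *)
Lemma windows_overlap : c1 != c2 ->
  (c2 < last 0 (knot_first c1 x)) || (head 0 (knot_last c1 x) < c2).
Proof.
have [a [A [E [e [xE /andP[ac ce] [Ac Ec] fE lE]]]]] := knot_childP sx xc1.
rewrite fE lE /= last_cat /=; case: (ltgtP c1 c2) => // c12 _.
  apply/orP; right; case: (A) Ac => //= u B Ac; apply: le_lt_trans c12.
  by rewrite Ac ?mem_head.
apply/orP; left; apply: lt_le_trans c12 _.
case/lastP: (E) Ec => //= B u Ec; rewrite last_rcons.
by apply/ltW/Ec; rewrite mem_rcons mem_head.
Qed.

End Windows.

(* Two different knots may be inserted in either order: the children for c2
   of x are obtained from the windows of the knot vector refined by both. *)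
Lemma knot_child_exchange (P : seq R -> Prop) c1 c2 x :
  sorted <=%R x -> inner_knot c1 x -> inner_knot c2 x -> c1 != c2 ->
  (forall y, knot_child c1 x y -> P y) ->
  (forall y z, knot_child c1 x y -> inner_knot c2 y -> knot_child c2 y z -> P z) ->
  (forall y, knot_child c2 x y -> inner_knot c1 y ->
     P (knot_first c1 y) -> P (knot_last c1 y) -> P y) ->
  forall y, knot_child c2 x y -> P y.
Proof.
move=> sx xc1 xc2 c12 P1 P12 PS.
set L := insert_knot c2 (insert_knot c1 x).
have F1 : knot_child c1 x (knot_first c1 x) by left.
have L1 : knot_child c1 x (knot_last c1 x) by right.
have hF1 : head 0 (knot_first c1 x) < c2.
  have [a [A [E [e [xE _ _ fE _]]]]] := knot_childP sx xc1.
  by rewrite fE; case/andP: xc2; rewrite {1}xE.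
have lL1 : c2 < last 0 (knot_last c1 x).
  have [a [A [E [e [xE _ _ _ lE]]]]] := knot_childP sx xc1.
  by case/andP: xc2 => _; rewrite lE {1}xE /= !last_cat /= !last_rcons.
have := knot_first_window sx xc1 xc2; have := knot_last_window sx xc1 xc2.
rewrite /= -/L => hL hF.
have [w0 w1] : P (take (size x) L) /\ (c2 < last 0 (knot_first c1 x) ->
    P (take (size x) (behead L))).
  move: hF; case: ifP => [i2 [<- <-]|i2 <-]; last by split=> //; exact: P1.
  by split=> [|_]; apply: (P12 _ _ F1); rewrite /inner_knot ?hF1 //; [left|right].
have [w2 w1'] : P (behead (behead L)) /\ (head 0 (knot_last c1 x) < c2 ->
    P (take (size x) (behead L))).
  move: hL; case: ifP => [i2 [<- <-]|i2 <-]; last by split=> //; exact: P1.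
  by split=> [|_]; apply: (P12 _ _ L1); rewrite /inner_knot ?lL1 ?i2 //;
    [right|left].
have {w1 w1'}w1 : P (take (size x) (behead L)).
  by have /orP[/w1|/w1'] := windows_overlap sx xc1 c12.
(* [P] now holds on all three windows. As [L] is symmetric in the two knots, the same windows
   describe the children for [c2] and their children for [c1]. *)
move: (knot_first_window sx xc2 xc1) (knot_last_window sx xc2 xc1).
rewrite /= (insert_knotC c1 c2) -/L => {}hF {}hL.
have hF2 : head 0 (knot_first c2 x) < c1.
  have [a [A [E [e [xE _ _ fE _]]]]] := knot_childP sx xc2.
  by rewrite fE; case/andP: xc1; rewrite {1}xE.
have lL2 : c1 < last 0 (knot_last c2 x).
  have [a [A [E [e [xE _ _ _ lE]]]]] := knot_childP sx xc2.
  by case/andP: xc1 => _; rewrite lE {1}xE /= !last_cat /= !last_rcons.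
move=> y [->|->].
  move: hF; case: ifP => [i2 [f l]|i2 -> //].
  by apply: PS; rewrite ?f ?l // /inner_knot ?hF2 //; left.
move: hL; case: ifP => [i2 [f l]|i2 -> //].
by apply: PS; rewrite ?f ?l // /inner_knot ?lL2 ?andbT //; right.
Qed.

End KnotChildren.

(** * Splitting B-splines on a mesh *)

Section Splitting.
Context {R : realType}.
Implicit Types (M N : mesh R) (B : @knots R) (S : set (@knots R)) (g : meshline R).

Lemma crossesW M N d c lo hi lo' hi' m m' :
  (forall g, (mult M g <= mult N g)%N) -> lo <= lo' -> hi' <= hi ->
  (m' <= m)%N -> crosses M d c lo hi m -> crosses N d c lo' hi' m'.
Proof.
move=> MN lol hih mm cr t /andP[lt th].
have [|g [gd gc gt g0 gm]] := cr t.
  by rewrite (le_trans lol lt) (le_trans th hih).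
exists g; split=> //; first exact: leq_trans (MN g).
exact: leq_trans mm (leq_trans gm (MN g)).
Qed.

(** What splitting preserves. Minimality is left out, since it is reached only at the end of an
    update. *)
Definition well_placed (p : nat * nat) M B : Prop :=
  (forall d, [/\ size (sel d B) = (sel d p).+2, sorted <=%R (sel d B)
                & supp_lo d B < supp_hi d B]) /\ local_mesh_in M B.

Definition split_child d c B B' : Prop :=
  B' = split_first d c B \/ B' = split_last d c B.

Lemma split_childP d c B B' : split_child d c B B' <->
  exists2 y, knot_child c (sel d B) y & B' = upd d y B.
Proof.
split=> [[->|->]|[y [->|->] ->]]; [| |by left|by right].
  by exists (knot_first c (sel d B)) => //; left.
by exists (knot_last c (sel d B)) => //; right.
Qed.

Lemma split_child_supp d c B B' :
  sorted <=%R (sel d B) -> inner_knot c (sel d B) -> split_child d c B B' ->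
  forall d', supp_lo d' B <= supp_lo d' B' /\ supp_hi d' B' <= supp_hi d' B.
Proof.
move=> sB cB /split_childP[y cy ->] d'; rewrite /supp_lo /supp_hi.
have [->|->] := dirP d d'; last by rewrite sel_updC.
by rewrite sel_upd; have [] := knot_child_hull sB cB cy.
Qed.

Lemma skipped_split_child M B d c d' c' B' :
  sorted <=%R (sel d' B) -> inner_knot c' (sel d' B) ->
  split_child d' c' B B' -> skipped M B d c -> inner_knot c (sel d B') ->
  (d = d' -> c != c') -> skipped M B' d c.
Proof.
move=> sB cB BB' [cI cr] cI' dd'; split=> //.
have [lo hi] := split_child_supp sB cB BB' (odir d).
apply: crossesW cr => //; rewrite ltnS.
move/split_childP : BB' => [y cy B'E]; rewrite B'E; case: (dirP d' d) => dE.
  rewrite dE sel_upd; apply: leq_trans (count_knot_child_le sB cB cy c) _.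
  by rewrite (negbTE (dd' dE)) addn0.
by rewrite dE sel_updC.
Qed.

Lemma well_placed_child p M B d c B' : well_placed p M B -> skipped M B d c ->
  split_child d c B B' -> well_placed p M B'.
Proof.
move=> [wB lB] [cI cr] BB'; have [_ sB _] := wB d.
have supp := split_child_supp sB cI BB'.
have /split_childP[y cy B'E] := BB'; split.
  move=> d'; rewrite /supp_lo /supp_hi B'E; have [->|->] := dirP d d'.
    rewrite sel_upd (size_knot_child sB cI cy) (sorted_knot_child cy).
    by have [_ ? _] := knot_child_hull sB cI cy; case: (wB d).
  by rewrite sel_updC; exact: wB.
move=> d' c' c'B'; have [lo hi] := supp (odir d').
move: c'B'; rewrite B'E; have [->|->] := dirP d d'; last first.
  rewrite sel_updC -B'E => /lB; apply: crossesW => //.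
  by have [] := supp (odir (odir d)).
  by have [] := supp (odir (odir d)).
rewrite sel_upd -B'E => c'y.
have [lo' hi'] := supp (odir d).
have := count_knot_child_le sB cI cy c'; case: (eqVneq c' c) => [->|c'c].
  by rewrite addn1 => le; apply: crossesW cr.
rewrite addn0 => le; apply: crossesW (lB d c' _) => //.
by have := mem_knot_child cy c'y; rewrite inE (negbTE c'c).
Qed.

(** A splitting tree whose leaves lie in [S]. Unlike a run, it follows a single B-spline and ignores
    the rest of the collection, so that confluence can re-root it at any child. *)
Inductive reach M S : @knots R -> Prop :=
| reach_leaf B : S B -> reach M S B
| reach_split B d c : skipped M B d c ->
    reach M S (split_first d c B) -> reach M S (split_last d c B) ->
    reach M S B.

(* Confluence of knot insertion. *)
Lemma reach_child M S B d c B' :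
  (forall B, S B -> forall d c, ~ skipped M B d c) ->
  (forall d, sorted <=%R (sel d B)) -> reach M S B ->
  skipped M B d c -> split_child d c B B' -> reach M S B'.
Proof.
move=> minS sB rB; elim: rB d c B' sB => [{}B SB d c B' _ /(minS _ SB)//|].
move=> {}B d1 c1 sk1 r1 IH1 r2 IH2 d c B' sB sk BB'.
have [I1 _] := sk1; have [I _] := sk.
have r B1 : split_child d1 c1 B B1 -> reach M S B1 by case=> ->.
have IH B1 B2 : split_child d1 c1 B B1 -> skipped M B1 d c ->
    split_child d c B1 B2 -> reach M S B2.
  move=> B1c; have /split_childP[y cy B1E] := B1c.
  have sB1 d' : sorted <=%R (sel d' B1).
    rewrite B1E; have [->|->] := dirP d1 d'; last by rewrite sel_updC.
    by rewrite sel_upd; apply: sorted_knot_child cy.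
  by move: B1c sB1 => -[->|->] sB1; [apply: IH1|apply: IH2].
have /split_childP[y cy B'E] := BB'.
have [dE|dE] := dirP d1 d.
  case: (eqVneq c1 c) => [cE|c1c]; first by apply: r; rewrite -dE cE.
  rewrite B'E; pose P y := reach M S (upd d y B).
  apply: (@knot_child_exchange _ P c1 c (sel d B)) cy => //.
  - by rewrite dE.
  - by move=> z cz; apply: r; apply/split_childP; exists z; rewrite -dE.
  - move=> z w cz cI wz.
    have zB : split_child d1 c1 B (upd d z B).
      by apply/split_childP; exists z; rewrite -dE.
    apply: (IH _ _ zB).
      apply: skipped_split_child zB sk _ _ => //; first by rewrite sel_upd.
      by rewrite eq_sym.
    by apply/split_childP; exists w; rewrite ?sel_upd ?upd_upd.
  - move=> z cz c1I Pf Pl.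
    apply: (@reach_split _ _ _ d c1); rewrite /split_first /split_last;
      rewrite ?sel_upd ?upd_upd //.
    have zB : split_child d c B (upd d z B).
      by apply/split_childP; exists z.
    apply: (skipped_split_child _ _ zB) => //; first by rewrite dE.
    by rewrite sel_upd.
(* Insertions in different directions commute: the children of [B'] for [c1] are children, for [c],
   of the children of [B], to which the induction hypotheses apply. *)
have skB' : skipped M B' d1 c1.
  apply: (skipped_split_child _ _ BB') => //.
    by rewrite B'E dE -[d1 in sel d1]odirK sel_updC odirK.
  by rewrite dE; case: (d1).
have sel1 z : sel d1 (upd d z B) = sel d1 B.
  by rewrite dE -[d1 in sel d1]odirK sel_updC odirK.
have commute z : upd d1 z B' = upd d y (upd d1 z B).
  by rewrite B'E dE upd_updC.
have key z : knot_child c1 (sel d1 B) z -> reach M S (upd d1 z B').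
  move=> cz; have zB : split_child d1 c1 B (upd d1 z B).
    by apply/split_childP; exists z.
  rewrite commute; apply: (IH _ _ zB).
    apply: (skipped_split_child _ _ zB) => //; first by rewrite dE sel_updC -dE.
    by rewrite dE; case: (d1).
  by apply/split_childP; exists y; rewrite ?dE ?sel_updC -?dE.
apply: (reach_split skB'); rewrite /split_first /split_last;
  rewrite (_ : sel d1 B' = sel d1 B) ?B'E ?sel1 // -B'E.
  by apply: key; left.
by apply: key; right.
Qed.

Lemma reach_trans M N S S' B :
  (forall g, (mult M g <= mult N g)%N) ->
  reach M S B -> (forall B, S B -> reach N S' B) -> reach N S' B.
Proof.
move=> MN rB SS'; elim: rB => {}B; first exact: SS'.
move=> d c [cI cr] _ IH1 _ IH2; apply: (reach_split _ IH1 IH2).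
by split=> //; apply: crossesW cr.
Qed.

Lemma reach_refinement M S S' B :
  clos_refl_trans _ (split_step M) S S' -> S B -> reach M S' B.
Proof.
move=> SS'; elim: SS' B => {S S'}[S S' SS'|S|S1 S2 S3 _ IH1 _ IH2] B.
- have [B0 [d [c [SB0 sk ->]]]] := SS' => SB; have [->|BB0] := pselect (B = B0).
    apply: (reach_split sk); apply: reach_leaf; right; first by left.
    by right.
  by apply: reach_leaf; left.
- exact: reach_leaf.
- by move=> /IH1 /reach_trans; apply.
Qed.

(** Descend the splitting tree. A split in the direction of [g] leaves the position of [g] interior
    to one of the children by [knot_child_cover]; a split in the other direction only shortens the
    side that [g] has to cross. *)
Lemma reach_traverses p M S g B :
  (forall B d c, well_placed p M B -> skipped M B d c ->
     ((count_mem c (sel d B)).+2 < size (sel d B))%N) ->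
  well_placed p M B -> reach M S B -> traverses g B ->
  exists2 B', S B' & traverses g B'.
Proof.
move=> small wB rB; elim: rB wB => {}B; first by move=> SB _; exists B.
move=> d c sk _ IH1 _ IH2 wB gB.
suff [B' BB' gB'] : exists2 B', split_child d c B B' & traverses g B'.
  have wB' := well_placed_child wB sk BB'.
  by move: BB' gB' wB' => -[->|->] gB' wB'; [apply: IH1|apply: IH2].
have [[[_ sB _] [cI _]] [gI [lg hg]]] := (wB.1 d, sk, gB).
have [dE|dE] := dirP d (mdir g).
  have gI' : inner_knot (mpos g) (sel d B) by rewrite -dE.
  have [y cy yI] := knot_child_cover sB cI gI' (small _ _ _ wB sk).
  exists (upd d y B); first by apply/split_childP; exists y.
  rewrite /traverses /supp_lo /supp_hi dE sel_upd sel_updC; split=> //.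
  by rewrite dE in lg hg.
have BB' : split_child d c B (split_first d c B) by left.
exists (split_first d c B) => //; split.
  by rewrite /supp_lo /supp_hi dE sel_updC -dE.
have [lo hi] := split_child_supp sB cI BB' (odir (mdir g)).
by split; [apply: le_trans lg lo|apply: le_trans hi hg].
Qed.

End Splitting.

(** * B-splines contained in a mesh, and invariants of the refinement procedure *)

Section WellPlaced.
Context {R : realType}.
Implicit Types (M N : mesh R) (B : @knots R) (S : set (@knots R)) (g : meshline R).

Lemma well_placedW p M N B : (forall g, (mult M g <= mult N g)%N) ->
  well_placed p M B -> well_placed p N B.
Proof. by move=> MN [wB lB]; split=> // d c /lB; apply: crossesW. Qed.

Lemma well_placed_line p M B d c : well_placed p M B -> c \in sel d B ->
  exists g, [/\ mdir g = d, mpos g = c, (0 < mult M g)%N &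
                (count_mem c (sel d B) <= mult M g)%N].
Proof.
move=> [wB lB] /lB /(_ (supp_lo (odir d) B)); have [_ _ lh] := wB (odir d).
by rewrite lexx ltW // => /(_ isT) [g []]; exists g.
Qed.

Lemma well_placed_range p M B d c : is_mesh p M -> well_placed p M B ->
  c \in sel d B -> sel d (corner0 M) <= c <= sel d (corner1 M).
Proof.
move=> [_ _ Mg _ _] wB /(well_placed_line wB)[g [<- <- g0 _]].
by have [] := Mg _ g0.
Qed.

Lemma mem_head_last (x : seq R) : head 0 x < last 0 x ->
  head 0 x \in x /\ last 0 x \in x.
Proof. by case: x => [|a x] /=; rewrite ?ltxx // mem_head mem_last. Qed.

Lemma inner_knot_range p M B d c : is_mesh p M -> well_placed p M B ->
  inner_knot c (sel d B) -> sel d (corner0 M) < c < sel d (corner1 M).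
Proof.
move=> MM wB /andP[hc cl]; have [hx lx] := mem_head_last (lt_trans hc cl).
have /andP[l0 _] := well_placed_range MM wB hx.
have /andP[_ l1] := well_placed_range MM wB lx.
by rewrite (le_lt_trans l0 hc) (lt_le_trans cl l1).
Qed.

Lemma inner_line_internal p M B g : is_mesh p M -> well_placed p M B ->
  inner_knot (mpos g) (sel (mdir g) B) -> ~ boundary_meshline M g.
Proof.
move=> MM wB /(inner_knot_range MM wB) gI bg; move: gI.
by case: bg => ->; rewrite ltxx ?andbF.
Qed.

Definition internal_mult_le (k : nat) M : Prop :=
  forall g, ~ boundary_meshline M g -> (mult M g <= k)%N.

Lemma skipped_count p k M B d c : is_mesh p M -> internal_mult_le k M ->
  well_placed p M B -> skipped M B d c -> (count_mem c (sel d B) < k)%N.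
Proof.
move=> MM Mk wB [cI cr]; have [_ _ lh] := wB.1 (odir d).
have [|g [gd gc _ _ gm]] := cr (supp_lo (odir d) B); first by rewrite lexx ltW.
apply: leq_trans gm (Mk g _); apply: (inner_line_internal MM wB).
by rewrite gd gc.
Qed.

Lemma mesh_positions p M : is_mesh p M ->
  exists P : seq R, forall g, (0 < mult M g)%N -> mpos g \in P.
Proof.
move=> [_ Mfin _ _ _].
have /finite_seqP[P PE] := finite_image (@mpos R) Mfin.
exists P => g g0; have : [set` P] (mpos g) by rewrite -PE; exists g.
by [].
Qed.

(** All copies of a value strictly between the two ends of a contiguous window lie in the window. *)
Lemma infix_sandwich (x X : seq R) : sorted <=%R X -> infix x X ->
  forall c, inner_knot c x -> count_mem c x = count_mem c X.
Proof.
move=> + /infixP[l1 [l2 XE]] c /andP[hc cl].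
rewrite XE => /sorted_catP[_ /sorted_catP[_ _ xl2] l1x].
have [hx lx] := mem_head_last (lt_trans hc cl).
have c1 : c \notin l1.
  apply/negP => cl1; have := l1x c (head 0 x) cl1.
  by rewrite mem_cat hx => /(_ isT); rewrite leNgt hc.
have c2 : c \notin l2.
  by apply/negP => cl2; have := xl2 (last 0 x) c lx cl2; rewrite leNgt cl.
by rewrite !count_cat (count_memPn c1) (count_memPn c2) addn0.
Qed.

Lemma sorted_head_le (x : seq R) c : sorted <=%R x -> c \in x -> head 0 x <= c.
Proof.
case: x => // a x /=; rewrite (path_sortedE le_trans) inE => /andP[/allP h _].
by move=> /predU1P[->//|/h].
Qed.

Lemma sorted_le_last (x : seq R) c : sorted <=%R x -> c \in x -> c <= last 0 x.
Proof.
case/lastP: x => // x a /sorted_rconsP[_ h].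
by rewrite last_rcons mem_rcons inE => /predU1P[->//|/h].
Qed.

Lemma knot_vector_range p M d X c : is_mesh p M -> knot_vector M d X ->
  c \in X -> sel d (corner0 M) <= c <= sel d (corner1 M).
Proof.
move=> [_ _ Mg _ _] [_ XM] cX.
by have [] := Mg (spanning_line M d c); rewrite // -XM -has_count has_pred1.
Qed.

(** The support is nondegenerate because p_k + 2 equal knots would exceed the largest multiplicity
    p_k + 1 of a meshline. *)
Lemma tensor_well_placed p M X B : is_mesh p M ->
  (forall d, knot_vector M d (sel d X)) -> tensor_bsplines p X B ->
  well_placed p M B.
Proof.
move=> MM XM tB; have [_ _ Mg _ _] := MM.
have sX d : sorted <=%R (sel d X) by case: (XM d).
have sub d : subseq (sel d B) (sel d X) by have [_ /infixW] := tB d.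
have sB d : sorted <=%R (sel d B) := subseq_sorted le_trans (sub d) (sX d).
have lh d : supp_lo d B < supp_hi d B.
  have [szB _] := tB d; rewrite /supp_lo /supp_hi lt_neqAle.
  case def: (sel d B) (sB d) szB => [|a x] //= sax szB.
  have ax : {in x, forall u, a <= u}.
    by move: sax; rewrite (path_sortedE le_trans) => /andP[/allP].
  apply/andP; split; last first.
    by case/lastP: x ax {def sax szB} => //= x e ax; rewrite last_rcons ax // mem_rcons mem_head.
  apply/eqP => al.
  have call : count_mem a (a :: x) = size (a :: x).
    apply/eqP; rewrite -all_count; apply/allP => u /= uax.
    have ul := sorted_le_last (sax : sorted <=%R (a :: x)) uax.
    rewrite eq_le (sorted_head_le (sax : sorted <=%R (a :: x)) uax) andbT.
    by rewrite [leRHS]al.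
  have := leq_count_subseq (pred1 a) (sub d).
  rewrite def call; have [_ ->] := XM d; rewrite /= szB => h.
  have [|_ _ _ _] := Mg (spanning_line M d a); first exact: leq_trans h.
  by move/(leq_trans h); rewrite /= ltnn.
split; first by move=> d; have [? _] := tB d.
move=> d c cB t /andP[lt th].
have rng d' u : u \in sel d' B -> sel d' (corner0 M) <= u <= sel d' (corner1 M).
  by move=> /(mem_subseq (sub d')) /(knot_vector_range MM (XM d')).
have [hx lx] := mem_head_last (lh (odir d)).
have /andP[l0 _] := rng _ _ hx; have /andP[_ l1] := rng _ _ lx.
exists (spanning_line M d c); have [_ <-] := XM d.
split=> //=; first by rewrite (le_trans l0 lt) (le_trans th l1).
  by rewrite -has_count has_pred1 (mem_subseq (sub d)).
exact: leq_count_subseq.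
Qed.

Lemma tensor_minimal p M X B d c : is_mesh p M -> tensor_mesh M ->
  (forall d, knot_vector M d (sel d X)) -> tensor_bsplines p X B ->
  ~ skipped M B d c.
Proof.
move=> MM tM XM tB [cI cr]; have wB := tensor_well_placed MM XM tB.
have [_ _ lh] := wB.1 (odir d); have [_ ix] := tB d; have [sX XE] := XM d.
have [|g [gd gc _ g0]] := cr (supp_lo (odir d) B); first by rewrite lexx ltW.
by rewrite (infix_sandwich sX ix cI) XE (tM g g0) gd gc ltnn.
Qed.

Lemma split_steps_well_placed p M S S' :
  clos_refl_trans _ (split_step M) S S' ->
  (forall B, S B -> well_placed p M B) -> forall B, S' B -> well_placed p M B.
Proof.
elim => {S S'} [S S'|S|S1 S2 S3 _ IH1 _ IH2] //; last by move=> /IH1/IH2.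
move=> [B0 [d [c [SB0 sk ->]]]] wS B [[SB _]|BB]; first exact: wS.
exact: well_placed_child (wS _ SB0) sk BB.
Qed.

Lemma lr_mesh_inv p M S : lr_mesh p M S ->
  is_mesh p M /\ forall B, S B -> well_placed p M B /\ minimal_support M B.
Proof.
elim=> {M S} [M X MM tM XM|M S g m S' _ [MM wS] ncr m0 _ MM' [st mS']|
              M S g S' _ [MM wS] g0 MM' [st mS']]; split=> // B.
- move=> tB; have wB := tensor_well_placed MM XM tB; split=> //.
  by split=> [|d c]; [case: wB|exact: (tensor_minimal MM tM XM tB)].
- move=> S'B; split; last exact: mS'.
  apply: (split_steps_well_placed st) S'B => B0 /wS[wB _].
  apply: well_placedW wB => g' /=; case: asboolP => // ->.
  (* A line that is already in the mesh covers itself, against the insertion condition; so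
     [set_mult] cannot lower a multiplicity here. *)
  have [->//|] := eqVneq (mult M g) 0%N; rewrite -lt0n => g0.
  exfalso; apply: ncr => t tg.
  by exists g; split.
- move=> S'B; split; last exact: mS'.
  apply: (split_steps_well_placed st) S'B => B0 /wS[wB _].
  by apply: well_placedW wB => g' /=; case: asboolP => // ->.
Qed.

Lemma tensor_bsplines_finite p (X : @knots R) : finite_set (tensor_bsplines p X).
Proof.
pose I (x : seq R) := [seq take k (drop j x) | k <- iota 0 (size x).+1, j <- iota 0 (size x).+1].
have inI (x y : seq R) : infix x y -> x \in I y.
  move=> /infixP[l1 [l2 ->]]; apply/allpairsP; exists (size x, size l1).
  split; last by rewrite /= drop_size_cat // take_size_cat.
    by rewrite mem_iota !size_cat [_.1]/=; clear; lia.
  by rewrite mem_iota !size_cat [_.2]/=; clear; lia.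
apply: (@sub_finite_set _ _ [set` [seq (x, y) | x <- I X.1, y <- I X.2]]).
  move=> -[x y] tB; apply/allpairsP; exists (x, y); split=> //; apply: inI.
    by have [] := tB Vert.
  by have [] := tB Hor.
exact: finite_seq.
Qed.

(** * Termination of the splitting procedure *)

Section Termination.
Variables (p : nat * nat) (M : mesh R).
Hypothesis MM : is_mesh p M.
Variable (P : seq R).
Hypothesis PM : forall g, (0 < mult M g)%N -> mpos g \in P.

(** A termination measure: the room for further knots at the positions of meshlines interior to the
    support. Inserting [c] either fills some room at [c] or moves [c] out of the interior; since
    mesh multiplicities are at most p_k + 1, the room at a skipped knot is positive. *)
Definition deficiency d (x : seq R) : nat :=
  \sum_(q <- P | inner_knot q x) ((sel d p).+2 - count_mem q x).

Lemma deficiency_child B d c y :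
  well_placed p M B -> skipped M B d c -> knot_child c (sel d B) y ->
  (deficiency d y < deficiency d (sel d B))%N.
Proof.
move=> wB [cI cr] cy; have [_ _ lh] := wB.1 (odir d); have [_ sB _] := wB.1 d.
have [|g [gd gc _ g0 gm]] := cr (supp_lo (odir d) B); first by rewrite lexx ltW.
have [_ _ Mg _ _] := MM; have [_ _ _ _ gp] := Mg _ g0.
have cP : c \in P by rewrite -gc PM.
have cp : (count_mem c (sel d B) < (sel d p).+1)%N.
  by rewrite -gd; apply: leq_trans gp; rewrite gd.
rewrite /deficiency big_mkcond [X in (_ < X)%N]big_mkcond /=.
rewrite (big_rem c cP) [X in (_ < X)%N](big_rem c cP) /=.
rewrite (cI : inner_knot c (sel d B)) -addSn.
apply: leq_add; last first.
  apply: leq_sum => q _; case: ifP => // qy.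
  rewrite (inner_knot_child sB cI cy qy) (count_knot_child sB cI cy qy).
  by rewrite leq_sub2l // leq_addr.
case: ifP => [cIy|_]; last by rewrite subn_gt0 (ltn_trans cp).
by rewrite (count_knot_child sB cI cy cIy) eqxx addn1 subSS -subSn // ltnW.
Qed.

Definition total_deficiency B : nat :=
  deficiency Vert (sel Vert B) + deficiency Hor (sel Hor B).

Lemma total_deficiency_child B d c B' :
  well_placed p M B -> skipped M B d c -> split_child d c B B' ->
  (total_deficiency B' < total_deficiency B)%N.
Proof.
move=> wB sk /split_childP[y cy ->]; have := deficiency_child wB sk cy.
by case: d sk cy => sk cy; rewrite /total_deficiency /= ?ltn_add2r ?ltn_add2l.
Qed.

(* The sum of the weights 3 ^ total_deficiency decreases at each split, since
   3 ^ k is replaced by at most 2 * 3 ^ k.-1. *)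
Lemma lr_update_exists (l : seq (seq R * seq R)) :
  (forall B, B \in l -> well_placed p M B) ->
  exists l' : seq (seq R * seq R), lr_update M [set` l] [set` l'].
Proof.
pose W (l : seq (seq R * seq R)) := (\sum_(B <- l) 3 ^ total_deficiency B)%N.
have [n] := ubnP (W l); elim: n l => // n IHn l Wl wl.
have [[B [d [c [Bl sk]]]]|nosk] :=
  pselect (exists B d c, B \in l /\ skipped M B d c); last first.
  exists l; split=> [|B Bl]; first exact: rt_refl.
  have [_ lB] := wl B Bl; split=> // d c sk; apply: nosk.
  by exists B, d, c.
pose f := split_first d c B; pose g := split_last d c B.
pose l1 := f :: g :: [seq B' <- l | B' != B].
have fB : split_child d c B f by left.
have gB : split_child d c B g by right.
have wB := wl _ Bl.
have [||l' [st ml']] := IHn l1.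
- move: Wl; rewrite ltnS /W /l1 !big_cons big_filter (bigID (pred1 B)) /=.
  apply: leq_trans; rewrite addnA -addSn leq_add2r (big_rem B) //= eqxx.
  apply: leq_trans (leq_addr _ _).
  have := total_deficiency_child wB sk fB.
  have := total_deficiency_child wB sk gB.
  case: (total_deficiency B) => // k; rewrite !ltnS => kg kf.
  have p3 := expn_gt0 3 k.
  have : (3 ^ total_deficiency f <= 3 ^ k)%N by rewrite leq_exp2l.
  have : (3 ^ total_deficiency g <= 3 ^ k)%N by rewrite leq_exp2l.
  by rewrite expnS; move: p3; clear; lia.
- move=> B'; rewrite !inE mem_filter => /or3P[/eqP->|/eqP->|/andP[_ /wl //]].
    exact: well_placed_child wB sk fB.
  exact: well_placed_child wB sk gB.
exists l'; split=> //; apply: rt_trans st; apply: rt_step.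
exists B, d, c; split=> //; apply/seteqP; split=> B' /=.
  rewrite !inE mem_filter => /or3P[/eqP->|/eqP->|/andP[/eqP BB' B'l]].
  - by right; left.
  - by right; right.
  - by left.
rewrite !inE mem_filter => -[[B'l /eqP ->]|[->|->]]; rewrite ?eqxx ?orbT //.
by rewrite B'l !orbT.
Qed.

End Termination.
End WellPlaced.

(** * From one bidegree to another *)

Section RMMeshes.
Context {R : realType}.
Implicit Types (M N : mesh R) (B : @knots R) (S : set (@knots R)) (g : meshline R).

Definition rm_degree (t : nat) : nat * nat := (t.*2.+1, t.*2.+1).

Lemma sel_rm_degree d t : sel d (rm_degree t) = t.*2.+1.
Proof. by case: d. Qed.

(** Depends on [M] only through its set of meshlines. The same map thus serves both directions of
    the conversion and identifies the meshes of a run that differ only in multiplicities. *)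
Definition rm_mesh t M : mesh R :=
  Mesh (corner0 M) (corner1 M)
    (fun g => if mult M g == 0%N then 0%N
              else if `[< boundary_meshline M g >] then t.*2.+2 else t.+1).

Lemma rm_mesh_gt0 t M g : (0 < mult (rm_mesh t M) g)%N = (0 < mult M g)%N.
Proof. by rewrite /=; case: (mult M g) => //= n; case: ifP. Qed.

Lemma rm_mesh_multiplicities t M : rm_multiplicities t (rm_mesh t M).
Proof.
move=> g; rewrite rm_mesh_gt0 lt0n => /negbTE /= ->.
by split=> h; case: asboolP.
Qed.

Lemma mesh_eq M N : corner0 M = corner0 N -> corner1 M = corner1 N ->
  (forall g, mult M g = mult N g) -> M = N.
Proof. by case: M N => [a b f] [a' b' f'] /= -> -> /funext ->. Qed.

Lemma rm_mesh_id t M : rm_multiplicities t M -> rm_mesh t M = M.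
Proof.
move=> rm; apply: mesh_eq => //= g; case: eqP => [->//|/eqP].
by rewrite -lt0n => /rm[b i]; case: asboolP => [/b|/i].
Qed.

Lemma rm_mesh_rm_mesh s t M : rm_mesh s (rm_mesh t M) = rm_mesh s M.
Proof.
by apply: mesh_eq => // g; rewrite /= -leqn0 leqNgt (rm_mesh_gt0 t M) lt0n negbK.
Qed.

Lemma raise_mesh_rm_mesh s M : rm_multiplicities 0 M ->
  raise_mesh s M = rm_mesh s M.
Proof.
move=> rm; apply: mesh_eq => //= g; case: eqP => // /eqP; rewrite -lt0n.
by move=> /rm[b i]; case: asboolP => [/b|/i] ->; rewrite ?addnS ?add0n.
Qed.

Lemma rm_mesh_raise t M g : (0 < mult M g)%N ->
  rm_mesh t (set_mult M g (mult M g).+1) = rm_mesh t M.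
Proof.
move=> g0; apply: mesh_eq => //= g'; case: asboolP => // ->.
by rewrite (gtn_eqF g0).
Qed.

Lemma rm_mesh_insert t M g m : (0 < m)%N -> ~ boundary_meshline M g ->
  rm_mesh t (set_mult M g m) = set_mult (rm_mesh t M) g t.+1.
Proof.
move=> m0 ig; apply: mesh_eq => //= g'; case: asboolP => // ->.
by rewrite (gtn_eqF m0); case: asboolP.
Qed.

Lemma internal_mult_le_rm_mesh t M : internal_mult_le t.+1 (rm_mesh t M).
Proof. by move=> g ig /=; case: eqP => //; case: asboolP. Qed.

Lemma is_mesh_rm_mesh p t M : is_mesh p M -> is_mesh (rm_degree t) (rm_mesh t M).
Proof.
move=> [cM Mfin Mg Msp [cells [c0 c1 c2]]]; split=> //.
- apply: sub_finite_set Mfin => g /=.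
  by rewrite -/(mult (rm_mesh t M) g) rm_mesh_gt0.
- move=> g; rewrite rm_mesh_gt0 => /Mg[-> -> -> -> _].
  rewrite sel_rm_degree; split=> //=; case: eqP => // _; case: ifP => // _.
  by rewrite -doubleS -addnn ltn_addr.
- by move=> d; rewrite !rm_mesh_gt0; exact: Msp.
exists cells; split=> //; rewrite -c2; congr (_ `\` _).
by apply/seteqP; split=> z [g g0 zg]; exists g => //; move: g0;
  rewrite rm_mesh_gt0.
Qed.

Lemma rm_mesh_crosses t M d c lo hi :
  sel d (corner0 M) < c < sel d (corner1 M) -> crosses M d c lo hi 1 ->
  crosses (rm_mesh t M) d c lo hi t.+1.
Proof.
move=> cI cr u /cr[g [gd gc gu g0 _]]; exists g; split=> //.
  by rewrite rm_mesh_gt0.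
rewrite /= (gtn_eqF g0); case: asboolP => //= bg; move: cI.
by case: bg; rewrite gd gc => ->; rewrite ltxx ?andbF.
Qed.

Lemma rm_mesh_crosses1 t M d c lo hi :
  crosses (rm_mesh t M) d c lo hi 1 -> crosses M d c lo hi 1.
Proof.
move=> cr u /cr[g [gd gc gu]]; rewrite rm_mesh_gt0 => g0 _.
by exists g.
Qed.

Definition blow t (X : seq R) : seq R := flatten [seq nseq t.+1 c | c <- X].

Lemma blow_cat t X Y : blow t (X ++ Y) = blow t X ++ blow t Y.
Proof. by rewrite /blow map_cat flatten_cat. Qed.

Lemma blow0 X : blow 0 X = X.
Proof. by rewrite /blow /=; exact: flatten_seq1. Qed.

Lemma blow_cons t a X : blow t (a :: X) = nseq t.+1 a ++ blow t X.
Proof. by []. Qed.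

Lemma mem_blow t X c : (c \in blow t X) = (c \in X).
Proof.
elim: X => // a X IH.
by rewrite blow_cons mem_cat mem_nseq IH in_cons.
Qed.

Lemma count_blow t X c : count_mem c (blow t X) = (t.+1 * count_mem c X)%N.
Proof.
elim: X => [|a X IH]; first by rewrite muln0.
by rewrite blow_cons count_cat IH count_nseq /= mulnDr [X in (X + _)%N]mulnC.
Qed.

Lemma sorted_nseq n (a : R) : sorted <=%R (nseq n a).
Proof. by case: n => // n /=; elim: n => //= n ->; rewrite lexx. Qed.

Lemma sorted_blow t X : sorted <=%R X -> sorted <=%R (blow t X).
Proof.
elim: X => // a X IH sX; rewrite blow_cons.
have /andP[/allP h {}sX] : all (>= a) X && sorted <=%R X.
  by rewrite -(path_sortedE le_trans).
 apply/sorted_catP.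
split; [exact: sorted_nseq|exact: IH|].
by move=> u v; rewrite mem_nseq mem_blow => /= /eqP -> /h.
Qed.

(** The end values already occur once in [undup X]; the extra copy at each end yields multiplicity
    2(t+1) there, against t+1 inside. *)
Definition rm_knot_vector t M d (X : seq R) : seq R :=
  blow t (sel d (corner0 M) :: rcons (undup X) (sel d (corner1 M))).

Lemma rm_knot_vectorP p t M d X : is_mesh p M -> tensor_mesh M ->
  knot_vector M d X -> knot_vector (rm_mesh t M) d (rm_knot_vector t M d X).
Proof.
move=> MM tM XM; have [sX XE] := XM; have [cM _ _ Msp _] := MM.
have rng c : c \in X -> sel d (corner0 M) <= c <= sel d (corner1 M).
  exact: knot_vector_range MM XM.
split.
  apply: sorted_blow; rewrite /= (path_sortedE le_trans); apply/andP; split.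
    apply/allP => c; rewrite mem_rcons inE mem_undup => /predU1P[->|].
      by rewrite ltW // cM.
    by case/rng/andP.
  apply/sorted_rconsP; split.
    by apply: subseq_sorted sX; [exact: le_trans|exact: undup_subseq].
  by move=> c; rewrite mem_undup => /rng/andP[].
move=> c; rewrite count_blow /= -cats1 count_cat /= addn0.
rewrite count_uniq_mem ?undup_uniq // mem_undup -has_pred1 has_count XE.
have [c0 c1] := Msp d.
have -> : `[< boundary_meshline M (spanning_line M d c) >] =
    (sel d (corner0 M) == c) || (sel d (corner1 M) == c).
  rewrite ![_ == c]eq_sym; apply/asboolP/orP => /= -[e|e].
  - by left; apply/eqP.
  - by right; apply/eqP.
  - by left; apply/eqP.
  - by right; apply/eqP.
case: eqVneq => [<-|c0c].
  rewrite (gt_eqF (cM d)) addn0 c0 /=; rewrite (gtn_eqF c0) /=; lia.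
case: eqVneq => [<-|c1c]; first by rewrite c1 (gtn_eqF c1) /=; lia.
by case: (mult _ _) => [|k] /=; lia.
Qed.

(** Normalised runs: every mesh on the way has RM multiplicities, so a line enters at once with
    multiplicity t+1 and is never raised. *)
Inductive rm_chain t : mesh R -> set (@knots R) -> Prop :=
| rm_tensor M X : is_mesh (rm_degree t) M -> tensor_mesh M ->
    rm_multiplicities t M -> (forall d, knot_vector M d (sel d X)) ->
    rm_chain t M (tensor_bsplines (rm_degree t) X)
| rm_insert M S g S' : rm_chain t M S ->
    ~ crosses M (mdir g) (mpos g) (mlo g) (mhi g) 1 ->
    ~ boundary_meshline M g -> (exists2 B, S B & traverses g B) ->
    is_mesh (rm_degree t) (set_mult M g t.+1) ->
    lr_update (set_mult M g t.+1) S S' -> rm_chain t (set_mult M g t.+1) S'.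

Lemma rm_chain_lr_mesh t M S : rm_chain t M S -> lr_mesh (rm_degree t) M S.
Proof.
elim=> {M S}[M X MM tM _ XM|M S g S' _ lrM ncr _ tr MM' up].
  exact: LR_tensor.
exact: LR_insert lrM ncr _ tr MM' up.
Qed.

Lemma rm_chain_multiplicities t M S : rm_chain t M S -> rm_multiplicities t M.
Proof.
elim=> {M S}[//|M S g S' _ rm ncr ig _ _ _ g'] /=.
by case: asboolP => [->|_]; [split|exact: rm].
Qed.

Inductive knot_desc (k : nat) (c : R) (x : seq R) : seq R -> Prop :=
| knot_desc_refl : knot_desc k c x x
| knot_desc_step y z : knot_desc k c x y -> inner_knot c y ->
    (count_mem c y < k)%N -> knot_child c y z -> knot_desc k c x z.

(** A line of multiplicity t+1 stays skipped as long as fewer than t+1 copies of it are present, so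
    confluence applies to each insertion of the chain. *)
Lemma reach_desc t M S B d c y0 y lo hi :
  (forall B, S B -> forall d c, ~ skipped M B d c) ->
  crosses M d c lo hi t.+1 ->
  lo <= supp_lo (odir d) B -> supp_hi (odir d) B <= hi ->
  knot_desc t.+1 c y0 y ->
  well_placed (rm_degree t) M (upd d y0 B) /\ reach M S (upd d y0 B) ->
  well_placed (rm_degree t) M (upd d y B) /\ reach M S (upd d y B).
Proof.
move=> minS cr lo_ _hi; elim=> // {}y z _ IH cI cy yz /IH[wB rB].
have sk : skipped M (upd d y B) d c.
  split; rewrite /supp_lo /supp_hi ?sel_upd //.
  by apply: crossesW cr; rewrite ?sel_updC.
have ch : split_child d c (upd d y B) (upd d z B).
  by apply/split_childP; exists z; rewrite ?sel_upd ?upd_upd.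
split; first exact: well_placed_child wB sk ch.
by apply: reach_child rB sk ch => // d'; have [] := wB.1 d'.
Qed.

(* [sh x y] associates with the local knot vectors x of degree 2s+1 local knot
   vectors y of degree 2t+1 that keep track of x through knot insertion. *)
Record shadow (s t : nat) (sh : seq R -> seq R -> Prop) : Prop := Shadow {
  shadow_tensor (c0 c1 : R) (X x y : seq R) : sorted <=%R X ->
    {in X, forall c, c0 <= c <= c1} ->
    (forall c, c0 < c < c1 -> (count_mem c X <= s.+1)%N) ->
    c0 \in X -> c1 \in X -> c0 < c1 ->
    size x = s.*2.+3 -> head 0 x < last 0 x -> infix x X -> sh x y ->
    size y = t.*2.+3 /\ infix y (blow t (c0 :: rcons (undup X) c1));
  shadow_child (c : R) (x x' y : seq R) : size x = s.*2.+3 ->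
    sorted <=%R x -> inner_knot c x -> (count_mem c x < s.+1)%N ->
    knot_child c x x' -> sh x' y -> exists2 y0, sh x y0 & knot_desc t.+1 c y0 y;
  shadow_supp (x y : seq R) : size x = s.*2.+3 -> sorted <=%R x -> sh x y ->
    head 0 x <= head 0 y /\ last 0 y <= last 0 x;
  shadow_cover (c : R) (x : seq R) : size x = s.*2.+3 -> sorted <=%R x ->
    inner_knot c x -> exists2 y, sh x y & inner_knot c y }.

(** * Conversion of a run from degree 2s+1 to degree 2t+1 *)

Section Conversion.
Variables (s t : nat) (sh : seq R -> seq R -> Prop).
Hypothesis shP : shadow s t sh.

(** The invariant of the conversion, with [S] the collection of the given run and [S1] that of the
    converted one. It asks for splitting trees instead of membership, because shadows of members of
    [S] may still have to be split. *)
Definition reach_shadows N S S1 : Prop := forall B B1, S B ->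
  (forall d, sh (sel d B) (sel d B1)) ->
  well_placed (rm_degree t) (rm_mesh t N) B1 /\ reach (rm_mesh t N) S1 B1.

(** The target [S1] is already fully refined and stays fixed while [S] is split. A shadow of a child
    descends from a shadow of its parent by insertions of the same knot, and confluence keeps
    descendants reachable. *)
Lemma reach_shadows_split N S S' S1 : is_mesh (rm_degree s) N ->
  internal_mult_le s.+1 N ->
  (forall B, S1 B -> forall d c, ~ skipped (rm_mesh t N) B d c) ->
  clos_refl_trans _ (split_step N) S S' ->
  (forall B, S B -> well_placed (rm_degree s) N B) ->
  reach_shadows N S S1 -> reach_shadows N S' S1.
Proof.
move=> NN Ns minS1; elim=> {S S'}[S S'|//|Sa Sb Sc st IH1 _ IH2 wS rS]; last first.
  by apply: IH2 (IH1 wS rS) => B; exact: (split_steps_well_placed st wS).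
move=> [B0 [d [c [SB0 sk ->]]]] wS rS B B1 [[SB _]|BB0] shB; first exact: rS SB shB.
have wB0 := wS _ SB0; have /split_childP[x' cx' BE] : split_child d c B0 B by [].
have [szB0 sB0 _] := wB0.1 d; rewrite sel_rm_degree in szB0.
have [cI cr] := sk.
have shx' : sh x' (sel d B1) by have := shB d; rewrite BE sel_upd.
have cs := skipped_count NN Ns wB0 sk.
have [y0 shy0 y0y] := shadow_child shP szB0 sB0 cI cs cx' shx'.
have [szB0' sB0' _] := wB0.1 (odir d); rewrite sel_rm_degree in szB0'.
have sho : sh (sel (odir d) B0) (sel (odir d) B1).
  by have := shB (odir d); rewrite BE sel_updC.
have [lo hi] := shadow_supp shP szB0' sB0' sho.
rewrite -[B1](upd_sel d); apply: (reach_desc minS1 _ lo hi y0y).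
  apply: rm_mesh_crosses; first exact: inner_knot_range NN wB0 cI.
  exact: crossesW cr.
by apply: (rS _ _ SB0) => d'; have [->|->] := dirP d d';
  rewrite ?sel_upd ?sel_updC.
Qed.

(** Since the edges of the rectangle are meshlines, a newly inserted line cannot lie on the
    boundary. *)
Lemma boundary_crosses p N g : is_mesh p N ->
  sel (odir (mdir g)) (corner0 N) <= mlo g ->
  mhi g <= sel (odir (mdir g)) (corner1 N) ->
  boundary_meshline N g -> crosses N (mdir g) (mpos g) (mlo g) (mhi g) 1.
Proof.
move=> [_ _ _ Nsp _] lo hi bg u /andP[lu uh].
exists (spanning_line N (mdir g) (mpos g)).
have g0 : (0 < mult N (spanning_line N (mdir g) (mpos g)))%N.
  by case: bg => ->; have [] := Nsp (mdir g).
by split=> //=; rewrite (le_trans lo lu) (le_trans uh hi).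
Qed.

(** An insertion of multiplicity [m] becomes one of multiplicity t+1, whatever [m] is; a raise
    leaves [rm_mesh t N] unchanged, and only the invariant has to follow the splits it causes.
    Multiplicities never decrease along the run, so the bound on internal lines passes to all
    earlier meshes. *)
Theorem rm_chain_of_lr_mesh N S : lr_mesh (rm_degree s) N S ->
  internal_mult_le s.+1 N ->
  exists2 l : seq (seq R * seq R), rm_chain t (rm_mesh t N) [set` l] &
    reach_shadows N S [set` l].
Proof.
elim=> {N S}[N X NN tN XN|N S g m S' lrN IH ncr m0 [B SB gB] NN' [st _]|
             N S g S' lrN IH g0 NN' [st _]] Ns.
- pose X1 : @knots R := (rm_knot_vector t N Vert (sel Vert X),
                         rm_knot_vector t N Hor (sel Hor X)).
  have selX1 d : sel d X1 = rm_knot_vector t N d (sel d X) by case: d.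
  have X1N d : knot_vector (rm_mesh t N) d (sel d X1).
    by rewrite selX1; exact: rm_knot_vectorP NN tN (XN d).
  have /finite_seqP[l lE] := tensor_bsplines_finite (rm_degree t) X1.
  have NN1 := is_mesh_rm_mesh t NN.
  exists l; rewrite -lE.
    apply: rm_tensor => //; last exact: rm_mesh_multiplicities.
    by move=> g; rewrite rm_mesh_gt0; exact: tN.
  move=> B B1 tB shB.
  suff tB1 : tensor_bsplines (rm_degree t) X1 B1.
    by split; [exact: tensor_well_placed tB1|exact: reach_leaf].
  have wB := tensor_well_placed NN XN tB.
  move=> d; rewrite selX1 sel_rm_degree.
  have [sX XE] := XN d; have [_ _ lh] := wB.1 d.
  have [szB iB] := tB d; rewrite sel_rm_degree in szB.
  have [cN _ _ Nsp _] := NN; have [n0 n1] := Nsp d.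
  apply: (shadow_tensor shP sX) (shB d) => //.
  + by move=> c; exact: (knot_vector_range NN (XN d)).
  + move=> c /andP[c0 c1]; rewrite XE; apply: Ns => -[] /= e.
      by rewrite e ltxx in c0.
    by rewrite e ltxx in c1.
  + by rewrite -has_pred1 has_count XE.
  + by rewrite -has_pred1 has_count XE.
- have NN := (lr_mesh_inv lrN).1; have wS := (lr_mesh_inv lrN).2.
  have gz : mult N g = 0%N.
    apply/eqP; rewrite -leqn0 leqNgt; apply/negP => g0.
    by apply: ncr => u gu; exists g.
  have NleN' g' : (mult N g' <= mult (set_mult N g m) g')%N.
    by rewrite /=; case: asboolP => // ->; rewrite gz.
  have [|l ch rS] := IH.
    by move=> g' ig'; apply: leq_trans (NleN' g') (Ns g' ig').
  have [_ _ Ng' _ _] := NN'; have [|_ glo glh ghi _] := Ng' g.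
    by rewrite /=; case: asboolP.
  have ig : ~ boundary_meshline N g by move/(boundary_crosses NN glo ghi).
  have [wB _] := wS _ SB; have [gI [lg hg]] := gB.
  pose d := mdir g.
  have [szB sB _] := wB.1 d; rewrite sel_rm_degree in szB.
  have [szB' sB' lh] := wB.1 (odir d); rewrite sel_rm_degree in szB'.
  have [y1 shy1 gy1] := shadow_cover shP szB sB gI.
  (* Across the direction of [g] any shadow will do, since its support is contained in that of [B].
     The midpoint is merely an interior point at which [shadow_cover] provides one. *)
  have mid : inner_knot ((supp_lo (odir d) B + supp_hi (odir d) B) / 2%:R)
               (sel (odir d) B) by apply/andP; have := midf_lt lh; case.
  have [y2 shy2 _] := shadow_cover shP szB' sB' mid.
  have [lo2 hi2] := shadow_supp shP szB' sB' shy2.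
  pose B1 := upd d y1 (upd (odir d) y2 B).
  have B1d : sel d B1 = y1 by rewrite sel_upd.
  have B1o : sel (odir d) B1 = y2 by rewrite sel_updC sel_upd.
  have [wB1 rB1] : well_placed (rm_degree t) (rm_mesh t N) B1 /\
                   reach (rm_mesh t N) [set` l] B1.
    by apply: (rS B) => // d'; have [->|->] := dirP d d'; rewrite ?B1d ?B1o.
  have gB1 : traverses g B1.
    split; first by rewrite /supp_lo /supp_hi -/d B1d.
    rewrite /supp_lo /supp_hi -/d B1o.
    by split; [exact: le_trans lg lo2|exact: le_trans hi2 hg].
  have lr1 := rm_chain_lr_mesh ch; have [NN1 wl] := lr_mesh_inv lr1.
  have [B2 lB2 gB2] : exists2 B2, [set` l] B2 & traverses g B2.
    apply: (reach_traverses _ wB1 rB1 gB1) => B2 d' c wB2 sk.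
    have := skipped_count NN1 (@internal_mult_le_rm_mesh t N) wB2 sk.
    have [-> _ _] := wB2.1 d'; rewrite sel_rm_degree; clear; lia.
  have meq := rm_mesh_insert t m0 ig.
  have NN1' := is_mesh_rm_mesh t NN'.
  have le1 g' : (mult (rm_mesh t N) g' <= mult (set_mult (rm_mesh t N) g t.+1) g')%N.
    by rewrite /=; case: (asboolP (g' = g)) => // ->; rewrite gz.
  have wl1 B3 : B3 \in l ->
      well_placed (rm_degree t) (set_mult (rm_mesh t N) g t.+1) B3.
    by move=> lB3; apply: well_placedW le1 (wl B3 lB3).1.
  have [P PM] := mesh_positions NN1'.
  rewrite meq in NN1' PM.
  have [l' up] := lr_update_exists NN1' PM wl1.
  have [stl minl'] := up.
  exists l'; rewrite ?meq.
    apply: rm_insert up => //; last by exists B2.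
    by move/rm_mesh_crosses1.
  apply: (reach_shadows_split NN' Ns _ st).
  + by rewrite meq => B3 /minl'[].
  + by move=> B3 SB3; apply: well_placedW NleN' (wS B3 SB3).1.
  + move=> B3 B4 SB3 shB; rewrite meq; have [w4 r4] := rS B3 B4 SB3 shB.
    split; first exact: well_placedW le1 w4.
    by apply: reach_trans le1 r4 _ => B5; exact: reach_refinement.
- have NN := (lr_mesh_inv lrN).1; have wS := (lr_mesh_inv lrN).2.
  have NleN' g' : (mult N g' <= mult (set_mult N g (mult N g).+1) g')%N.
    by rewrite /=; case: asboolP => // ->.
  have [|l ch rS] := IH.
    by move=> g' ig'; apply: leq_trans (NleN' g') (Ns g' ig').
  have meq := rm_mesh_raise t g0.
  exists l; first by rewrite meq.
  apply: (reach_shadows_split NN' Ns _ st).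
  + rewrite meq => B lB; have [_ wl] := lr_mesh_inv (rm_chain_lr_mesh ch).
    by have [_ []] := wl _ lB.
  + by move=> B3 SB3; apply: well_placedW NleN' (wS B3 SB3).1.
  + by move=> B3 B4 SB3 shB; rewrite meq; exact: (rS B3).
Qed.

End Conversion.
End RMMeshes.

(** * Shadows of degree 1: consecutive triples of knots *)

Section Shadows.
Context {R : realType}.
Implicit Types (x y X A E : seq R) (a b c e u : R).

Lemma insert_knot3l a b c e : a <= c -> c <= b -> b <= e ->
  insert_knot c [:: a; b; e] = [:: a; c; b; e].
Proof.
move=> ac cb be; apply: (@insert_knot_cat _ c [:: a] [:: b; e]) => /=.
- by rewrite (le_trans ac cb) be.
- by move=> u; rewrite inE => /eqP ->.
- by move=> u; rewrite !inE => /orP[] /eqP -> //; exact: le_trans be.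
Qed.

Lemma insert_knot3r a b c e : a <= b -> b <= c -> c <= e ->
  insert_knot c [:: a; b; e] = [:: a; b; c; e].
Proof.
move=> ab bc ce; apply: (@insert_knot_cat _ c [:: a; b] [:: e]) => /=.
- by rewrite ab (le_trans bc ce).
- by move=> u; rewrite !inE => /orP[] /eqP -> //; exact: le_trans bc.
- by move=> u; rewrite inE => /eqP ->.
Qed.

Lemma sorted_pred x a : sorted <=%R x -> head 0 x < a ->  x != [::] ->
  exists u, [/\ u \in x, u < a & {in x, forall v, v < a -> v <= u}].
Proof.
move=> sx ha x0; pose y := [seq v <- x | v < a].
have hy : head 0 x \in y.
  by rewrite mem_filter ha; case: (x) x0 => // v s _; exact: mem_head.
have sy : sorted <=%R y by apply: sorted_filter => //; exact: le_trans.
have : last 0 y \in y by case: (y) hy => // v s _; exact: (mem_last v s).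
rewrite mem_filter => /andP[la lx]; exists (last 0 y); split=> // v vx va.
by apply: sorted_le_last => //; rewrite mem_filter va.
Qed.

Lemma sorted_succ x a : sorted <=%R x -> a < last 0 x -> x != [::] ->
  exists u, [/\ u \in x, a < u & {in x, forall v, a < v -> u <= v}].
Proof.
move=> sx ha x0; pose y := [seq v <- x | a < v].
have hy : last 0 x \in y.
  by rewrite mem_filter ha; case: (x) x0 => // v s _; exact: (mem_last v s).
have sy : sorted <=%R y by apply: sorted_filter => //; exact: le_trans.
have : head 0 y \in y by case: (y) hy => // v s _; exact: mem_head.
rewrite mem_filter => /andP[la lx]; exists (head 0 y); split=> // v vx va.
by apply: sorted_head_le => //; rewrite mem_filter va.
Qed.

Lemma lt_sorted_window (U m : seq R) : sorted <%R U -> sorted <%R m ->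
  {subset m <= U} -> {in U, forall u, head 0 m <= u <= last 0 m -> u \in m} ->
  m != [::] ->
  U = [seq u <- U | u < head 0 m] ++ m ++ [seq u <- U | last 0 m < u].
Proof.
move=> sU sm mU Um m0.
have smle : sorted <=%R m by apply: sub_sorted sm => ? ?; exact: ltW.
apply: lt_sorted_eq => //.
  rewrite (sorted_pairwise lt_trans) !pairwise_cat -!(sorted_pairwise lt_trans).
  rewrite sm !sorted_filter //; try exact: lt_trans.
  rewrite andbT /= andbT; apply/andP; split; apply/allrelP => u v.
    rewrite mem_filter => /andP[uh _]; rewrite mem_cat mem_filter.
    have hl : head 0 m <= last 0 m.
      by apply: sorted_le_last => //; case: (m) m0 => // ? ? _; exact: mem_head.
    case/orP => [/(sorted_head_le smle) /(lt_le_trans uh)//|/andP[lv _]].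
    exact: lt_trans (lt_le_trans uh hl) lv.
  by move=> /(sorted_le_last smle) um; rewrite mem_filter => /andP[/(le_lt_trans um)].
move=> u; rewrite !mem_cat !mem_filter.
have [uU|] := boolP (u \in U); last by rewrite !andbF orbF /= => /negbTE uU;
  apply/esym/negP => /mU; rewrite uU.
rewrite !andbT; case: ltP => //= hu; case: ltP => //= ul; first by rewrite orbT.
by rewrite orbF Um // hu ul.
Qed.

(* On an RM mesh only boundary values have multiplicity more than s+1; they
   may be repeated in the triple. *)
Definition consecutive_triple (s : nat) x y : Prop :=
  exists a b e, [/\ y = [:: a; b; e], {subset y <= x},
    [/\ a <= b, b <= e & a < e], {in x, forall u, a < u < e -> u = b} &
    (a = b -> (s.+1 < count_mem a x)%N) /\ (b = e -> (s.+1 < count_mem e x)%N)].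

Lemma consecutive_triple_refl x : size x = 3%N -> sorted <=%R x ->
  head 0 x < last 0 x -> consecutive_triple 0 x x.
Proof.
case: x => [|a [|b [|e []]]] //= _ /and3P[ab be _] ae.
exists a, b, e; split=> //.
  by move=> u; rewrite !inE => /or3P[]/eqP-> //; rewrite ltxx ?andbF.
by split=> ->; rewrite /= !eqxx ?addn0 //=; lia.
Qed.

(** A repeated knot of the triple has more than s+1 copies, so it is [c0] or [c1], and the copy
    added at that end of [undup X] provides the repetition. Without repetition, the three knots are
    neighbours in [undup X]. *)
Lemma consecutive_triple_infix s (c0 c1 : R) X x y : sorted <=%R X ->
  {in X, forall c, c0 <= c <= c1} ->
  (forall c, c0 < c < c1 -> (count_mem c X <= s.+1)%N) ->
  c0 \in X -> c1 \in X -> c0 < c1 -> infix x X -> consecutive_triple s x y ->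
  infix y (c0 :: rcons (undup X) c1).
Proof.
move=> sX rng cX c0X c1X c01 xX [a [b [e [yE yx [ab be ae] xb [xab xbe]]]]].
have sx : sorted <=%R x := subseq_sorted le_trans (infixW xX) sX.
have [ax bx ex] : [/\ a \in x, b \in x & e \in x].
  by split; apply: yx; rewrite yE !inE eqxx ?orbT.
have [aX bX eX] : [/\ a \in X, b \in X & e \in X].
  by split; apply: mem_infix xX _ _.
have XE u : u \in X -> a < u < e -> u = b.
  move=> uX /[dup] uae /andP[au ue]; apply: xb uae.
  have : inner_knot u x.
    by rewrite /inner_knot (le_lt_trans (sorted_head_le sx ax) au)
      (lt_le_trans ue (sorted_le_last sx ex)).
  move/(infix_sandwich sX xX) => cE; rewrite -has_pred1 has_count cE.
  by rewrite -has_count has_pred1.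
have bnd u : u \in x -> (s.+1 < count_mem u x)%N -> u = c0 \/ u = c1.
  move=> ux cu; have /andP[] := rng u (mem_infix xX ux).
  rewrite !le_eqVlt => /predU1P[<-|c0u]; first by left.
  case/predU1P => [->|uc1]; first by right.
  have := cX u; rewrite c0u uc1 => /(_ isT); rewrite leqNgt => /negP[].
  exact: leq_trans cu (leq_count_subseq _ (infixW xX)).
have sU : sorted <%R (undup X).
  rewrite lt_sorted_uniq_le undup_uniq.
  by apply: subseq_sorted sX; [exact: le_trans|exact: undup_subseq].
have memU u : (u \in undup X) = (u \in X) by rewrite mem_undup.
have [ab'|ab'] := eqVneq a b.
  have ac0 : a = c0.
    case: (bnd a ax (xab ab')) => // ac1; have := rng e eX.
    by rewrite -ac1 [e <= a]leNgt ae andbF.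
  have := @lt_sorted_window (undup X) [:: a; e] sU; rewrite /= ae => -> //.
  - rewrite (_ : [seq u <- _ | _] = [::]); last first.
      apply/eqP; rewrite -[_ == _]negbK -has_filter; apply/negP => /hasP[u].
      by rewrite memU => /rng/andP[+ _]; rewrite -ac0 leNgt => /negP.
    by rewrite yE -ab' ac0; exact: (prefix_infix [:: c0; c0; e] (rcons _ c1)).
  - by move=> u; rewrite !inE memU => /orP[]/eqP->.
  - move=> u; rewrite memU !inE => uX /andP[]; rewrite !le_eqVlt.
    move=> /predU1P[->|au]; first by rewrite eqxx.
    move=> /predU1P[->|ue]; first by rewrite eqxx orbT.
    by rewrite (XE u uX) ?au ?ue // ab' eqxx.
have [be'|be'] := eqVneq b e.
  have ec1 : e = c1.
    case: (bnd e ex (xbe be')) => // ec0; have := rng a aX.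
    by rewrite -ec0 [e <= a]leNgt ae.
  have := @lt_sorted_window (undup X) [:: a; e] sU; rewrite /= ae => -> //.
  - rewrite (_ : [seq u <- _ | e < u] = [::]); last first.
      apply/eqP; rewrite -[_ == _]negbK -has_filter; apply/negP => /hasP[u].
      by rewrite memU => /rng/andP[_]; rewrite -ec1 leNgt => /negP.
    rewrite yE be' ec1 rcons_cat.
    exact: (suffix_infix (c0 :: _) [:: a; c1; c1]).
  - by move=> u; rewrite !inE memU => /orP[]/eqP->.
  - move=> u; rewrite memU !inE => uX /andP[]; rewrite !le_eqVlt.
    move=> /predU1P[->|au]; first by rewrite eqxx.
    move=> /predU1P[->|ue]; first by rewrite eqxx orbT.
    by rewrite (XE u uX) ?au ?ue // be' eqxx orbT.
have {ab be ab' be'}[ab be] : a < b /\ b < e by rewrite !lt_neqAle ab be ab' be'.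
have := @lt_sorted_window (undup X) [:: a; b; e] sU; rewrite /= ab be => -> //.
- by rewrite yE !rcons_cat; exact: (infix_infix (c0 :: _) [:: a; b; e]).
- by move=> u; rewrite !inE memU => /or3P[]/eqP->.
- move=> u; rewrite memU !inE => uX /andP[]; rewrite !le_eqVlt.
  move=> /predU1P[->|au]; first by rewrite eqxx.
  move=> /predU1P[->|ue]; first by rewrite eqxx !orbT.
  by rewrite (XE u uX) ?au ?ue // eqxx orbT.
Qed.

(** The third knot is the predecessor of [a] or the successor of [e] in [x]. If neither exists, [x]
    takes only the values [a] and [e], and one of them may be repeated. *)
Lemma extend_consecutive s x a e : size x = s.*2.+3 -> sorted <=%R x ->
  a \in x -> e \in x -> a < e -> {in x, forall u, ~~ (a < u < e)} ->
  exists2 y, consecutive_triple s x y &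
    (exists2 a', a' <= a & y = [:: a'; a; e]) \/
    (exists2 e', e <= e' & y = [:: a; e; e']).
Proof.
move=> szx sx ax ex ae noae; have x0 : x != [::] by rewrite -size_eq0 szx.
have [ha|ah] := ltP (head 0 x) a.
  have [a' [a'x a'a a'max]] := sorted_pred sx ha x0.
  exists [:: a'; a; e]; last by left; exists a' => //; exact: ltW.
  exists a', a, e; split=> //.
  - by move=> u; rewrite !inE => /or3P[]/eqP->.
  - by rewrite !ltW // (lt_trans a'a).
  - move=> u ux /andP[a'u ue]; case: (ltgtP u a) => // ua.
      by have := a'max u ux ua; rewrite leNgt a'u.
    by have := noae u ux; rewrite ua ue.
  - by split=> [aa|ae']; [rewrite aa ltxx in a'a|rewrite ae' ltxx in ae].
have [eh|he] := ltP e (last 0 x).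
  have [e' [e'x ee' e'min]] := sorted_succ sx eh x0.
  exists [:: a; e; e']; last by right; exists e' => //; exact: ltW.
  exists a, e, e'; split=> //.
  - by move=> u; rewrite !inE => /or3P[]/eqP->.
  - by rewrite !ltW // (lt_trans ae).
  - move=> u ux /andP[au ue']; case: (ltgtP u e) => // ue.
      by have := noae u ux; rewrite au ue.
    by have := e'min u ux ue; rewrite leNgt ue'.
  - by split=> [aa|ae']; [rewrite aa ltxx in ae|rewrite ae' ltxx in ee'].
have xae u : u \in x -> (u == a) || (u == e).
  move=> ux; have au := le_trans ah (sorted_head_le sx ux).
  have ue := le_trans (sorted_le_last sx ux) he; have := noae u ux.
  by move: au ue; rewrite !le_eqVlt ![u == _]eq_sym => /orP[->//|->] /orP[->|->];
    rewrite ?orbT // eq_sym.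
(* By the pigeonhole principle one of the two multiplicities exceeds s+1. *)
have cnt : (count_mem a x + count_mem e x = s.*2.+3)%N.
  rewrite -szx -(count_predC (pred1 a)) addnC [RHS]addnC; congr (_ + _)%N.
  apply: eq_in_count => u /xae /=; case: eqVneq => [->|_ /= ->] //.
  by rewrite (lt_eqF ae).
have [ca|ca] := ltnP s.+1 (count_mem a x).
  exists [:: a; a; e]; last by left; exists a.
  exists a, a, e; split=> //.
  - by move=> u; rewrite !inE => /or3P[]/eqP->.
  - by rewrite lexx ltW.
  - by move=> u ux uae; have := noae u ux; rewrite uae.
  - by split=> // ae'; rewrite ae' ltxx in ae.
exists [:: a; e; e]; last by right; exists e.
exists a, e, e; split=> //.
- by move=> u; rewrite !inE => /or3P[]/eqP->.
- by rewrite lexx ltW.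
- by move=> u ux uae; have := noae u ux; rewrite uae.
- by split=> [ae'|_]; [rewrite ae' ltxx in ae|move: cnt ca; clear; lia].
Qed.

Lemma knot_desc1 k c x y : inner_knot c x -> (count_mem c x < k)%N ->
  knot_child c x y -> knot_desc k c x y.
Proof. by move=> cI ck; apply: knot_desc_step => //; exact: knot_desc_refl. Qed.

(** For knot insertion, let [y] be a triple of the child. If [c] was in [x] already, or is not in
    [y], then [y] is a triple of [x]. Otherwise [y] is a child of a triple of [x]: in place of [c]
    this one has the predecessor of [c] if [c] came first in [y], its successor if [c] came last,
    and if [c] was in the middle it extends the two other knots. A repeated knot of [y] has more
    than s+1 copies and thus is not [c]. *)
Lemma consecutive_triple_shadow s : @shadow R s 0 (consecutive_triple s).
Proof.
split.
- move=> c0 c1 X x y sX rng cX c0X c1X c01 _ _ xX xy; rewrite blow0.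
  split; last exact: consecutive_triple_infix xy.
  by case: xy => a [b [e [->]]].
- move=> c x x' y szx sx cI cs cx' [a [b [e [yE yx' [ab be ae] xb [xab xbe]]]]].
  have x0 : x != [::] by rewrite -size_eq0 szx.
  have /andP[hc cl] := cI.
  have [ax bx ex] : [/\ a \in x', b \in x' & e \in x'].
    by split; apply: yx'; rewrite yE !inE eqxx ?orbT.
  have sx' := sorted_knot_child cx'.
  have xx' u : u \in x' -> u != c -> u \in x.
    by move=> /(mem_knot_child cx'); rewrite inE => /predU1P[->|//]; rewrite eqxx.
  have xb' : {in x, forall u, a < u < e -> u = b}.
    move=> u ux /[dup] uae /andP[au ue]; apply: xb uae.
    have : inner_knot u x'.
      by rewrite /inner_knot (le_lt_trans (sorted_head_le sx' ax) au)
        (lt_le_trans ue (sorted_le_last sx' ex)).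
    move/(count_knot_child sx cI cx') => cE; rewrite -has_pred1 has_count cE.
    by rewrite ltn_addr // -has_count has_pred1.
  have big u : (s.+1 < count_mem u x')%N -> u != c /\ (s.+1 < count_mem u x)%N.
    have := count_knot_child_le sx cI cx' u.
    case: eqVneq => [->|_ le gt]; first by move: cs; clear; lia.
    by split=> //; rewrite addn0 in le; exact: leq_trans gt le.
  have keep : (c \in y -> c \in x) -> consecutive_triple s x y.
    move=> cyx; exists a, b, e; split=> //.
      move=> u uy; case: (eqVneq u c) uy => [->|uc]; first exact: cyx.
      by move=> /yx' /xx'; exact.
    by split=> [/xab/big[]|/xbe/big[]].
  have [cx|cx] := boolP (c \in x).
    by exists y; [exact: keep|exact: knot_desc_refl].
  have [|] := boolP (c \in y); last first.
    by move=> /negbTE cy; exists y; [apply: keep; rewrite cy|exact: knot_desc_refl].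
  have ca : a = b -> a != c by move=> /xab /big[].
  have ce : b = e -> e != c by move=> /xbe /big[].
  rewrite yE !inE => /or3P[]/eqP cE.
  + have ltab : c < b.
      rewrite cE lt_neqAle ab andbT; apply/eqP => ab'.
      by have := ca ab'; rewrite cE eqxx.
    have [a' [a'x a'c a'max]] := sorted_pred sx hc x0.
    have bx' : b \in x by apply: xx' => //; rewrite (gt_eqF ltab).
    have ex' : e \in x by apply: xx' => //; rewrite (gt_eqF (lt_le_trans ltab be)).
    have a'b := lt_trans a'c ltab; have a'e := lt_le_trans a'b be.
    exists [:: a'; b; e].
      exists a', b, e; split=> //.
      * by move=> u; rewrite !inE => /or3P[]/eqP->.
      * by rewrite (ltW a'b).
      * move=> u ux /andP[a'u ue]; case: (ltgtP u c) => [uc|uc|uc].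
        - by have := a'max u ux uc; rewrite leNgt a'u.
        - by apply: xb' => //; rewrite -cE uc.
        - by rewrite uc (negbTE cx) in ux.
      * by split=> [a'b'|/xbe/big[]//]; rewrite a'b' ltxx in a'b.
    apply: knot_desc1.
    * by rewrite /inner_knot /= a'c cE ae.
    * rewrite /= (lt_eqF a'c) (gt_eqF ltab).
      by rewrite (gt_eqF (lt_le_trans ltab be)).
    * by right; rewrite /knot_last insert_knot3l ?(ltW a'c) ?(ltW ltab) // cE.
  + have ac : a < c.
      rewrite cE lt_neqAle ab andbT; apply/eqP => ab'.
      by have := ca ab'; rewrite cE ab' eqxx.
    have ce' : c < e.
      rewrite cE lt_neqAle be andbT; apply/eqP => be'.
      by have := ce be'; rewrite cE be' eqxx.
    have ax' : a \in x by apply: xx' => //; rewrite (lt_eqF ac).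
    have ex' : e \in x by apply: xx' => //; rewrite (gt_eqF ce').
    have noae : {in x, forall u, ~~ (a < u < e)}.
      move=> u ux; apply/negP => /(xb' u ux) uE.
      by rewrite uE -cE (negbTE cx) in ux.
    have [y0 cy0 yE0] := extend_consecutive szx sx ax' ex' ae noae.
    exists y0 => //; case: yE0 => -[v vl ->]; apply: knot_desc1.
    * by rewrite /inner_knot /= ce' (le_lt_trans vl ac).
    * by rewrite /= (lt_eqF ac) (gt_eqF ce') (lt_eqF (le_lt_trans vl ac)).
    * right; rewrite /knot_last insert_knot3r ?(ltW ac) ?(ltW ce') //= cE //.
    * by rewrite /inner_knot /= ac (lt_le_trans ce' vl).
    * by rewrite /= (lt_eqF ac) (gt_eqF ce') (gt_eqF (lt_le_trans ce' vl)).
    * by left; rewrite /knot_first insert_knot3l ?(ltW ac) ?(ltW ce') //= cE.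
  + have ltbe : b < c.
      rewrite cE lt_neqAle be andbT; apply/eqP => be'.
      by have := ce be'; rewrite cE eqxx.
    have [e' [e'x ce' e'min]] := sorted_succ sx cl x0.
    have bx' : b \in x by apply: xx' => //; rewrite (lt_eqF ltbe).
    have ax' : a \in x by apply: xx' => //; rewrite (lt_eqF (le_lt_trans ab ltbe)).
    have be' := lt_trans ltbe ce'; have ae' := le_lt_trans ab be'.
    exists [:: a; b; e'].
      exists a, b, e'; split=> //.
      * by move=> u; rewrite !inE => /or3P[]/eqP->.
      * by rewrite (ltW be').
      * move=> u ux /andP[au ue]; case: (ltgtP u c) => [uc|uc|uc].
        - by apply: xb' => //; rewrite -cE uc au.
        - by have := e'min u ux uc; rewrite leNgt ue.
        - by rewrite uc (negbTE cx) in ux.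
      * by split=> [/xab/big[]//|be'']; rewrite be'' ltxx in be'.
    apply: knot_desc1.
    * by rewrite /inner_knot /= ce' cE ae.
    * rewrite /= (gt_eqF ce') (lt_eqF ltbe).
      by rewrite (lt_eqF (le_lt_trans ab ltbe)).
    * by left; rewrite /knot_first insert_knot3r ?(ltW ltbe) ?(ltW ce') //= cE.
- move=> x y _ sx [a [b [e [-> yx _ _ _]]]] /=.
  by rewrite (sorted_head_le sx) ?(sorted_le_last sx) //; apply: yx;
    rewrite !inE eqxx ?orbT.
- move=> c x szx sx /andP[hc cl]; have x0 : x != [::] by rewrite -size_eq0 szx.
  have [a [ax ac amax]] := sorted_pred sx hc x0.
  have [e [ex ce emin]] := sorted_succ sx cl x0.
  have [cx|cx] := boolP (c \in x).
    exists [:: a; c; e]; last by rewrite /inner_knot /= ac.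
    exists a, c, e; split=> //.
    + by move=> u; rewrite !inE => /or3P[]/eqP->.
    + by rewrite !ltW // (lt_trans ac).
    + move=> u ux /andP[au ue]; case: (ltgtP u c) => // uc.
        by have := amax u ux uc; rewrite leNgt au.
      by have := emin u ux uc; rewrite leNgt ue.
    + by split=> E; [rewrite E ltxx in ac|rewrite E ltxx in ce].
  have [|y cy yE] := extend_consecutive szx sx ax ex (lt_trans ac ce).
    move=> u ux; apply/negP => /andP[au ue]; case: (ltgtP u c) => uc.
    + by have := amax u ux uc; rewrite leNgt au.
    + by have := emin u ux uc; rewrite leNgt ue.
    + by rewrite -uc ux in cx.
  exists y => //; case: yE => -[v vl ->]; rewrite /inner_knot /=.
    by rewrite ce (le_lt_trans vl ac).
  by rewrite ac (lt_le_trans ce vl).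
Qed.

End Shadows.

(** * Shadows of a hat function: its lifts to degree 2t+1 *)

Section Lifts.
Context {R : realType}.
Implicit Types (x y X A E : seq R) (a b c e u : R).

Lemma knot_desc_trans k c x y z :
  knot_desc k c x y -> knot_desc k c y z -> knot_desc k c x z.
Proof. by move=> xy; elim=> // u v _; exact: knot_desc_step. Qed.

Lemma nseq_cat_cons j c E : nseq j c ++ c :: E = nseq j.+1 c ++ E.
Proof. by elim: j => //= j ->. Qed.

Section Steps.
Variables (k : nat) (c : R).

Lemma insert_knot_block A E j : sorted <=%R (A ++ E) ->
  {in A, forall u, u < c} -> {in E, forall u, c < u} ->
  insert_knot c (A ++ nseq j c ++ E) = A ++ nseq j.+1 c ++ E.
Proof.
move=> /sorted_catP[sA sE AE] Ac Ec.
rewrite catA insert_knot_cat -?catA ?nseq_cat_cons //.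
- apply/sorted_catP; split=> //.
    apply/sorted_catP; split=> //; first exact: sorted_nseq.
    by move=> u v; rewrite mem_nseq => /andP[_ /eqP ->] /Ec/ltW.
  move=> u v uA; rewrite mem_cat mem_nseq.
  by move=> /orP[/andP[_ /eqP ->]|]; [exact/ltW/Ac|exact: AE].
- move=> u; rewrite mem_cat mem_nseq => /orP[/Ac/ltW//|/andP[_ /eqP->]].
  exact: lexx.
- by move=> u /Ec/ltW.
Qed.

Lemma count_block A E j :
  {in A, forall u, u < c} -> {in E, forall u, c < u} ->
  count_mem c (A ++ nseq j c ++ E) = j.
Proof.
move=> Ac Ec; rewrite !count_cat count_nseq /= eqxx mul1n.
have /count_memPn -> : c \notin A by apply/negP => /Ac; rewrite ltxx.
have /count_memPn -> : c \notin E by apply/negP => /Ec; rewrite ltxx.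
by rewrite addn0.
Qed.

Lemma inner_block A E j : A != [::] -> E != [::] ->
  {in A, forall u, u < c} -> {in E, forall u, c < u} ->
  inner_knot c (A ++ nseq j c ++ E).
Proof.
case: A => // a A _; case/lastP: E => // E e _ Ac Ec.
rewrite /inner_knot /= Ac ?mem_head // !last_cat last_rcons Ec //.
by rewrite mem_rcons mem_head.
Qed.

(* Repeatedly taking the first child replaces the end of the knot vector by
   copies of c, and repeatedly taking the last child its beginning. *)
Lemma knot_desc_first A E1 E2 j : A != [::] -> sorted <=%R (A ++ E1 ++ E2) ->
  {in A, forall u, u < c} -> {in E1 ++ E2, forall u, c < u} ->
  (j + size E2 <= k)%N ->
  knot_desc k c (A ++ nseq j c ++ E1 ++ E2) (A ++ nseq (j + size E2) c ++ E1).
Proof.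
move=> A0; elim/last_ind: E2 j => [|E2 e IH] j sAE Ac Ec jk.
  by rewrite cats0 addn0; exact: knot_desc_refl.
rewrite size_rcons addnS in jk *; rewrite -addSn.
have sub : {subset E1 ++ E2 <= E1 ++ rcons E2 e}.
  by move=> u; rewrite !mem_cat mem_rcons inE => /orP[]->; rewrite ?orbT.
apply: knot_desc_trans (IH j.+1 _ Ac _ jk); last first.
- by move=> u /sub/Ec.
- by move: sAE; rewrite -!rcons_cat => /sorted_rconsP[].
apply: knot_desc1.
- apply: inner_block => //; by case: (E1) (E2) => // -[].
- by rewrite count_block //; move: jk; clear; lia.
left; rewrite /knot_first insert_knot_block //.
have -> : size (A ++ nseq j c ++ E1 ++ rcons E2 e) =
    size (A ++ nseq j.+1 c ++ E1 ++ E2).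
  by rewrite !size_cat !size_nseq size_rcons; clear; lia.
by rewrite -!rcons_cat -cats1 take_size_cat.
Qed.

Lemma knot_desc_last A1 A2 E j : E != [::] -> sorted <=%R ((A1 ++ A2) ++ E) ->
  {in A1 ++ A2, forall u, u < c} -> {in E, forall u, c < u} ->
  (j + size A1 <= k)%N ->
  knot_desc k c ((A1 ++ A2) ++ nseq j c ++ E) (A2 ++ nseq (j + size A1) c ++ E).
Proof.
move=> E0; elim: A1 j => [|a A1 IH] j sAE Ac Ec jk.
  by rewrite addn0; exact: knot_desc_refl.
rewrite /= addnS in jk *; rewrite -addSn.
apply: knot_desc_trans (IH j.+1 _ _ Ec jk); last first.
- by move=> u uA; apply: Ac; rewrite inE uA orbT.
- exact: path_sorted sAE.
apply: knot_desc1.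
- exact: (@inner_block (a :: A1 ++ A2)).
- by rewrite (@count_block (a :: A1 ++ A2)) //; move: jk; clear; lia.
by right; rewrite /knot_last (@insert_knot_block (a :: A1 ++ A2)).
Qed.

End Steps.

(* For al <= t these are the windows of length 2t+3 of the sequence in which
   each of the three knots of x is repeated t+1 times. *)
Definition knot_lift (t al : nat) x : seq R :=
  nseq (t.+1 - al) x`_0 ++ nseq t.+1 x`_1 ++ nseq al.+1 x`_2.

Definition is_lift t x y : Prop := exists2 al, (al <= t)%N & y = knot_lift t al x.

Lemma size_lift t al x : (al <= t)%N -> size (knot_lift t al x) = t.*2.+3.
Proof. by rewrite !size_cat !size_nseq; clear; lia. Qed.

Lemma infix_lift t al x : (al <= t)%N -> size x = 3%N ->
  infix (knot_lift t al x) (blow t x).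
Proof.
case: x => [|a [|b [|e []]]] // alt _; apply/infixP.
exists (nseq al a), (nseq (t - al) e).
rewrite /knot_lift !catA -nseqD -!catA -nseqD !blow_cons cats0.
by congr (nseq _ a ++ nseq _ b ++ nseq _ e); move: alt; clear; lia.
Qed.

Lemma head_lift t al x : (al <= t)%N -> head 0 (knot_lift t al x) = x`_0.
Proof. by move=> alt; rewrite /knot_lift subSn. Qed.

Lemma last_lift t al x : last 0 (knot_lift t al x) = x`_2.
Proof.
by rewrite /knot_lift !last_cat -[al.+1]addn1 nseqD last_cat.
Qed.

(** The lift of a child with index [al] descends from the lift of the parent with the same index, by
    taking repeatedly the child on the same side. Each of the four cases takes at most t+1
    insertions of [c], the multiplicity that is available. *)
Lemma is_lift_shadow t : @shadow R 0 t (is_lift t).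
Proof.
split.
- move=> c0 c1 X x y sX rng cX c0X c1X c01 szx hl xX [al alt ->].
  split; first exact: size_lift.
  have sx : sorted <=%R x := subseq_sorted le_trans (infixW xX) sX.
  have xx := consecutive_triple_refl szx sx hl.
  have /infixP[l1 [l2 ->]] := consecutive_triple_infix sX rng cX c0X c1X c01 xX xx.
  rewrite !blow_cat; apply/infix_catl/infix_catr; exact: infix_lift.
- move=> c x x' y szx sx cI cs cx' [al alt ->].
  case: x szx sx cI cs cx' => [|a [|b [|e []]]] // _ /and3P[ab be _] /andP[].
  rewrite /= => ac ce; rewrite ltnS leqn0 (lt_eqF ac) (gt_eqF ce) /= !addn0 add0n.
  rewrite eqb0 eq_sym => cb cx'.
  exists (knot_lift t al [:: a; b; e]); first by exists al.
  pose k := (t.+1 - al)%N; have kE : (k + al)%N = t.+1 by rewrite subnK // ltnW.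
  have lE u v w : knot_lift t al [:: u; v; w] =
    nseq k u ++ nseq t.+1 v ++ nseq al.+1 w by [].
  have srt : sorted <=%R (nseq k a ++ nseq t.+1 b ++ nseq al.+1 e).
    apply/sorted_catP; split; first exact: sorted_nseq.
      apply/sorted_catP; split; try exact: sorted_nseq.
      by move=> u v; rewrite !mem_nseq => /andP[_ /eqP->] /andP[_ /eqP->].
    move=> u v; rewrite mem_cat !mem_nseq => /andP[_ /eqP->].
    by move=> /orP[]/andP[_ /eqP->] //; exact: le_trans be.
  have k0 : nseq k a != [::] by rewrite -size_eq0 size_nseq; move: kE alt; clear; lia.
  have [cltb|bltc|cE] := ltgtP c b; last by rewrite cE eqxx in cb.
  + have Ac : {in nseq k a, forall u, u < c}.
      by move=> u; rewrite mem_nseq => /andP[_ /eqP->].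
    have Ec : {in nseq t.+1 b ++ nseq al.+1 e, forall u, c < u}.
      by move=> u; rewrite mem_cat !mem_nseq => /orP[]/andP[_ /eqP->].
    case: cx' => ->.
      rewrite /knot_first insert_knot3l ?(ltW ac) ?(ltW cltb) // -[take _ _]/[:: a; c; b] !lE.
      (* Of the copies of [b], al+1 are kept as last knots of the new lift; the other t - al and the
         al+1 copies of [e] make room for t+1 copies of [c]. *)
      have tE : t.+1 = (al.+1 + (t - al))%N by move: alt; clear; lia.
      rewrite [X in nseq X b]tE nseqD -catA in srt Ec *.
      have := @knot_desc_first t.+1 c (nseq k a) (nseq al.+1 b)
        (nseq (t - al) b ++ nseq al.+1 e) 0 k0 srt Ac Ec.
      rewrite size_cat !size_nseq add0n addnC -tE; exact.
    * rewrite /knot_last insert_knot3l ?(ltW ac) ?(ltW cltb) // -[behead _]/[:: c; b; e] !lE.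
      have := @knot_desc_last t.+1 c (nseq k a) [::]
        (nseq t.+1 b ++ nseq al.+1 e) 0; rewrite cats0 size_nseq add0n.
      by apply=> //; move: kE; clear; lia.
  + have Ac : {in nseq k a ++ nseq t.+1 b, forall u, u < c}.
      by move=> u; rewrite mem_cat !mem_nseq => /orP[]/andP[_ /eqP->].
    have Ec : {in nseq al.+1 e, forall u, c < u}.
      by move=> u; rewrite mem_nseq => /andP[_ /eqP->].
    case: cx' => ->.
    * rewrite /knot_first insert_knot3r ?(ltW bltc) ?(ltW ce) // -[take _ _]/[:: a; b; c] !lE.
      have := @knot_desc_first t.+1 c (nseq k a ++ nseq t.+1 b) [::]
        (nseq al.+1 e) 0; rewrite !cats0 size_nseq add0n -!catA.
      by apply=> //; case: (k) k0.
    * rewrite /knot_last insert_knot3r ?(ltW bltc) ?(ltW ce) // -[behead _]/[:: b; c; e] !lE.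
      have kb : (k <= t.+1)%N by move: kE; clear; lia.
      have := @knot_desc_last t.+1 c (nseq k a ++ nseq (t.+1 - k) b) (nseq k b)
        (nseq al.+1 e) 0.
      rewrite size_cat !size_nseq add0n -!catA -nseqD subnK // subnKC //.
      have -> : nseq (t.+1 - k) b ++ nseq k b ++ nseq al.+1 e =
          nseq t.+1 b ++ nseq al.+1 e by rewrite catA -nseqD subnK.
      by apply.

- move=> x y szx sx [al alt ->]; rewrite head_lift // last_lift.
  by case: x szx {sx} => [|a [|b [|e []]]] //= _; rewrite !lexx.
- move=> c x szx sx cI; exists (knot_lift t 0 x); first by exists 0%N.
  rewrite /inner_knot head_lift // last_lift; move: cI.
  by case: x szx {sx} => [|a [|b [|e []]]].
Qed.

End Lifts.

(** * LR B-splines on an RM mesh are lifts *)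

Section MinimalLifts.
Local Ltac count_lia :=
  repeat match goal with |- context [count ?p ?x] =>
    let n := fresh "n" in set n := (count p x); clearbody n end; clear; lia.

Context {R : realType}.
Implicit Types (M N : mesh R) (B : @knots R) (S : set (@knots R)) (g : meshline R).

Lemma sum_count_mem (m x : seq R) : uniq m ->
  (\sum_(u <- m) count_mem u x)%N = count [in m] x.
Proof.
move=> um; elim: x => [|a x IH]; first by rewrite big1_seq.
rewrite /= big_split /= IH; congr (_ + _)%N.
transitivity (count_mem a m); last by rewrite count_uniq_mem.
rewrite -sum1_count [RHS]big_mkcond /=; apply: eq_bigr => u _.
by rewrite [a == u]eq_sym; case: eqP.
Qed.

Lemma sum_count_mem_le (m x : seq R) : uniq m ->
  (\sum_(u <- m) count_mem u x <= size x)%N.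
Proof. by move=> um; rewrite sum_count_mem // count_size. Qed.

Lemma sum_count_mem_size (m x : seq R) : uniq m -> {subset x <= m} ->
  (\sum_(u <- m) count_mem u x)%N = size x.
Proof.
by move=> um xm; rewrite sum_count_mem //; apply/eqP; rewrite -all_count; apply/allP.
Qed.

(** Counting: if [a] or [e] were not an end of [x], the multiplicities of the triple and of the
    further end would add up to at least 2s+4. So [x] has only the values a, b, e, and the index of
    the lift is read off a multiplicity. *)
Lemma consecutive_triple_lift s (x y : seq R) : size x = s.*2.+3 ->
  sorted <=%R x -> {in x, forall c, inner_knot c x -> count_mem c x = s.+1} ->
  consecutive_triple s x y -> is_lift s y x.
Proof.
move=> szx sx cnt [a [b [e [yE yx [ab be ae] xb [xab xbe]]]]].
have [ax bx ex] : [/\ a \in x, b \in x & e \in x].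
  by split; apply: yx; rewrite yE !inE eqxx ?orbT.
have x0 : x != [::] by rewrite -size_eq0 szx.
have hx : head 0 x \in x by case: (x) x0 => // u z _; exact: mem_head.
have lx : last 0 x \in x by case: (x) x0 => // u z _; exact: (mem_last u z).
have pos u : u \in x -> (0 < count_mem u x)%N by rewrite -has_count has_pred1.
have mid : a != b -> b != e -> count_mem b x = s.+1.
  move=> ab' be'; apply: cnt => //; apply/andP; split.
    by apply: le_lt_trans (sorted_head_le sx ax) _; rewrite lt_neqAle ab' ab.
  by apply: lt_le_trans (sorted_le_last sx ex); rewrite lt_neqAle be' be.
have ha : head 0 x = a.
  apply/eqP/negPn/negP => hneq.
  have ha : head 0 x < a by rewrite lt_neqAle hneq (sorted_head_le sx ax).
  have ca : count_mem a x = s.+1.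
    by apply: cnt => //; rewrite /inner_knot ha (lt_le_trans ae) // sorted_le_last.
  have ab' : a != b by apply/eqP => /xab; rewrite ca ltnn.
  have [be'|be'] := eqVneq b e.
    have := @sum_count_mem_le [:: head 0 x; a; e] x.
    rewrite /= !inE (lt_eqF ha) (lt_eqF (lt_trans ha ae)) (lt_eqF ae) => /(_ isT).
    rewrite !big_cons big_nil ca szx; have := xbe be'; have := pos _ hx.
    by count_lia.
  have ltab : a < b by rewrite lt_neqAle ab' ab.
  have ltbe : b < e by rewrite lt_neqAle be' be.
  have := @sum_count_mem_le [:: head 0 x; a; b; e] x.
  rewrite /= !inE (lt_eqF ha) (lt_eqF (lt_trans ha ae)) (lt_eqF ae).
  rewrite (lt_eqF ltab) (lt_eqF ltbe) (lt_eqF (lt_trans ha ltab)) => /(_ isT).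
  rewrite !big_cons big_nil ca szx mid //; have := pos _ hx; have := pos _ ex.
  by count_lia.
have le : last 0 x = e.
  apply/eqP/negPn/negP => hneq.
  have el : e < last 0 x.
    by rewrite lt_neqAle eq_sym hneq (sorted_le_last sx ex).
  have ce : count_mem e x = s.+1.
    by apply: cnt => //; rewrite /inner_knot el ha ae.
  have be' : b != e by apply/eqP => /xbe; rewrite ce ltnn.
  have [ab'|ab'] := eqVneq a b.
    have := @sum_count_mem_le [:: a; e; last 0 x] x.
    rewrite /= !inE (lt_eqF ae) (lt_eqF (lt_trans ae el)) (lt_eqF el) => /(_ isT).
    rewrite !big_cons big_nil ce szx; have := xab ab'; have := pos _ lx.
    by count_lia.
  have ltab : a < b by rewrite lt_neqAle ab' ab.
  have ltbe : b < e by rewrite lt_neqAle be' be.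
  have := @sum_count_mem_le [:: a; b; e; last 0 x] x.
  rewrite /= !inE (lt_eqF ae) (lt_eqF (lt_trans ae el)) (lt_eqF el).
  rewrite (lt_eqF ltab) (lt_eqF ltbe) (lt_eqF (lt_trans ltbe el)) => /(_ isT).
  rewrite !big_cons big_nil ce szx mid //; have := pos _ lx; have := pos _ ax.
  by count_lia.
have xabe u : u \in x -> [|| u == a, u == b | u == e].
  move=> ux; have := sorted_head_le sx ux; have := sorted_le_last sx ux.
  rewrite ha le le_eqVlt => /predU1P[->|ue]; first by rewrite eqxx !orbT.
  rewrite le_eqVlt => /predU1P[->|au]; first by rewrite eqxx.
  by rewrite (xb u ux) ?au ?ue // eqxx orbT.
have srt al : sorted <=%R (knot_lift s al y).
  rewrite yE; apply/sorted_catP; split; first exact: sorted_nseq.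
    apply/sorted_catP; split; try exact: sorted_nseq.
    by move=> u v; rewrite !mem_nseq => /andP[_ /eqP->] /andP[_ /eqP->].
  move=> u v; rewrite mem_cat !mem_nseq => /andP[_ /eqP->].
  by move=> /orP[]/andP[_ /eqP->] //; exact: le_trans be.
suff [al als key] : exists2 al : nat, (al <= s)%N &
    {in [:: a; b; e], forall u, count_mem u x = count_mem u (knot_lift s al y)}.
  exists al => //; apply: (sorted_eq le_trans le_anti) => //.
  apply/allP => u _ /=; apply/eqP; have [uy|uy] := boolP (u \in [:: a; b; e]).
    exact: key.
  have ux : u \notin x by apply: contra uy => /xabe; rewrite !inE.
  have ul : u \notin knot_lift s al y.
    apply: contra uy; rewrite yE !mem_cat !mem_nseq !inE.
    by move=> /or3P[]/andP[_ ->]; rewrite ?orbT.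
  by rewrite (count_memPn ux) (count_memPn ul).
have cl al u : count_mem u (knot_lift s al y) =
    ((a == u) * (s.+1 - al) + ((b == u) * s.+1 + (e == u) * al.+1))%N.
  by rewrite yE !count_cat !count_nseq.
have [ab'|ab'] := eqVneq a b.
  have h : (count_mem a x + count_mem e x)%N = s.*2.+3.
    rewrite -szx -(@sum_count_mem_size [:: a; e] x) ?big_cons ?big_nil ?addn0 //.
      by rewrite /= !inE (lt_eqF ae).
    by move=> u /xabe; rewrite -ab' !inE orbA orbb.
  have ca := xab ab'; have pe := pos _ ex.
  exists (count_mem e x).-1; first by move: h ca pe; count_lia.
  move=> u uy; rewrite cl; move: uy; rewrite -ab' !inE orbA orbb => /orP[]/eqP->.
    by rewrite eqxx (gt_eqF ae); move: h ca pe; count_lia.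
  by rewrite eqxx (lt_eqF ae); move: h ca pe; count_lia.
have [be'|be'] := eqVneq b e.
  have h : (count_mem a x + count_mem e x)%N = s.*2.+3.
    rewrite -szx -(@sum_count_mem_size [:: a; e] x) ?big_cons ?big_nil ?addn0 //.
      by rewrite /= !inE (lt_eqF ae).
    by move=> u /xabe; rewrite be' !inE orbb.
  have ce := xbe be'; have pa := pos _ ax.
  (* Here the copies of [e] include the s+1 middle knots, so the index is read off the copies of
     [a]. *)
  exists (s.+1 - count_mem a x)%N; first by move: h ce pa; count_lia.
  move=> u uy; rewrite cl; move: uy; rewrite be' !inE orbb => /orP[]/eqP->.
    by rewrite eqxx (gt_eqF ae); move: h ce pa; count_lia.
  by rewrite eqxx (lt_eqF ae); move: h ce pa; count_lia.
have ltab : a < b by rewrite lt_neqAle ab' ab.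
have ltbe : b < e by rewrite lt_neqAle be' be.
have h : (count_mem a x + (s.+1 + count_mem e x))%N = s.*2.+3.
  rewrite -(mid ab' be') -szx -(@sum_count_mem_size [:: a; b; e] x).
  - by rewrite !big_cons big_nil addn0.
  - by rewrite /= !inE (lt_eqF ae) (lt_eqF ltab) (lt_eqF ltbe).
  - by move=> u /xabe; rewrite !inE.
have pa := pos _ ax; have pe := pos _ ex.
exists (count_mem e x).-1; first by move: h pa pe; count_lia.
move=> u uy; rewrite cl; move: uy; rewrite !inE => /or3P[]/eqP->.
- by rewrite eqxx (gt_eqF ae) (gt_eqF ltab); move: h pa pe; count_lia.
- by rewrite eqxx (lt_eqF ltab) (gt_eqF ltbe) mid //; move: h pa pe; count_lia.
- by rewrite eqxx (lt_eqF ae) (lt_eqF ltbe); move: h pa pe; count_lia.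
Qed.

(** Containment in the mesh bounds the multiplicity from above, and with fewer copies the line would
    be skipped. *)
Lemma minimal_inner_count s M B d c : is_mesh (rm_degree s) M ->
  rm_multiplicities s M -> well_placed (rm_degree s) M B ->
  minimal_support M B -> c \in sel d B -> inner_knot c (sel d B) ->
  count_mem c (sel d B) = s.+1.
Proof.
move=> MM rm wB [lB nosk] cB cI.
have mult_c g : mdir g = d -> mpos g = c -> (0 < mult M g)%N -> mult M g = s.+1.
  move=> gd gc /rm[_]; apply; apply: (inner_line_internal MM wB).
  by rewrite gd gc.
apply/eqP; rewrite eqn_leq; apply/andP; split.
  by have [g [gd gc g0]] := well_placed_line wB cB; rewrite mult_c.
rewrite leqNgt; apply/negP => lt; apply: (nosk d c); split=> // t tI.
have [g [gd gc gt g0 _]] := lB d c cB t tI.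
by exists g; split=> //; rewrite mult_c.
Qed.

Lemma lr_mesh_sub_lift s M S (l : seq (seq R * seq R)) :
  lr_mesh (rm_degree s) M S -> rm_multiplicities s M ->
  reach_shadows 0 (consecutive_triple s) M S [set` l] ->
  forall B, S B -> exists2 B1, B1 \in l & forall d, is_lift s (sel d B1) (sel d B).
Proof.
move=> lrM rm rS B SB; have [MM wS] := lr_mesh_inv lrM.
have [wB mB] := wS _ SB; have shP := @consecutive_triple_shadow R s.
have sz d : size (sel d B) = s.*2.+3.
  by have [-> _ _] := wB.1 d; rewrite sel_rm_degree.
have srt d : sorted <=%R (sel d B) by have [] := wB.1 d.
have ex d : exists y, consecutive_triple s (sel d B) y.
  have [_ _ lh] := wB.1 d.
  have mid : inner_knot ((supp_lo d B + supp_hi d B) / 2%:R) (sel d B).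
    by apply/andP; have := midf_lt lh; case.
  by have [y] := shadow_cover shP (sz d) (srt d) mid; exists y.
have [y1 c1] := ex Vert; have [y2 c2] := ex Hor.
pose B1 : seq R * seq R := (y1, y2).
have cB1 d : consecutive_triple s (sel d B) (sel d B1) by case: d.
have liB1 d : is_lift s (sel d B1) (sel d B).
  apply: consecutive_triple_lift (cB1 d) => // c cB.
  by move=> cI; exact: (minimal_inner_count MM rm wB mB cB cI).
exists B1 => //; have [wB1 rB1] := rS _ B1 SB cB1.
(* [B1] must be a leaf of its splitting tree: it has the same support and the same knot values as
   [B], so a line skipped by [B1] would be skipped by [B]. *)
case: rB1 wB1 cB1 liB1 => // {}B1 d c [cI cr] _ _ wB1 cB1 liB1; exfalso.
have NN := is_mesh_rm_mesh 0 MM.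
have sz1 d' : size (sel d' B1) = 3%N.
  by have [-> _ _] := wB1.1 d'; rewrite sel_rm_degree.
have ends d' : supp_lo d' B = supp_lo d' B1 /\ supp_hi d' B = supp_hi d' B1.
  have [al als BE] := liB1 d'; rewrite /supp_lo /supp_hi BE head_lift // last_lift.
  by case: (sel d' B1) (sz1 d') => [|? [|? [|? []]]].
have c0 : count_mem c (sel d B1) = 0%N.
  have := skipped_count NN (@internal_mult_le_rm_mesh R 0 M) wB1 (conj cI cr : skipped _ B1 d c).
  by case: (count_mem _ _).
have [lo hi] := ends d; have [lo' hi'] := ends (odir d).
have [_ nosk] := mB; apply: (nosk d c); split; first by rewrite lo hi.
rewrite lo' hi'; rewrite c0 in cr.
suff -> : count_mem c (sel d B) = 0%N by exact: rm_mesh_crosses1 cr.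
have [al als ->] := liB1 d; apply/count_memPn.
have cy : c \notin sel d B1 by rewrite -has_pred1 has_count c0.
move: cy; case: (sel d B1) (sz1 d) => [|a [|b [|e []]]] // _.
rewrite !inE => /norP[/negbTE ca /norP[/negbTE cb /negbTE ce]].
by rewrite !mem_cat !mem_nseq /= ca cb ce !andbF.
Qed.

End MinimalLifts.

(** * B-splines on a cell *)

Section BsplinePieces.
Context {R : realType}.
Implicit Types (x : seq R) (u v t : R) (k a b : nat).

Lemma bspline1_eq0l k x v t : (forall i, (i <= k.+1)%N -> v <= x`_i) -> t < v ->
  bspline1 k x t = 0.
Proof.
elim: k x => [|k IH] x xv tv /=.
  by rewrite [x`_0 <= t]leNgt (lt_le_trans tv (xv 0%N isT)).
rewrite IH //; last by move=> i ik; apply: xv; exact: leqW.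
rewrite IH //; first by rewrite !mulr0 addr0.
by move=> i ik; rewrite nth_behead; exact: xv.
Qed.

Lemma bspline1_eq0r k x v t : (forall i, (i <= k.+1)%N -> x`_i <= v) -> v <= t ->
  bspline1 k x t = 0.
Proof.
elim: k x => [|k IH] x xv tv /=.
  by rewrite [t < x`_1]ltNge (le_trans (xv 1%N isT) tv) andbF.
rewrite IH //; last by move=> i ik; apply: xv; exact: leqW.
rewrite IH //; first by rewrite !mulr0 addr0.
by move=> i ik; rewrite nth_behead; exact: xv.
Qed.

Lemma size_linear_mul (p q : {poly R}) n : (size p <= 2)%N ->
  (size q <= n)%N -> (size (p * q)%R <= n.+1)%N.
Proof.
move=> sp sq; apply: leq_trans (size_polyMleq _ _) _.
by rewrite -subn1 leq_subLR add1n -add2n leq_add.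
Qed.

(* Between its first knot u, of multiplicity a, and the next one, a B-spline
   of degree k is a polynomial with a zero of order exactly k + 1 - a at u. *)
Lemma bspline1_left k x a u v : (0 < a <= k.+1)%N -> u < v ->
  (forall i, (i < a)%N -> x`_i = u) ->
  (forall i, (a <= i <= k.+1)%N -> v <= x`_i) ->
  exists Q : {poly R}, [/\ (size Q <= a)%N, 0 < Q.[u] &
    forall t, u < t < v -> bspline1 k x t = (t - u) ^+ (k.+1 - a) * Q.[t]].
Proof.
elim: k x a => [|k IH] x a /andP[a0 ak] uv xu xv.
  have a1 : a = 1%N by move: a0 ak; clear; lia.
  exists 1; rewrite size_poly1 hornerE; split=> // t /andP[ut tv].
  rewrite /= a1 subnn expr0 !hornerE xu ?a1 // (ltW ut) /=.
  by rewrite (lt_le_trans tv) // xv // a1.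
have x0 : x`_0 = u by exact: xu.
have [ak'|ak'] := ltnP k.+1 a.
  have aE : a = k.+2 by apply/eqP; rewrite eqn_leq ak ak'.
  have [||//|//|Q [sQ Qu Qt]] := IH (behead x) k.+1.
  - by rewrite leqnn.
  - exact: uv.
  - by move=> i ik; rewrite nth_behead xu // aE.
  - by move=> i ik; rewrite nth_behead xv // aE; move: ik; clear; lia.
  have uk : u < x`_k.+2 by apply: lt_le_trans uv (xv _ _); rewrite aE leqnn.
  have Dn0 : x`_k.+2 - u != 0 by rewrite subr_eq0 gt_eqF.
  exists ((x`_k.+2 - u)^-1 *: ((x`_k.+2)%:P - 'X) * Q); split.
  - rewrite aE; apply: size_linear_mul sQ.
    apply: leq_trans (size_scale_leq _ _) _.
    by rewrite -opprB size_polyN size_XsubC.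
  - by rewrite !hornerE mulVf // mul1r.
  - move=> t ut; rewrite [LHS]/= x0 (xu k.+1) ?aE // (xu 1%N) ?aE //.
    (* The first quotient has denominator 0; the convention 0^-1 = 0 removes this term, as is usual
       in the recursion for B-splines. *)
    rewrite subrr invr0 mulr0 mul0r add0r Qt // ?aE !subnn !expr0 !hornerE.
    by rewrite /=; field.
have uk : u < x`_k.+2 by apply: lt_le_trans uv (xv _ _); rewrite leqnn (leqW ak').
have [ak2|ak2] := ltnP a k.+2; last by move: ak' ak2; clear; lia.
have xk1 : u < x`_k.+1 by apply: lt_le_trans uv (xv _ _); rewrite ak' ltnW.
have D1 : 0 < x`_k.+1 - u by rewrite subr_gt0.
have D2 : 0 < x`_k.+2 - u by rewrite subr_gt0.
have [|//|//|i ik|Q [sQ Qu Qt]] := IH x a; first by rewrite a0 ak'.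
- by apply: xv; move: ik; clear; lia.
have powE : (k.+2 - a = (k.+1 - a).+1)%N by rewrite subSn.
case: a a0 ak ak' ak2 xu xv sQ Qt powE => // -[|a] _ ak ak' ak2 xu xv sQ Qt powE.
  exists ((x`_k.+1 - u)^-1 *: Q); split.
  - exact: leq_trans (size_scale_leq _ _) sQ.
  - by rewrite hornerE mulr_gt0 ?invr_gt0.
  - move=> t /[dup] ut /andP[_ tv]; rewrite [LHS]/= x0 Qt //.
    rewrite (@bspline1_eq0l _ (behead x) v) //; last first.
      by move=> i ik; rewrite nth_behead xv.
    by rewrite mulr0 addr0 powE exprS hornerZ; field; rewrite gt_eqF.
have [|//|i ik|i ik|Q' [sQ' Qu' Qt']] := IH (behead x) a.+1.
- by rewrite /=; move: ak; clear; lia.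
- by rewrite nth_behead xu.
- by rewrite nth_behead xv //; move: ik; clear; lia.
exists ((x`_k.+1 - u)^-1 *: Q +
        (x`_k.+2 - u)^-1 *: ((x`_k.+2)%:P - 'X) * Q'); split.
- apply: leq_trans (size_polyD _ _) _; rewrite geq_max; apply/andP; split.
    exact: leq_trans (size_scale_leq _ _) sQ.
  apply: size_linear_mul sQ'; apply: leq_trans (size_scale_leq _ _) _.
  by rewrite -opprB size_polyN size_XsubC.
- rewrite !hornerE mulVf ?gt_eqF // mul1r; apply: addr_gt0 => //.
  by rewrite mulr_gt0 ?invr_gt0.
- move=> t ut; rewrite [LHS]/= x0 Qt // Qt' // (xu 1%N) // powE !exprS !hornerE.
  have -> : (k.+1 - a.+1 = (k.+1 - a.+2).+1)%N by move: ak'; clear; lia.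
  by rewrite exprS /=; field; rewrite !gt_eqF.
Qed.

(** Mirror image of [bspline1_left]. Written with powers of [u - t], both terms of the recursion
    have cofactors that are positive at [u], so they cannot cancel there. *)
Lemma bspline1_right k x b u v : (0 < b <= k.+1)%N -> v < u ->
  (forall i, (k.+2 - b <= i <= k.+1)%N -> x`_i = u) ->
  (forall i, (i < k.+2 - b)%N -> x`_i <= v) ->
  exists Q : {poly R}, [/\ (size Q <= b)%N, 0 < Q.[u] &
    forall t, v < t < u -> bspline1 k x t = (u - t) ^+ (k.+1 - b) * Q.[t]].
Proof.
elim: k x b => [|k IH] x b /andP[b0 bk] vu xu xv.
  have b1 : b = 1%N by move: b0 bk; clear; lia.
  exists 1; rewrite size_poly1 hornerE; split=> // t /andP[vt tu].
  rewrite /= b1 subnn expr0 !hornerE (xu 1%N) ?b1 // tu.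
  by rewrite (le_trans _ (ltW vt)) // xv // b1.
have xk2 : x`_k.+2 = u by apply: xu; rewrite leqnn andbT; move: b0; clear; lia.
have sz2 (c : R) : (size ((u - c)^-1 *: ('X - c%:P : {poly R})) <= 2)%N.
  by apply: leq_trans (size_scale_leq _ _) _; rewrite size_XsubC.
have [bk'|bk'] := ltnP k.+1 b.
  have bE : b = k.+2 by apply/eqP; rewrite eqn_leq bk bk'.
  have [||i ik|i ik|Q [sQ Qu Qt]] := IH x k.+1; rewrite ?leqnn //.
  - by apply: xu; move: ik; rewrite bE; clear; lia.
  - by apply: xv; move: ik; rewrite bE; clear; lia.
  have x0u : x`_0 < u by apply: le_lt_trans (xv _ _) vu; rewrite bE; clear; lia.
  have Dn0 : u - x`_0 != 0 by rewrite subr_eq0 gt_eqF.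
  have xk1 : x`_k.+1 = u by apply: xu; rewrite bE; clear; lia.
  have x1 : x`_1 = u by apply: xu; rewrite bE; clear; lia.
  exists ((u - x`_0)^-1 *: ('X - (x`_0)%:P) * Q); split.
  - by rewrite bE; apply: size_linear_mul sQ; exact: sz2.
  - by rewrite !hornerE mulVf // mul1r.
  - move=> t ut; rewrite [LHS]/= xk2 xk1 x1.
    rewrite subrr invr0 mulr0 mul0r addr0 Qt // bE !subnn !expr0 !hornerE.
    by rewrite /=; field.
have x1 : x`_1 < u by apply: le_lt_trans (xv _ _) vu; move: bk'; clear; lia.
have x0 : x`_0 < u by apply: le_lt_trans (xv _ _) vu; move: bk'; clear; lia.
have D1 : 0 < u - x`_1 by rewrite subr_gt0.
have D0 : 0 < u - x`_0 by rewrite subr_gt0.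
have [|//|i ik|i ik|Q [sQ Qu Qt]] := IH (behead x) b; first by rewrite b0 bk'.
- by rewrite nth_behead; apply: xu; move: ik bk'; clear; lia.
- by rewrite nth_behead; apply: xv; move: ik bk'; clear; lia.
have powE : (k.+2 - b = (k.+1 - b).+1)%N by rewrite subSn.
case: b b0 bk bk' xu xv sQ Qt powE => // -[|b] _ bk bk' xu xv sQ Qt powE.
  exists ((u - x`_1)^-1 *: Q); split.
  - exact: leq_trans (size_scale_leq _ _) sQ.
  - by rewrite hornerE mulr_gt0 ?invr_gt0.
  - move=> t /[dup] ut /andP[vt _]; rewrite [LHS]/= xk2 Qt //.
    rewrite (@bspline1_eq0r _ x v) ?(ltW vt) //.
    by rewrite mulr0 add0r powE exprS hornerZ; field; rewrite gt_eqF.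
have [|//|i ik|i ik|Q' [sQ' Qu' Qt']] := IH x b.+1.
- by rewrite /=; move: bk; clear; lia.
- by rewrite xu //; move: ik; clear; lia.
- by rewrite xv //; move: ik; clear; lia.
have xk1 : x`_k.+1 = u by apply: xu; move: bk; clear; lia.
exists ((u - x`_1)^-1 *: Q + (u - x`_0)^-1 *: ('X - (x`_0)%:P) * Q'); split.
- apply: leq_trans (size_polyD _ _) _; rewrite geq_max; apply/andP; split.
    exact: leq_trans (size_scale_leq _ _) sQ.
  by apply: size_linear_mul sQ'; exact: sz2.
- rewrite !hornerE mulVf ?gt_eqF // mul1r; apply: addr_gt0 => //.
  by rewrite mulr_gt0 ?invr_gt0.
- move=> t ut; rewrite [LHS]/= xk2 xk1 Qt // Qt' // powE !exprS !hornerE.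
  have -> : (k.+1 - b.+1 = (k.+1 - b.+2).+1)%N by move: bk'; clear; lia.
  by rewrite exprS /=; field; rewrite !gt_eqF.
Qed.

End BsplinePieces.

(** * The spaces spanned by lifts on a cell *)

Section Pieces.
Context {R : realType}.
Implicit Types (x y : seq R) (u v z t : R) (F G p q : {poly R}).

Definition active z y : bool := y`_0 <= z < y`_2.

(* Right of z the hat function with knots y is an affine function vanishing at
   [pole z y]. *)
Definition pole z y : R := if z < y`_1 then y`_0 else y`_2.

Lemma size_pow_mul m u q n : (size q <= n)%N ->
  (size (('X - u%:P) ^+ m * q)%R <= m + n)%N.
Proof.
move=> sq; apply: leq_trans (size_polyMleq _ _) _.
by rewrite size_exp_XsubC addSn /= leq_add2l.
Qed.

(** The pole has multiplicity s+1-al in the lift if it is the first knot and al+1 if it is the last,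
    so the order of vanishing there is s+1+al, respectively 2s+1-al. Over all [al] each order from
    s+1 to 2s+1 occurs once. *)
Lemma knot_lift_poly s al y z z' : (al <= s)%N -> size y = 3%N ->
  sorted <=%R y -> active z y -> z < z' ->
  (forall u, u \in y -> u <= z \/ z' <= u) ->
  exists Q : {poly R}, let k := if z < y`_1 then al else (s - al)%N in
    [/\ (size Q <= s.+1 - k)%N, Q.[pole z y] != 0 &
    forall t, z < t < z' -> bspline1 s.*2.+1 (knot_lift s al y) t =
      (('X - (pole z y)%:P) ^+ s.+1 * (('X - (pole z y)%:P) ^+ k * Q)).[t]].
Proof.
case: y => [|a [|b [|e []]]] // als _ /and3P[ab be _] /andP[az ze] zz' yz.
rewrite /= in az ze.
rewrite /pole -[_`_0]/a -[_`_1]/b -[_`_2]/e; set x := knot_lift s al _.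
have xE i : x`_i = if (i < s.+1 - al)%N then a else
                   if (i < (s.+1 - al) + s.+1)%N then b else
                   if (i < s.*2.+3)%N then e else 0.
  have -> : x = nseq (s.+1 - al) a ++ nseq s.+1 b ++ nseq al.+1 e by [].
  rewrite !nth_cat !size_nseq !nth_nseq.
  case: (ltnP i) => // h1.
  have -> : (i < s.+1 - al + s.+1)%N = (i - (s.+1 - al) < s.+1)%N.
    by move: h1; clear; lia.
  case: ifP => h2; first by rewrite h2.
  congr (if _ then _ else _).
  by move: h1 h2 als; clear; lia.
have [zb|bz] := ltP z b.
  have z'b : z' <= b.
    have /yz[|//] : b \in [:: a; b; e] by rewrite !inE eqxx orbT.
    by rewrite leNgt zb.
  have [||i il|i il|Q [sQ Qu Qt]] := @bspline1_left R s.*2.+1 x (s.+1 - al) a b.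
  - by move: als; clear; lia.
  - exact: le_lt_trans zb.
  - by rewrite xE il.
  - rewrite xE ltnNge; case/andP: il => -> /= il; case: ifP => // _.
    by rewrite ltnS il.
  exists Q; split=> //; first exact: lt0r_neq0.
  move=> t /andP[zt tz']; rewrite Qt; last first.
    by rewrite (le_lt_trans az zt) (lt_le_trans tz' z'b).
  rewrite !hornerM !horner_exp hornerXsubC mulrA -exprD; congr (_ ^+ _ * _).
  by move: als; clear; lia.
have be' : b < e := le_lt_trans bz ze.
have z'e : z' <= e.
  have /yz[|//] : e \in [:: a; b; e] by rewrite !inE eqxx !orbT.
  by rewrite leNgt ze.
have [||i il|i il|Q [sQ Qu Qt]] := @bspline1_right R s.*2.+1 x al.+1 e b.
- by move: als; clear; lia.
- by [].
- rewrite xE.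
  have -> : (i < s.+1 - al)%N = false by move: il als; clear; lia.
  have -> : (i < s.+1 - al + s.+1)%N = false by move: il als; clear; lia.
  by have -> : (i < s.*2.+3)%N by move: il als; clear; lia.
- rewrite xE; case: ifP => // _.
  by have -> : (i < s.+1 - al + s.+1)%N by move: il als; clear; lia.
exists ((-1) ^+ (s.*2.+2 - al.+1) *: Q); split.
- apply: leq_trans (size_scale_leq _ _) _; apply: leq_trans sQ _.
  by move: als; clear; lia.
- by rewrite hornerZ mulf_neq0 ?signr_eq0 // lt0r_neq0.
- move=> t /andP[zt tz']; rewrite Qt; last first.
    by rewrite (le_lt_trans bz zt) (lt_le_trans tz' z'e).
  rewrite -[e - t]opprB [(- (t - e)) ^+ _]exprNn !hornerM !horner_exp hornerXsubC hornerZ mulrA -exprD.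
  have -> : (s.+1 + (s - al) = s.*2.+2 - al.+1)%N by move: als; clear; lia.
  by rewrite [RHS]mulrCA mulrA.
Qed.

Definition additive_form (L : {poly R} -> R) : Prop :=
  forall c p q, L (c *: p + q) = c * L p + L q.

Lemma additive_form0 L : additive_form L -> L 0 = 0.
Proof.
by move=> /(_ (-1) 0 0); rewrite scaler0 addr0 mulN1r addNr.
Qed.

(** A triangular basis: polynomials of degree at most s with exact orders 0, ..., s at [u] span all
    polynomials of degree at most s. A linear form [L] vanishing on them stands for the span. *)
Lemma span_of_orders s u (q : nat -> {poly R}) (L : {poly R} -> R) :
  additive_form L ->
  (forall k, (k <= s)%N -> exists2 Q : {poly R}, (size Q <= s.+1 - k)%N && (Q.[u] != 0) &
     exists2 al : nat, (al <= s)%N & q al = ('X - u%:P) ^+ k * Q) ->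
  (forall al, (al <= s)%N -> L (q al) = 0) ->
  forall p, (size p <= s.+1)%N -> L p = 0.
Proof.
move=> linL ex Lq.
suff key m k p : (k + m = s.+1)%N -> (size p <= m)%N ->
    L (('X - u%:P) ^+ k * p) = 0.
  by move=> p sp; have := key s.+1 0%N p (add0n _) sp; rewrite expr0 mul1r.
elim: m k p => [|m IH] k p km sp.
  have -> : p = 0 by apply/eqP; rewrite -size_poly_leq0.
  by rewrite mulr0 additive_form0.
have [|Q /andP[sQ Qu] [al als qE]] := ex k; first by move: km; clear; lia.
(* Subtracting this multiple of the generator of order [k] raises the order at [u] by one. *)
pose c := p.[u] / Q.[u].
have sQm : (size Q <= m.+1)%N by move: sQ km; clear; lia.
have /factor_theorem[r rE] : root (p - c *: Q) u.
  by rewrite /root !hornerE /c mulfVK // subrr.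
have sr : (size r <= m)%N.
  have [->|r0] := eqVneq r 0; first by rewrite size_poly0.
  have : (size (r * ('X - u%:P))%R <= m.+1)%N.
    rewrite -rE; apply: leq_trans (size_polyD _ _) _; rewrite geq_max sp.
    by rewrite size_polyN (leq_trans (size_scale_leq _ _)).
  by rewrite size_Mmonic ?monicXsubC // size_XsubC addn2.
have -> : ('X - u%:P) ^+ k * p = c *: q al + ('X - u%:P) ^+ k.+1 * r.
  rewrite qE exprSr -mulrA [('X - _) * r]mulrC -rE mulrBr scalerAr.
  by rewrite [RHS]addrC subrK.
rewrite linL Lq // mulr0 add0r; apply: IH sr.
by move: km; clear; lia.
Qed.

(** The span, on the cell to the right of [z], of the lifts of the hat function with knots [y]; it
    is zero if that function is inactive there. *)
Definition piece (s : nat) z y F : Prop :=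
  if active z y
  then exists2 q : {poly R}, (size q <= s.+1)%N & F = ('X - (pole z y)%:P) ^+ s.+1 * q
  else F = 0.

Lemma piece0 s z y : piece s z y 0.
Proof.
by rewrite /piece; case: ifP => // _; exists 0; rewrite ?size_poly0 ?mulr0.
Qed.

(** A Bezout identity with the first cofactor reduced modulo [Q]. Then [Q] times the second cofactor
    is F - P q1, which has at most 2s+2 coefficients, and [Q] is monic of degree s+1. *)
Lemma coprime_powers s (a e : R) F : a != e -> (size F <= s.*2.+2)%N ->
  exists q1 q2 : {poly R}, [/\ (size q1 <= s.+1)%N, (size q2 <= s.+1)%N &
    F = ('X - a%:P) ^+ s.+1 * q1 + ('X - e%:P) ^+ s.+1 * q2].
Proof.
move=> ae sF; set P := ('X - a%:P) ^+ s.+1; set Q := ('X - e%:P) ^+ s.+1.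
have cop : coprimep P Q.
  rewrite coprimep_expl // coprimep_expr // coprimep_XsubC.
  by rewrite /root !hornerE subr_eq0 eq_sym.
have /Bezout_eq1_coprimepP[[u v] /= uv] := cop.
have Qm : Q \is monic by rewrite monic_exp ?monicXsubC.
have sQ : size Q = s.+2 by rewrite size_exp_XsubC.
have sP : size P = s.+2 by rewrite size_exp_XsubC.
exists ((F * u) %% Q), ((F * u) %/ Q * P + F * v).
have FE : F = P * ((F * u) %% Q) + Q * ((F * u) %/ Q * P + F * v).
  rewrite -[LHS]mulr1 -uv mulrDr !mulrA {1}(divp_eq (F * u) Q).
  by ring.
have s1 : (size ((F * u) %% Q)%R <= s.+1)%N.
  by rewrite -ltnS -sQ ltn_modp monic_neq0.
split=> //; set r := (_ + F * v) in FE *.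
have [->|r0] := eqVneq r 0; first by rewrite size_poly0.
have : (size (Q * r)%R <= s.*2.+2)%N.
  have -> : Q * r = F - P * ((F * u) %% Q) by rewrite {1}FE addrC addKr.
  apply: leq_trans (size_polyD _ _) _; rewrite geq_max sF size_polyN.
  by apply: leq_trans (size_pow_mul _ _ s1) _; clear; lia.
by rewrite size_monicM // sQ addSn /= -doubleS -addnn leq_add2l.
Qed.

Lemma size_piece s z y F : piece s z y F -> (size F <= s.*2.+2)%N.
Proof.
rewrite /piece; case: ifP => [_ [q sq ->]|_ ->]; last by rewrite size_poly0.
apply: leq_trans (size_pow_mul _ _ sq) _; clear; lia.
Qed.

(* Inserting a knot c does not change the affine functions on a cell, except
   that on a cell next to c whose pole a is separated from it by c, the two
   children have two different poles. *)
Lemma piece_split s z y c F : size y = 3%N -> sorted <=%R y ->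
  inner_knot c y -> c \notin y -> piece s z y F ->
  exists F1 F2, [/\ F = F1 + F2, piece s z (knot_first c y) F1 &
    piece s z (knot_last c y) F2].
Proof.
case: y => [|a [|b [|e []]]] // _ /and3P[ab be _] /andP[/= ac ce].
rewrite !inE !negb_or => /and3P[_ cb _] pF.
have keep1 w : piece s z w F ->
    exists F1 F2, [/\ F = F1 + F2, piece s z w F1 & piece s z (knot_last c [:: a; b; e]) F2].
  by move=> pw; exists F, 0; rewrite addr0; split=> //; exact: piece0.
have keep2 w : piece s z w F ->
    exists F1 F2, [/\ F = F1 + F2, piece s z (knot_first c [:: a; b; e]) F1 & piece s z w F2].
  by move=> pw; exists 0, F; rewrite add0r; split=> //; exact: piece0.
have sF := size_piece pF.
move: pF keep1 keep2; rewrite /knot_first /knot_last.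
have [cltb|bltc|cE] := ltgtP c b; last by rewrite cE eqxx in cb.
  rewrite insert_knot3l ?(ltW ac) ?(ltW cltb) //=.
  rewrite {1}/piece /active /pole /= => pF k1 k2.
  have [za|az] := ltP z a.
    by apply: k1; move: pF; rewrite /piece /active /= leNgt za.
  have [zc|cz] := ltP z c.
    apply: k1; move: pF; rewrite /piece /active /pole /= az.
    by rewrite (lt_trans zc cltb) zc (lt_trans zc ce).
  have [zb|bz] := ltP z b.
    have [q1 [q2 [s1 s2 FE]]] := coprime_powers (negbT (gt_eqF cltb)) sF.
    exists (('X - b%:P) ^+ s.+1 * q1), (('X - c%:P) ^+ s.+1 * q2).
    split=> //; rewrite /piece /active /pole /=.
      by rewrite az zb ltNge cz; exists q1.
    by rewrite cz (lt_le_trans zb be) zb; exists q2.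
  apply: k2; move: pF; rewrite /piece /active /pole /= az cz [z < b]ltNge bz.
  by [].
rewrite insert_knot3r ?(ltW bltc) ?(ltW ce) //=.
rewrite {1}/piece /active /pole /= => pF k1 k2.
have [zb|bz] := ltP z b.
  apply: k1; move: pF; rewrite /piece /active /pole /= zb.
  by rewrite (lt_trans zb bltc) (lt_le_trans zb be).
have az := le_trans ab bz.
have [zc|cz] := ltP z c.
  have [q1 [q2 [s1 s2 FE]]] := coprime_powers (negbT (gt_eqF bltc)) sF.
  exists (('X - c%:P) ^+ s.+1 * q1), (('X - b%:P) ^+ s.+1 * q2).
  split=> //; rewrite /piece /active /pole /=.
    by rewrite az zc ltNge bz; exists q1.
  by rewrite bz (lt_trans zc ce) zc; exists q2.
apply: k2; move: pF; rewrite /piece /active /pole /= az bz [z < b]ltNge bz.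
by rewrite [z < c]ltNge cz.
Qed.

(** [phi] encodes a linear form on bivariate polynomials of degree below [n] in each variable,
    evaluated at F(x) G(y). *)
Definition coef_form n (phi : 'M[R]_n) F G : R :=
  (poly_rV F *m phi *m (poly_rV G)^T) 0 0.

Lemma form_linl n (phi : 'M[R]_n) G : additive_form (coef_form phi ^~ G).
Proof.
by move=> c p q; rewrite /coef_form linearP !mulmxDl -!scalemxAl !mxE.
Qed.

Lemma form_linr n (phi : 'M[R]_n) F : additive_form (coef_form phi F).
Proof.
by move=> c p q; rewrite /coef_form linearP linearD linearZ mulmxDr -scalemxAr !mxE.
Qed.

Lemma form0 n (phi : 'M[R]_n) :
  (forall F G, (size F <= n)%N -> (size G <= n)%N -> coef_form phi F G = 0) -> phi = 0.
Proof.
move=> h; apply/matrixP => i j; rewrite !mxE.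
have := h (rVpoly (delta_mx 0 i)) (rVpoly (delta_mx 0 j)) (size_poly _ _) (size_poly _ _).
by rewrite /coef_form !rVpolyK -rowE trmx_delta -colE !mxE.
Qed.

(** The spaces of all B-splines in [S] together span the polynomials of bidegree (2s+1, 2s+1) on the
    cell to the upper right of [z]: no nonzero form annihilates them. *)
Definition spanning (s : nat) (z : R * R) (S : set (@knots R)) : Prop :=
  forall phi : 'M[R]_(s.*2.+2),
  (forall B F G, S B -> piece s z.1 B.1 F -> piece s z.2 B.2 G ->
     coef_form phi F G = 0) -> phi = 0.

Lemma spanning_split_step s (z : R * R) (M : mesh R) S S' :
  (forall B d c, S B -> skipped M B d c ->
     [/\ size (sel d B) = 3%N, sorted <=%R (sel d B) & c \notin sel d B]) ->
  split_step M S S' -> spanning s z S -> spanning s z S'.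
Proof.
move=> wS [B0 [d [c [SB0 sk S'E]]]] spS phi h; apply: spS => B F G SB pF pG.
have [BB0|BB0] := pselect (B = B0); last first.
  by apply: h pF pG; rewrite S'E; left.
have [sz srt cy] := wS _ _ _ SB0 sk; have [cI _] := sk.
have hf : S' (split_first d c B0) by rewrite S'E; right; left.
have hl : S' (split_last d c B0) by rewrite S'E; right; right.
rewrite {}BB0 in pF pG.
case: d sk hf hl sz srt cy cI {S'E} => _ hf hl sz srt cy cI.
  have [F1 [F2 [-> p1 p2]]] := piece_split sz srt cI cy pF.
  rewrite -[F1]scale1r (form_linl phi G) mul1r.
  by rewrite (h _ _ _ hf p1 pG) (h _ _ _ hl p2 pG) addr0.
have [G1 [G2 [-> p1 p2]]] := piece_split sz srt cI cy pG.
rewrite -[G1]scale1r (form_linr phi F) mul1r.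
by rewrite (h _ _ _ hf pF p1) (h _ _ _ hl pF p2) addr0.
Qed.

(* Around z the sequence X reads a', a, e, e' with a <= z < e, and the hat
   functions (a', a, e) and (a, e, e') have poles e and a. *)
Lemma piece_tensor s z (X : seq R) (c0 c1 : R) F : sorted <=%R X ->
  count_mem c0 X = 2%N -> count_mem c1 X = 2%N -> c0 <= z < c1 ->
  (size F <= s.*2.+2)%N ->
  exists y1 y2 F1 F2, [/\ (size y1 = 3%N /\ infix y1 X), (size y2 = 3%N /\ infix y2 X),
    F = F1 + F2, piece s z y1 F1 & piece s z y2 F2].
Proof.
move=> sX n0 n1 /andP[c0z zc1] sF.
pose A := [seq u <- X | u <= z]; pose E := [seq u <- X | z < u].
have XE : X = A ++ E.
  apply: (sorted_eq le_trans le_anti) => //.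
    apply/sorted_catP; split.
    - by apply: sorted_filter => //; exact: le_trans.
    - by apply: sorted_filter => //; exact: le_trans.
    - move=> u v; rewrite !mem_filter => /andP[uz _] /andP[/ltW zv _].
      exact: le_trans zv.
  rewrite perm_sym; have -> : E = [seq u <- X | ~~ (u <= z)].
    by apply: eq_filter => u; rewrite ltNge.
  exact/permPl/perm_filterC.
have szA : (1 < size A)%N.
  rewrite -n0 size_filter; apply: sub_count => u /= /eqP ->; exact: c0z.
have szE : (1 < size E)%N.
  rewrite -n1 size_filter; apply: sub_count => u /= /eqP ->; exact: zc1.
have Az u : u \in A -> u <= z by rewrite mem_filter => /andP[].
have Ez u : u \in E -> z < u by rewrite mem_filter => /andP[].
move: sX; rewrite XE; clearbody A E.
case/lastP: A szA Az {XE} => // A a; case/lastP: A => // A a' _ Az.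
case: E szE Ez => // e [//|e' E] _ Ez; rewrite -!cats1 -!catA /=.
move=> /sorted_catP[_ /= /and4P[a'a ae ee' _] _].
have az : a <= z by apply: Az; rewrite mem_rcons mem_head.
have a'z : a' <= z := le_trans a'a az.
have ze : z < e by apply: Ez; rewrite mem_head.
have ze' : z < e' := lt_le_trans ze ee'.
have [q1 [q2 [s1 s2 FE]]] := coprime_powers (negbT (gt_eqF (le_lt_trans az ze))) sF.
exists [:: a'; a; e], [:: a; e; e'].
exists (('X - e%:P) ^+ s.+1 * q1), (('X - a%:P) ^+ s.+1 * q2); split=> //.
- by split=> //; exact: (infix_infix A [:: a'; a; e]).
- split=> //; have := infix_infix (A ++ [:: a']) [:: a; e; e'] E.
  by rewrite -catA.
- by rewrite /piece /active /pole /= a'z ze ltNge az; exists q1.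
- by rewrite /piece /active /pole /= az ze' ze; exists q2.
Qed.

(** On the initial mesh, openness supplies two knots on either side of each coordinate of [z].
    Afterwards, internal multiplicity 1 ensures that a skipped knot is absent from the triple, as
    [piece_split] requires. *)
Lemma rm_chain_spanning s M S (z : R * R) : rm_chain 0 M S ->
  (forall d, sel d (corner0 M) <= sel d z < sel d (corner1 M)) ->
  spanning s z S.
Proof.
move=> ch; elim: ch z => {M S}[M X MM tM rm XM z zM phi h|
    M S g S' ch IH ncr ig _ MM' [st _] z zM].
  have cnt d : count_mem (sel d (corner0 M)) (sel d X) = 2%N /\
               count_mem (sel d (corner1 M)) (sel d X) = 2%N.
    have [_ XE] := XM d; rewrite !XE; have [_ _ _ Msp _] := MM.
    have [m0 m1] := Msp d.
    by split; [apply: (rm _ m0).1; left|apply: (rm _ m1).1; right].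
  have [[c10 c11] [c20 c21]] := (cnt Vert, cnt Hor).
  have [s1 s2] := ((XM Vert).1, (XM Hor).1).
  apply: form0 => F G sF sG.
  have [y1 [y2 [F1 [F2 [[z1 i1] [z2 i2] -> p1 p2]]]]] :=
    piece_tensor s1 c10 c11 (zM Vert) sF.
  have [w1 [w2 [G1 [G2 [[z3 i3] [z4 i4] -> p3 p4]]]]] :=
    piece_tensor s2 c20 c21 (zM Hor) sG.
  have tB y w : size y = 3%N -> infix y (sel Vert X) -> size w = 3%N ->
      infix w (sel Hor X) -> tensor_bsplines (rm_degree 0) X (y, w).
    by move=> *; case.
  rewrite -[F1]scale1r (form_linl phi) mul1r -[G1]scale1r !(form_linr phi) !mul1r.
  rewrite (h (y1, w1) _ _ (tB _ _ z1 i1 z3 i3) p1 p3).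
  rewrite (h (y1, w2) _ _ (tB _ _ z1 i1 z4 i4) p1 p4).
  rewrite (h (y2, w1) _ _ (tB _ _ z2 i2 z3 i3) p2 p3).
  by rewrite (h (y2, w2) _ _ (tB _ _ z2 i2 z4 i4) p2 p4) !addr0.
have rm' : internal_mult_le 1 (set_mult M g 1).
  move=> g' ig' /=; case: asboolP => // _; case: (posnP (mult M g')) => [->//|g0].
  by rewrite (rm_chain_multiplicities ch g0).2.
have le1 g' : (mult M g' <= mult (set_mult M g 1) g')%N.
  rewrite /=; case: asboolP => // ->; case: (posnP (mult M g)) => [->//|g0].
  by rewrite (rm_chain_multiplicities ch g0).2.
have [_ wS] := lr_mesh_inv (rm_chain_lr_mesh ch).
have {}wS B : S B -> well_placed (rm_degree 0) (set_mult M g 1) B.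
  by move=> /wS[wB _]; exact: well_placedW le1 wB.
have {IH} := IH z zM; elim: st wS => {S'}[S1 S2 st|//|S1 S2 S3 st1 IH1 _ IH2] wS.
  apply: spanning_split_step st => B d c SB sk.
  have wB := wS _ SB; have [sz srt _] := wB.1 d; rewrite sel_rm_degree in sz.
  split=> //; have := skipped_count MM' rm' wB sk.
  by rewrite ltnS leqn0 => /eqP c0; rewrite -has_pred1 has_count c0.
move/(IH1 wS); apply: IH2 => B; exact: (split_steps_well_placed st1 wS).
Qed.

End Pieces.

(** * Local linear independence *)

Section Dimension.
Context {R : realType}.
Variables (T : eqType) (n : nat) (L : seq T) (F G : T -> {poly R}).

Let x0 (i : 'I_(size L)) : T := tnth (in_tuple L) i.
Let A : 'M[R]_(size L, n * n) :=
  \matrix_(i < size L)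
    mxvec ((poly_rV (F (x0 i)) : 'rV_n)^T *m (poly_rV (G (x0 i)) : 'rV_n)).

Let combE (a : T -> R) i j :
  ((\row_k a (x0 k)) *m A) 0 (mxvec_index i j) =
  \sum_(x <- L) a x * ((F x)`_i * (G x)`_j).
Proof.
rewrite mxE [RHS]big_tnth; apply: eq_bigr => k _.
by rewrite !mxE mxvecE !mxE big_ord1 !mxE.
Qed.

Let memP (a : T -> R) : (\row_k a (x0 k) : 'rV_(size L)) = 0 ->
  forall x, x \in L -> a x = 0.
Proof.
move=> a0 x /seq_tnthP[k ->].
by move/rowP/(_ k) : a0; rewrite !mxE.
Qed.

(** The rows of [A] are the coefficient vectors of the products F(x) G(y). Spanning means that the
    n^2 columns are independent; with at most n^2 rows, the rows are independent too. *)
Lemma independent_of_spanning (a : T -> R) : (size L <= n * n)%N ->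
  (forall phi : 'M[R]_n, (forall x, x \in L -> coef_form phi (F x) (G x) = 0) ->
     phi = 0) ->
  (forall i j : 'I_n, \sum_(x <- L) a x * ((F x)`_i * (G x)`_j) = 0) ->
  forall x, x \in L -> a x = 0.
Proof.
move=> szL sp rel; apply: memP.
have rA : row_free A^T.
  apply: inj_row_free => v vA; suff -> : v = mxvec 0 by rewrite linear0.
  rewrite -[v]vec_mxK; congr mxvec; apply: sp => x /seq_tnthP[k ->].
  rewrite /coef_form -mxvec_dotmul vec_mxK.
  transitivity ((v *m A^T) 0 k); last by rewrite vA mxE.
  by rewrite !mxE; apply: eq_bigr => j _; rewrite !mxE mulrC.
have : row_free A.
  by rewrite -row_leq_rank -mxrank_tr (eqP rA).
move=> /row_free_inj; apply; rewrite mul0mx; apply/rowP => k.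
by case/mxvec_indexP: k => i j; rewrite combE rel mxE.
Qed.

Lemma size_independent : uniq L ->
  (forall a : T -> R,
     (forall i j : 'I_n, \sum_(x <- L) a x * ((F x)`_i * (G x)`_j) = 0) ->
     forall x, x \in L -> a x = 0) -> (size L <= n * n)%N.
Proof.
move=> uL ind; suff /eqP <- : row_free A by exact: rank_leq_col.
apply: inj_row_free => v vA.
(* As [L] has no repetitions, every row vector comes from a coefficient function on its elements. *)
pose a x := if insub (index x L) is Some k then v 0 k else 0.
have ax k : a (x0 k) = v 0 k.
  rewrite /a /x0 (tnth_nth (x0 k)) /= index_uniq //.
  by rewrite (insubT (fun i => (i < size L)%N) (ltn_ord k)) /=; congr (v 0 _); exact: val_inj.
have vE : v = \row_k a (x0 k) by apply/rowP => k; rewrite mxE ax.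
have a0 : forall x, x \in L -> a x = 0.
  by apply: ind => i j; rewrite -combE -vE vA mxE.
by apply/rowP => k; rewrite !mxE -ax a0 // /x0 mem_tnth.
Qed.

End Dimension.

(** * Polynomial pieces of lifts on an interval without knots *)

Section LocalPolynomials.
Context {R : realType}.
Implicit Types (x y : seq R) (u v z t : R) (P Q p q : {poly R}).

Lemma poly_interval0 z z' P : z < z' -> (forall t, z < t < z' -> P.[t] = 0) ->
  P = 0.
Proof.
move=> zz' Pt; apply/eqP/negPn/negP => P0.
(* These [size P] distinct roots are one too many; [i.+2] keeps them strictly inside the
   interval. *)
pose r := [seq z + (z' - z) / (i.+2%:R) | i <- iota 0 (size P)].
have d0 : 0 < z' - z by rewrite subr_gt0.
have rP : all (root P) r.
  apply/allP => u /mapP[i _ ->]; apply/eqP/Pt.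
  rewrite ltrDl divr_gt0 //= -ltrBrDl ltr_pdivrMr // ltr_pMr //.
  by rewrite ltr1n.
have ur : uniq r.
  rewrite map_inj_uniq ?iota_uniq // => i j /addrI /mulfI.
  rewrite gt_eqF // => /(_ isT) /invr_inj /eqP.
  by rewrite eqr_nat => /eqP [].
by have := max_poly_roots P0 rP ur; rewrite size_map size_iota ltnn.
Qed.

Lemma poly_interval_eq z z' P Q : z < z' ->
  (forall t, z < t < z' -> P.[t] = Q.[t]) -> P = Q.
Proof.
move=> zz' PQ; apply/eqP; rewrite -subr_eq0; apply/eqP.
by apply: (poly_interval0 zz') => t /PQ; rewrite !hornerE => ->; rewrite subrr.
Qed.

(** Chosen as a total function, so that families of pieces can be indexed by knot vectors; the
    default 0 is returned only if no polynomial fits. *)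
Definition local_poly k z z' x : {poly R} :=
  xget 0 [set P | forall t, z < t < z' -> bspline1 k x t = P.[t]].

Lemma local_polyE k z z' x P : z < z' ->
  (forall t, z < t < z' -> bspline1 k x t = P.[t]) -> local_poly k z z' x = P.
Proof.
move=> zz' xP; apply: (poly_interval_eq zz') => t tz.
rewrite -xP // /local_poly; case: xgetP => [Q _ -> //|/(_ P)].
by rewrite /=.
Qed.

Definition gap z z' y : Prop := z < z' /\ forall u, u \in y -> u <= z \/ z' <= u.

Lemma lift_local_poly s al y z z' : (al <= s)%N -> size y = 3%N ->
  sorted <=%R y -> active z y -> gap z z' y ->
  let k := if z < y`_1 then al else (s - al)%N in
  exists Q, [/\ (size Q <= s.+1 - k)%N, Q.[pole z y] != 0,
    local_poly s.*2.+1 z z' (knot_lift s al y) =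
      ('X - (pole z y)%:P) ^+ s.+1 * (('X - (pole z y)%:P) ^+ k * Q) &
    forall t, z < t < z' -> bspline1 s.*2.+1 (knot_lift s al y) t =
      (local_poly s.*2.+1 z z' (knot_lift s al y)).[t]].
Proof.
move=> als sy srt ay [zz' yz] k.
have [Q [sQ Qu Qt]] := knot_lift_poly als sy srt ay zz' yz.
by exists Q; rewrite (local_polyE zz' Qt).
Qed.

Lemma lift_local_poly_size s al y z z' : (al <= s)%N -> size y = 3%N ->
  sorted <=%R y -> active z y -> gap z z' y ->
  (size (local_poly s.*2.+1 z z' (knot_lift s al y)) <= s.*2.+2)%N.
Proof.
move=> als sy srt ay yz; have [Q [sQ _ -> _]] := lift_local_poly als sy srt ay yz.
set k := (if _ then _ else _) in sQ *.
have ks : (k <= s)%N by rewrite /k; case: ifP => // _; exact: leq_subr.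
apply: leq_trans (size_pow_mul _ _ (size_pow_mul _ _ sQ)) _.
by move: ks; clear; lia.
Qed.

Lemma lift_inactive s al y t : (al <= s)%N -> size y = 3%N -> sorted <=%R y ->
  ~~ active t y -> bspline1 s.*2.+1 (knot_lift s al y) t = 0.
Proof.
move=> als sy srt; rewrite /active negb_and -!ltNge -leNgt.
have sx := size_lift y als.
have y0 u : u \in y -> y`_0 <= u.
  by move=> uy; have := sorted_head_le srt uy; rewrite -nth0.
have y2 u : u \in y -> u <= y`_2.
  by move=> uy; have := sorted_le_last srt uy; rewrite -nth_last sy.
have inx i : (i <= s.*2.+2)%N -> (knot_lift s al y)`_i \in y.
  move=> il; have : (knot_lift s al y)`_i \in knot_lift s al y.
    by rewrite mem_nth // sx.
  rewrite !mem_cat !mem_nseq.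
  by case/or3P => /andP[_ /eqP ->]; rewrite mem_nth // sy.
case/orP => [ty|yt].
  by apply: bspline1_eq0l ty => i il; apply/y0/inx.
by apply: bspline1_eq0r yt => i il; apply/y2/inx.
Qed.

Lemma active_gap z z' t y : size y = 3%N -> gap z z' y -> z < t < z' ->
  active t y = active z y.
Proof.
move=> sy [zz' yz] /andP[zt tz']; rewrite /active.
have [h0|h0] : y`_0 <= z \/ z' <= y`_0 by apply: yz; rewrite mem_nth ?sy.
  have [h2|h2] : y`_2 <= z \/ z' <= y`_2 by apply: yz; rewrite mem_nth ?sy.
    by rewrite ![_ < y`_2]ltNge h2 (le_trans h2 (ltW zt)) !andbF.
  by rewrite h0 (le_trans h0 (ltW zt)) (lt_le_trans zz' h2) (lt_le_trans tz' h2).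
by rewrite ![y`_0 <= _]leNgt (lt_le_trans zz' h0) (lt_le_trans tz' h0).
Qed.

End LocalPolynomials.

(** * The argument on a single cell *)

Section LocalIndependence.
Context {R : realType}.
Implicit Types (z t : R) (K : seq R).

Lemma exists_gap K z e : 0 < e -> exists2 z', gap z z' K & z' <= z + e.
Proof.
move=> e0; elim: K => [|u K [z' [zz' K1] z'e]].
  by exists (z + e) => //; split=> //; rewrite ltrDl.
have [uz|zu] := leP u z.
  exists z' => //; split=> // v; rewrite inE => /predU1P[->|/K1//]; by left.
exists (Num.min z' u); last by rewrite ge_min z'e.
split; first by rewrite lt_min zz'.
move=> v; rewrite inE => /predU1P[->|/K1[vz|z'v]].
- by right; rewrite ge_min lexx orbT.
- by left.
- by right; rewrite ge_min z'v.
Qed.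

(** Univariate B-splines are built on half-open intervals, so being active at [z] concerns the
    points to the upper right of [z]. *)
Lemma open_quadrant (U : set (R * R)) (z : R * R) : open U -> U z ->
  exists2 e, 0 < e & forall w : R * R, z.1 < w.1 < z.1 + e ->
    z.2 < w.2 < z.2 + e -> U w.
Proof.
move=> Uo Uz; have /nbhs_ballP[e /= e0 zU] := open_nbhs_nbhs (conj Uo Uz).
exists e => // w /andP[a1 b1] /andP[a2 b2]; apply: zU; split => /=.
  by rewrite /ball /= distrC ger0_norm ?subr_ge0 ?ltW // ltrBlDl.
by rewrite /ball /= distrC ger0_norm ?subr_ge0 ?ltW // ltrBlDl.
Qed.

Definition quadrant (z z' : R * R) : set (R * R) :=
  [set w | z.1 < w.1 < z'.1 /\ z.2 < w.2 < z'.2].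

Lemma quadrant_open (z z' : R * R) : open (quadrant z z').
Proof.
have -> : quadrant z z' =
    (fst @^-1` [set` `]z.1, z'.1[]) `&` (snd @^-1` [set` `]z.2, z'.2[]).
  by apply/seteqP; split=> w /=; rewrite !in_itv.
apply: openI; apply: open_comp; try exact: interval_open.
- by move=> w _; exact: cvg_fst.
- by move=> w _; exact: cvg_snd.
Qed.

Lemma additive_form_mul (L : {poly R} -> R) p :
  additive_form L -> additive_form (fun q => L (p * q)).
Proof. by move=> linL c q r; rewrite mulrDr -scalerAr linL. Qed.

Lemma horner_prod_sum (T : eqType) (L : seq T) n (a : T -> R)
    (F G : T -> {poly R}) t t' :
  (forall x, x \in L -> (size (F x) <= n)%N /\ (size (G x) <= n)%N) ->
  \sum_(x <- L) a x * ((F x).[t] * (G x).[t']) =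
  \sum_(i < n) \sum_(j < n)
    (\sum_(x <- L) a x * ((F x)`_i * (G x)`_j)) * (t ^+ i * t' ^+ j).
Proof.
move=> sz.
rewrite (eq_big_seq (fun x => \sum_(i < n) \sum_(j < n)
   a x * ((F x)`_i * (G x)`_j) * (t ^+ i * t' ^+ j))); last first.
  move=> x /sz[sF sG]; rewrite (horner_coef_wide _ sF) (horner_coef_wide _ sG).
  rewrite big_distrlr mulr_sumr; apply: eq_bigr => i _.
  by rewrite mulr_sumr; apply: eq_bigr => j _ /=; ring.
rewrite exchange_big; apply: eq_bigr => i _.
by rewrite exchange_big; apply: eq_bigr => j _; rewrite mulr_suml.
Qed.

(** Coefficients are compared in one variable at a time, with the other variable fixed. *)
Lemma coef_relations (T : eqType) (L : seq T) n (a : T -> R)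
    (F G : T -> {poly R}) (z z' : R * R) : z.1 < z'.1 -> z.2 < z'.2 ->
  (forall t t', z.1 < t < z'.1 -> z.2 < t' < z'.2 ->
     \sum_(x <- L) a x * ((F x).[t] * (G x).[t']) = 0) ->
  forall i j : 'I_n, \sum_(x <- L) a x * ((F x)`_i * (G x)`_j) = 0.
Proof.
move=> z1 z2 rel i j.
have relF t' : z.2 < t' < z'.2 ->
    \sum_(x <- L) a x * ((F x)`_i * (G x).[t']) = 0.
  move=> t'z; have : \sum_(x <- L) (a x * (G x).[t']) *: F x = 0.
    apply: (poly_interval0 z1) => t tz; rewrite horner_sum -[RHS](rel t t' tz t'z).
    by apply: eq_bigr => x _; rewrite hornerZ; ring.
  move=> /(congr1 (fun p : {poly R} => p`_i)); rewrite coef0 coef_sum => h; rewrite -[RHS]h.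
  by apply: eq_bigr => x _; rewrite coefZ; ring.
have : \sum_(x <- L) (a x * (F x)`_i) *: G x = 0.
  apply: (poly_interval0 z2) => t' tz; rewrite horner_sum -[RHS](relF t' tz).
  by apply: eq_bigr => x _; rewrite hornerZ; ring.
move=> /(congr1 (fun p : {poly R} => p`_j)); rewrite coef0 coef_sum => h; rewrite -[RHS]h.
by apply: eq_bigr => x _; rewrite coefZ; ring.
Qed.

(** Dividing the lifts by their common factor [P] leaves the triangular family to which
    [span_of_orders] applies. *)
Lemma lift_orders s y z z' (P := ('X - (pole z y)%:P) ^+ s.+1) :
  size y = 3%N -> sorted <=%R y -> active z y -> gap z z' y ->
  exists q : nat -> {poly R},
    (forall al, (al <= s)%N ->
       local_poly s.*2.+1 z z' (knot_lift s al y) = P * q al) /\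
    (forall k, (k <= s)%N -> exists2 Q : {poly R},
       (size Q <= s.+1 - k)%N && (Q.[pole z y] != 0) &
       exists2 al : nat, (al <= s)%N & q al = ('X - (pole z y)%:P) ^+ k * Q).
Proof.
move=> sy srt ay gy.
exists (fun al => local_poly s.*2.+1 z z' (knot_lift s al y) %/ P).
have P0 : P != 0 by rewrite monic_neq0 // monic_exp ?monicXsubC.
split=> [al als|k ks].
  have [Q [_ _ -> _]] := lift_local_poly als sy srt ay gy.
  by rewrite -/P mulKp.
pose al := if z < y`_1 then k else (s - k)%N.
have als : (al <= s)%N by rewrite /al; case: ifP => // _; exact: leq_subr.
have [Q [sQ Qu QE _]] := lift_local_poly als sy srt ay gy.
have kE : (if z < y`_1 then al else (s - al)%N) = k.
  by rewrite /al; case: (z < y`_1) => //; rewrite subKn.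
rewrite kE in sQ QE; exists Q; first by rewrite sQ.
by exists al => //; rewrite QE -/P mulKp.
Qed.

(** To annul the coefficient of a given [B0], choose a point [z] of [U] where [B0] does not vanish
    and a box [V] inside [U], with lower left corner [z], that no knot of [l] cuts. On [V] every
    function is a polynomial, and [B0] is among the active lifts. *)
Theorem lift_locally_linearly_independent s (M : mesh R)
    (l : seq (seq R * seq R)) (S : set (@knots R)) :
  rm_chain 0 M [set` l] ->
  locally_linearly_independent (rm_degree 0) M [set` l] ->
  (forall B, S B ->
     exists2 B1, B1 \in l & forall d, is_lift s (sel d B1) (sel d B)) ->
  locally_linearly_independent (rm_degree s) M S.
Proof.
move=> ch indep liftS U Uo _ UM sq a usq sqS rel B0 B0sq.
have [MM wl] := lr_mesh_inv (rm_chain_lr_mesh ch).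
have triple B d : B \in l -> size (sel d B) = 3%N /\ sorted <=%R (sel d B).
  move=> Bl; have [[wB _] _] := wl B Bl; have [sz srt _] := wB d.
  by rewrite sel_rm_degree in sz.
have [_ [z Uz B0z]] := sqS B0 B0sq.
have [e e0 zU] := open_quadrant Uo Uz.
have [z1 gap1 z1e] := exists_gap (flatten [seq B.1 | B <- l]) z.1 e0.
have [z2 gap2 z2e] := exists_gap (flatten [seq B.2 | B <- l]) z.2 e0.
pose V := quadrant z (z1, z2).
have VU w : V w -> U w.
  move=> [/andP[a1 b1] /andP[a2 b2]].
  by apply: zU; rewrite ?a1 ?a2 /= (lt_le_trans _ z1e, lt_le_trans _ z2e).
have zz1 := gap1.1; have zz2 := gap2.1.
have g1 B : B \in l -> gap z.1 z1 B.1.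
  move=> Bl; split=> // u uB; apply: gap1.2; apply/flattenP.
  by exists B.1 => //; apply: map_f.
have g2 B : B \in l -> gap z.2 z2 B.2.
  move=> Bl; split=> // u uB; apply: gap2.2; apply/flattenP.
  by exists B.2 => //; apply: map_f.
pose act (B : seq R * seq R) := active z.1 B.1 && active z.2 B.2.
pose F k (B : seq R * seq R) := local_poly k z.1 z1 B.1.
pose G k (B : seq R * seq R) := local_poly k z.2 z2 B.2.
pose la := undup [seq B <- l | act B].
have laP B : B \in la -> [/\ B \in l, active z.1 B.1 & active z.2 B.2].
  by rewrite mem_undup mem_filter => /andP[/andP[]].
pose mid := ((z.1 + z1) / 2%:R, (z.2 + z2) / 2%:R).
have Vmid : V mid.
  by split; apply/andP; [have := midf_lt zz1|have := midf_lt zz2]; case.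
have hat (y : seq R) (u u' : R) : size y = 3%N -> sorted <=%R y ->
    active u y -> gap u u' y ->
    [/\ forall t, u < t < u' -> bspline1 1 y t = (local_poly 1 u u' y).[t],
      (size (local_poly 1 u u' y) <= 2)%N &
      forall t, u < t < u' -> (local_poly 1 u u' y).[t] != 0].
  move=> sy srt ay gy.
  (* A hat function is its own lift for s = 0, so the results on lifts cover it. *)
  have yE : knot_lift 0 0 y = y by case: y sy {srt ay gy} => [|? [|? [|? []]]].
  have := @lift_local_poly_size R 0 0 y u u' (leqnn _) sy srt ay gy.
  have [Q [sQ Qu QE Qt]] := @lift_local_poly R 0 0 y u u' (leqnn _) sy srt ay gy.
  rewrite yE subnn if_same in sQ QE Qt *; move=> szP.
  split; [exact: Qt|exact: szP|move=> t /andP[ut tu']].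
  rewrite [local_poly _ _ _ _]QE expr0 mul1r hornerM horner_exp hornerXsubC.
  rewrite expr1 mulf_neq0 //.
    have [_ yg] := gy; case/andP: ay => y0 y2; rewrite subr_eq0 /pole.
    case: ifP => _; first by rewrite gt_eqF // (le_lt_trans y0 ut).
    rewrite lt_eqF //; have [|yu|//] := yg y`_2; first by rewrite mem_nth ?sy.
      by move: yu; rewrite leNgt y2.
    by move=> u'y; exact: lt_le_trans tu' u'y.
  have [c QC] : exists c, Q = c%:P by exists Q`_0; exact: size1_polyC.
  by move: Qu; rewrite QC !hornerC.
have hatF B : B \in la -> [/\ forall t, z.1 < t < z1 -> bspline1 1 B.1 t = (F 1%N B).[t],
    (size (F 1%N B) <= 2)%N & forall t, z.1 < t < z1 -> (F 1%N B).[t] != 0].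
  move=> /laP[Bl a1 _]; have [sz srt] := triple B Vert Bl.
  by apply: hat => //; exact: g1.
have hatG B : B \in la -> [/\ forall t, z.2 < t < z2 -> bspline1 1 B.2 t = (G 1%N B).[t],
    (size (G 1%N B) <= 2)%N & forall t, z.2 < t < z2 -> (G 1%N B).[t] != 0].
  move=> /laP[Bl _ a2]; have [sz srt] := triple B Hor Bl.
  by apply: hat => //; exact: g2.
(* Local independence is used on [V], where the functions in [la] do not vanish: independent
   bilinear polynomials are at most four. *)
have la4 : (size la <= 2 * 2)%N.
  apply: (@size_independent R _ 2 la (F 1%N) (G 1%N)); first exact: undup_uniq.
  move=> b relb; apply: (indep V).
  - exact: quadrant_open.
  - by exists mid.
  - by move=> w /VU/UM.
  - exact: undup_uniq.
  - move=> B Bla; have [Bl _ _] := laP B Bla; split=> //; exists mid => //.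
    have [F1 _ F3] := hatF B Bla; have [G1 _ G3] := hatG B Bla.
    have [m1 m2] := Vmid; rewrite /bspline F1 // G1 //.
    by rewrite mulf_neq0 ?F3 ?G3.
  - move=> w [w1 w2].
    rewrite (eq_big_seq (fun B => b B * ((F 1%N B).[w.1] * (G 1%N B).[w.2]))).
      rewrite (@horner_prod_sum _ _ 2).
        by apply: big1 => i _; apply: big1 => j _; rewrite relb mul0r.
      by move=> B Bla; have [_ ? _] := hatF B Bla; have [_ ? _] := hatG B Bla.
    move=> B Bla; have [F1 _ _] := hatF B Bla; have [G1 _ _] := hatG B Bla.
    by rewrite /bspline F1 // G1.
pose p := s.*2.+1.
pose I := [seq (i, j) | i <- iota 0 s.+1, j <- iota 0 s.+1].
pose L : seq (seq R * seq R) := undup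
  [seq (knot_lift s ij.1 B.1, knot_lift s ij.2 B.2) | B <- la, ij <- I].
have LP B : B \in L <-> exists B1 i j,
    [/\ B1 \in la, (i <= s)%N, (j <= s)%N & B = (knot_lift s i B1.1, knot_lift s j B1.2)].
  rewrite mem_undup; split.
    move=> /allpairsP[[B1 ij] [B1la /allpairsP[[i j] [+ + ijE]] ->]].
    rewrite !mem_iota !add0n !ltnS => is_ js.
    by exists B1, i, j; split=> //; rewrite ijE.
  move=> [B1 [i [j [B1la is_ js ->]]]]; apply/allpairsP; exists (B1, (i, j)).
  by split=> //; apply/allpairsP; exists (i, j); rewrite !mem_iota !add0n !ltnS.
have polyF B : B \in L -> (forall t, z.1 < t < z1 -> bspline1 p B.1 t = (F p B).[t]) /\
    (forall t, z.2 < t < z2 -> bspline1 p B.2 t = (G p B).[t]).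
  move=> /LP[B1 [i [j [/laP[Bl a1 a2] is_ js ->]]]].
  have [s1 t1] := triple _ Vert Bl; have [s2 t2] := triple _ Hor Bl; split.
    by have [? []] := lift_local_poly is_ s1 t1 a1 (g1 _ Bl).
  by have [? []] := lift_local_poly js s2 t2 a2 (g2 _ Bl).
have szL : (size L <= s.*2.+2 * s.*2.+2)%N.
  apply: leq_trans (size_undup _) _; rewrite size_allpairs size_allpairs !size_iota.
  apply: leq_trans (leq_mul la4 (leqnn _)) _.
  by rewrite -doubleS -mul2n mulnACA.
have liftE B : S B -> exists B1 i j, [/\ B1 \in l, (i <= s)%N, (j <= s)%N &
    B = (knot_lift s i B1.1, knot_lift s j B1.2)].
  move=> /liftS[B1 B1l li]; have [i is_ E1] := li Vert; have [j js E2] := li Hor.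
  by exists B1, i, j; split=> //; rewrite -E1 -E2; case: (B).
have SL B : S B -> bspline (rm_degree s) B z != 0 -> B \in L.
  move=> /liftE[B1 [i [j [B1l is_ js ->]]]] nz; apply/LP; exists B1, i, j; split=> //.
  have [s1 t1] := triple _ Vert B1l; have [s2 t2] := triple _ Hor B1l.
  rewrite mem_undup mem_filter B1l andbT /act; move: nz; apply: contraNT.
  rewrite negb_and /bspline => /orP[n1|n2].
    by rewrite lift_inactive ?mul0r.
  by rewrite [X in _ * X]lift_inactive ?mulr0.
have SV B w : S B -> B \notin L -> V w -> bspline (rm_degree s) B w = 0.
  move=> /liftE[B1 [i [j [B1l is_ js BE]]]] nL [w1 w2].
  have [s1 t1] := triple _ Vert B1l; have [s2 t2] := triple _ Hor B1l.
  have : ~~ act B1.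
    apply: contra nL => aB1; apply/LP; exists B1, i, j; split=> //.
    by rewrite mem_undup mem_filter aB1.
  rewrite negb_and BE /bspline => /orP[n1|n2].
    by rewrite lift_inactive ?mul0r // (active_gap s1 (g1 _ B1l) w1).
  by rewrite [X in _ * X]lift_inactive ?mulr0 // (active_gap s2 (g2 _ B1l) w2).
(* [B0] is a lift of a B-spline active at [z], whose knots lie in the rectangle; the strict bound
   comes from the half-open supports. *)
have zM d : sel d (corner0 M) <= sel d z < sel d (corner1 M).
  have /LP[B1 [_ [_ [/laP[B1l a1 a2] _ _ _]]]] := SL _ (sqS _ B0sq).1 B0z.
  have ad : active (sel d z) (sel d B1) by case: (d).
  have [sz _] := triple _ d B1l; have [wB _] := wl _ B1l.
  case/andP: ad => y0 y2.
  have knot k : (k < 3)%N -> (sel d B1)`_k \in sel d B1.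
    by move=> k3; rewrite mem_nth // sz.
  have /andP[c0 _] := well_placed_range MM wB (knot 0%N isT).
  have /andP[_ c1] := well_placed_range MM wB (knot 2%N isT).
  by rewrite (le_trans c0 y0) (lt_le_trans y2 c1).
pose a' (B : seq R * seq R) := if B \in sq then a B else 0.
suff : a' B0 = 0 by rewrite /a' B0sq.
apply: (@independent_of_spanning R _ s.*2.+2 L (F p) (G p)) => //.
- move=> phi phiL; apply: (rm_chain_spanning ch zM) => B F' G' Bl.
  rewrite /piece; case: ifP => [a1 [q1 sq1 ->]|_ ->] => [|_]; last first.
    by rewrite (additive_form0 (form_linl phi G')).
  case: ifP => [a2 [q2 sq2 ->]|_ ->]; last first.
    by rewrite (additive_form0 (form_linr phi _)).
  have [s1 t1] := triple _ Vert Bl; have [s2 t2] := triple _ Hor Bl.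
  have [qF [qFE qFo]] := lift_orders s s1 t1 a1 (g1 _ Bl).
  have [qG [qGE qGo]] := lift_orders s s2 t2 a2 (g2 _ Bl).
  apply: (span_of_orders (additive_form_mul _ (form_linl phi _)) qFo _ sq1) => i is_.
  apply: (span_of_orders (additive_form_mul _ (form_linr phi _)) qGo _ sq2) => j js.
  rewrite -qFE // -qGE //; apply: (phiL (knot_lift s i B.1, knot_lift s j B.2)).
  apply/LP; exists B, i, j; split=> //.
  by rewrite mem_undup mem_filter Bl /act a1 a2.
- apply: (@coef_relations _ L _ a' (F p) (G p) z (z1, z2)) => // t t' tz t'z.
  have Vt : V (t, t') by [].
  rewrite -[RHS](rel _ (VU _ Vt)).
  (* Both sums reduce to the common elements of [L] and [sq]: [a'] vanishes outside [sq], and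
     members of [sq] outside [L] vanish on [V]. *)
  transitivity (\sum_(B <- L | B \in sq) a B * bspline (rm_degree s) B (t, t')).
    rewrite [RHS]big_mkcond; apply: eq_big_seq => B BL.
    have [F1 G1] := polyF B BL; rewrite /a'; case: ifP => _; last by rewrite mul0r.
    by rewrite /bspline F1 // G1.
  transitivity (\sum_(B <- sq | B \in L) a B * bspline (rm_degree s) B (t, t')).
    rewrite -big_filter -[RHS]big_filter; apply: perm_big; apply: uniq_perm.
    + by rewrite filter_uniq // undup_uniq.
    + by rewrite filter_uniq.
    + by move=> B; rewrite !mem_filter andbC.
  rewrite big_mkcond; apply: eq_big_seq => B Bsq; case: ifPn => // nL.
  by rewrite (SV B) ?mulr0 //; exact: (sqS B Bsq).1.
- exact: SL (sqS _ B0sq).1 B0z.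
Qed.

End LocalIndependence.

Theorem proposition1 (R : realType) (M : mesh R) (s : nat)
  (hM : admissible 0 M) : admissible s (raise_mesh s M).
Proof.
have [[S0 lr0] rm0 indep] := hM; rewrite raise_mesh_rm_mesh //.
split; [|exact: rm_mesh_multiplicities|move=> S lrS].
  have M1 : internal_mult_le 1 M.
    by move=> g ig; case: (posnP (mult M g)) => [->//|/rm0[_ ->]].
  have [l ch _] := rm_chain_of_lr_mesh (@is_lift_shadow R s) lr0 M1.
  by exists [set` l]; exact: rm_chain_lr_mesh ch.
(* The conversion back to (1,1), from an arbitrary run for bidegree (p,p). It ends on [M] itself,
   because [rm_mesh 0] restores the multiplicities of [M]; so the hypothesis of local independence
   applies to [l]. *)
have [l ch rS] := rm_chain_of_lr_mesh (@consecutive_triple_shadow R s) lrS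
  (@internal_mult_le_rm_mesh R s M).
have liftS := lr_mesh_sub_lift lrS (@rm_mesh_multiplicities R s M) rS.
rewrite rm_mesh_rm_mesh rm_mesh_id // in ch.
have indepM := indep _ (rm_chain_lr_mesh ch).
exact: (lift_locally_linearly_independent ch indepM liftS).
Qed.
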